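(* There is an algorithm which, given a marriage instance $T$ with $n$ agents, a stable table $T'\subseteq T$, and $\rho\in R_X(T')$, in time $O(n^2)$ outputs a set $R=\{\rho_1,\dots,\rho_k\}$ satisfying (i) $R\subseteq R_X(T^* )\setminus R_X(T')$ where $T^*=T'\cup\bigcup_{j=1}^kE(\rho_j)$, and (ii) $M_X^{T'}/R(\rho)/\rho=M_X^{T'}/R(\rho)/R$, if such a set exists, and outputs $\{\rho\}$ otherwise (i.e., it solves the problem \texttt{DR}).
   Context: Marriage instance: agents partitioned into $X,Y$, each agent has a strict preference order $>_z$ over its acceptable agents of the other side, acceptability symmetric; acceptable pairs are edges. Matchings, $M(z)$ (partner or $\emptyset$, with $\emptyset$ least preferred), blocking edges and stable matchings as usual; $\mathcal{S}(U)$ is the set of stable matchings of a table $U$. A subtable is a subset of the edges with induced orders; a stable table is one whose every edge belongs to some stable matching of it. $M\preceq_X M'$ if every $x\in X$ weakly prefers $M'$ to $M$; $M_X^{T'}$ is the maximum of $(\mathcal{S}(T'),\preceq_X)$. A generalized $X$-rotation exposed in matching $M$ within table $U$: sequence $(x_0,y_0),\dots,(x_{r-1},y_{r-1})$ of distinct agents, indices mod $r$, with $x_iy_i\in M$, $x_iy_{i+1}\in U$, $x_i>_{y_{i+1}}x_{i+1}$, $y_i>_{x_i}y_{i+1}$. It is an $X$-rotation of $U$ exposed in $M\in\mathcal{S}(U)$ if additionally $M(y)>_yx_i$ for all $y$ with $x_iy\in U$ and $y_i>_{x_i}y>_{x_i}y_{i+1}$. $M/\rho$: $x_i$ rematched to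 $y_{i+1}$; $M/R$ for a set $R$: successive elimination in an order in which each element is exposed in the current matching. $E(\rho)=\{x_iy_i,x_iy_{i+1}\}_i$. $R_X(T')$: $X$-rotations of $T'$ exposed in some stable matching of $T'$. For $\rho\in R_X(T')$, $R(\rho)$ is the set of $\rho'\ne\rho$ in $R_X(T')$ that precede $\rho$ in every sequence of successive eliminations of exposed rotations starting from $M_X^{T'}$ containing both; $M_X^{T'}/R(\rho)$ is the stable matching obtained by eliminating them, in which $\rho$ is exposed. *)

(* Defs.v *)
From mathcomp Require Import all_boot.

Set Implicit Arguments.
Unset Strict Implicit.
Unset Printing Implicit Defensive.

(* A strict preference order over the acceptable agents is the duplicate-free
   list of those agents, most preferred first. *)
Record instance (X Y : finType) := Instance {
  prefX : X -> seq Y;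
  prefY : Y -> seq X;
  prefX_uniq : forall x, uniq (prefX x);
  prefY_uniq : forall y, uniq (prefY y);
  accept_sym : forall x y, (y \in prefX x) = (x \in prefY y)
}.

(* [None] stands for being unmatched: it ranks below every acceptable agent. *)
Definition rank (A : eqType) (l : seq A) (o : option A) : nat :=
  if o is Some a then index a l else size l.

Definition prefers (A : eqType) (l : seq A) (a b : option A) : Prop :=
  rank l a < rank l b.

Section Marriage.
Variables (X Y : finType) (T : instance X Y).

Implicit Types (U M N : {set X * Y}) (rho : seq (X * Y)) (R : seq (seq (X * Y))).

Definition edges : {set X * Y} := [set e | e.2 \in prefX T e.1].

Definition is_matching M : Prop :=
  (forall x y y', (x, y) \in M -> (x, y') \in M -> y = y') /\
  (forall x x' y, (x, y) \in M -> (x', y) \in M -> x = x').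

Definition mateX M (x : X) : option Y := [pick y | (x, y) \in M].
Definition mateY M (y : Y) : option X := [pick x | (x, y) \in M].

Definition blocks M (x : X) (y : Y) : Prop :=
  prefers (prefX T x) (Some y) (mateX M x) /\
  prefers (prefY T y) (Some x) (mateY M y).

(* M belongs to S(U). *)
Definition stable U M : Prop :=
  [/\ M \subset U, is_matching M &
      forall x y, (x, y) \in U -> ~ blocks M x y].

Definition stable_table U : Prop :=
  forall e, e \in U -> exists2 M, stable U M & e \in M.

Definition leX M N : Prop :=
  forall x, rank (prefX T x) (mateX N x) <= rank (prefX T x) (mateX M x).

(* M is the matching M_X^U. *)
Definition X_optimal U M : Prop :=
  stable U M /\ (forall N, stable U N -> leX N M).

(* For e = (x_i, y_i) in rho, [next rho e] is (x_{i+1}, y_{i+1}), the index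
   being taken modulo r. *)
Definition gen_exposed U M rho : Prop :=
  [/\ rho != [::], uniq (map fst rho), uniq (map snd rho) &
      forall e, e \in rho ->
        [/\ e \in M,
            (e.1, (next rho e).2) \in U,
            prefers (prefY T (next rho e).2) (Some e.1) (Some (next rho e).1) &
            prefers (prefX T e.1) (Some e.2) (Some (next rho e).2)]].

Definition exposed U M rho : Prop :=
  [/\ stable U M, gen_exposed U M rho &
      forall e y, e \in rho -> (e.1, y) \in U ->
        prefers (prefX T e.1) (Some e.2) (Some y) ->
        prefers (prefX T e.1) (Some y) (Some (next rho e).2) ->
        prefers (prefY T y) (mateY M y) (Some e.1)].

(* rho belongs to R_X(U). *)
Definition is_rotation U rho : Prop := exists M, exposed U M rho.

(* A rotation is a cyclic sequence: its starting index is immaterial. *)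
Definition same_rotation rho rho' : Prop := exists k, rho' = rot k rho.

Definition in_rotations R rho : Prop :=
  exists2 rho', rho' \in R & same_rotation rho rho'.

Definition distinct_rotations R : Prop :=
  forall i j, i < size R -> j < size R ->
    same_rotation (nth [::] R i) (nth [::] R j) -> i = j.

Definition moved rho : {set X * Y} := [set (e.1, (next rho e).2) | e in rho].

(* M / rho *)
Definition elim M rho : {set X * Y} := (M :\: [set e in rho]) :|: moved rho.

(* E(rho) *)
Definition rot_edges rho : {set X * Y} := [set e in rho] :|: moved rho.

(* Eliminating the members of R from M in the listed order, each being exposed
   in U when its turn comes, yields N. *)
Fixpoint elim_seq U M R N : Prop :=
  if R is rho :: R' then exposed U M rho /\ elim_seq U (elim M rho) R' N
  else N = M.

(* N = M / P for a set P of rotations, given as a predicate. *)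
Definition elim_set U M (P : seq (X * Y) -> Prop) N : Prop :=
  exists R, [/\ distinct_rotations R,
                (forall rho, in_rotations R rho <-> P rho) &
                elim_seq U M R N].

(* rho' belongs to R(rho), within R_X(U). *)
Definition predecessor U rho rho' : Prop :=
  [/\ is_rotation U rho', ~ same_rotation rho rho' &
      forall M N R i j, X_optimal U M -> elim_seq U M R N ->
        i < size R -> j < size R ->
        same_rotation rho' (nth [::] R i) ->
        same_rotation rho (nth [::] R j) -> i < j].

(* T^* *)
Definition extended_table U R : {set X * Y} :=
  U :|: \bigcup_(rho <- R) rot_edges rho.

(* Conditions (i) and (ii) on R, for the table U (the T' of the problem). The
   inclusion in [edges] records that T^* is a subtable of T. *)
Definition dissecting U rho R : Prop :=
  [/\ distinct_rotations R,
      extended_table U R \subset edges,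
      (forall rho', rho' \in R ->
         is_rotation (extended_table U R) rho' /\ ~ is_rotation U rho') &
      exists M0 M,
        [/\ X_optimal U M0,
            elim_set U M0 (predecessor U rho) M,
            exposed U M rho &
            elim_set (extended_table U R) M (in_rotations R) (elim M rho)]].

Definition solves_DR U rho R : Prop :=
  ((exists R', dissecting U rho R') -> dissecting U rho R) /\
  (~ (exists R', dissecting U rho R') -> R = [:: rho]).

End Marriage.

(* Programs of a word RAM, in structured form. The memory consists of arrays
   named by natural numbers; since names are literal in a program, a program
   uses a fixed number of arrays (interleaving them gives a single memory). *)
Definition store := nat -> nat -> nat.

Inductive expr :=
| Const of nat
| Read of nat & expr           (* array name, index *)
| Add of expr & expr
| Sub of expr & expr           (* truncated at 0 *)
| Mul of expr & expr
| Eq of expr & expr            (* 1 if true, 0 if false *)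
| Lt of expr & expr.           (* 1 if true, 0 if false *)

Inductive cmd :=
| Skip
| Write of nat & expr & expr   (* array name, index, value *)
| Seq of cmd & cmd
| If of expr & cmd & cmd
| While of expr & cmd.

Section Semantics.
Variable W : nat. (* machine words range over 0, ..., W - 1 *)

(* Evaluation is undefined as soon as some value does not fit in a word. *)
Definition word (v : nat) : option nat := if v < W then Some v else None.

Fixpoint eval (s : store) (e : expr) : option nat :=
  let binop op e1 e2 :=
    if (eval s e1, eval s e2) is (Some v1, Some v2) then word (op v1 v2)
    else None in
  match e with
  | Const v => word v
  | Read a e1 => if eval s e1 is Some i then word (s a i) else None
  | Add e1 e2 => binop addn e1 e2
  | Sub e1 e2 => binop subn e1 e2
  | Mul e1 e2 => binop muln e1 e2
  | Eq e1 e2 => binop (fun u v => nat_of_bool (u == v)) e1 e2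
  | Lt e1 e2 => binop (fun u v => nat_of_bool (u < v)) e1 e2
  end.

Fixpoint cost (e : expr) : nat :=
  match e with
  | Const _ => 1
  | Read _ e1 => (cost e1).+1
  | Add e1 e2 | Sub e1 e2 | Mul e1 e2 | Eq e1 e2 | Lt e1 e2 =>
      (cost e1 + cost e2).+1
  end.

Definition update (s : store) (a i v : nat) : store :=
  fun b j => if (b == a) && (j == i) then v else s b j.

(* [exec p s t s']: started in s, p halts in s' after t elementary steps. *)
Inductive exec : cmd -> store -> nat -> store -> Prop :=
| ExecSkip s : exec Skip s 1 s
| ExecWrite s a e1 e2 i v :
    eval s e1 = Some i -> eval s e2 = Some v ->
    exec (Write a e1 e2) s (cost e1 + cost e2).+1 (update s a i v)
| ExecSeq p1 p2 s1 s2 s3 t1 t2 :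
    exec p1 s1 t1 s2 -> exec p2 s2 t2 s3 ->
    exec (Seq p1 p2) s1 (t1 + t2).+1 s3
| ExecIf e p1 p2 s s' v t :
    eval s e = Some v -> exec (if v != 0 then p1 else p2) s t s' ->
    exec (If e p1 p2) s (cost e + t).+1 s'
| ExecWhileStop e p s :
    eval s e = Some 0 -> exec (While e p) s (cost e).+1 s
| ExecWhileStep e p s1 s2 s3 v t1 t2 :
    eval s1 e = Some v -> v != 0 ->
    exec p s1 t1 s2 -> exec (While e p) s2 t2 s3 ->
    exec (While e p) s1 (cost e + t1 + t2).+1 s3.

End Semantics.

Definition pad (m : nat) (l : seq nat) : seq nat := l ++ nseq (m - size l) 0.

(* Initial memory; every cell not listed is 0.
   array 0: |X|, |Y|, length of rho
   array 1: length of the list of each x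
   array 2: |X| x |Y| matrix, by rows; row x is the list of x, padded with 0
   array 3: length of the list of each y
   array 4: |Y| x |X| matrix, by rows; row y is the list of y, padded with 0
   array 5: |X| x |Y| matrix, by rows; 0/1 incidence matrix of the subtable U
   array 6: the x_i of rho
   array 7: the y_i of rho *)
Definition input (p q : nat) (T : instance 'I_p 'I_q)
    (U : {set 'I_p * 'I_q}) (rho : seq ('I_p * 'I_q)) : store :=
  let arrays :=
    [:: [:: p; q; size rho];
        [seq size (prefX T x) | x <- enum 'I_p];
        flatten [seq pad q [seq val y | y <- prefX T x] | x <- enum 'I_p];
        [seq size (prefY T y) | y <- enum 'I_q];
        flatten [seq pad p [seq val x | x <- prefY T y] | y <- enum 'I_q];
        [seq nat_of_bool ((x, y) \in U) | x <- enum 'I_p, y <- enum 'I_q];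
        [seq val e.1 | e <- rho];
        [seq val e.2 | e <- rho]] in
  fun a i => nth 0 (nth [::] arrays a) i.

(* The set R = {rho_1, ..., rho_k} is read off the final memory:
   array 8:  k
   array 9:  the lengths of rho_1, ..., rho_k
   array 10: the x-components of rho_1, ..., rho_k, concatenated
   array 11: the y-components of rho_1, ..., rho_k, concatenated *)
Definition outputs (p q : nat) (s : store)
    (R : seq (seq ('I_p * 'I_q))) : Prop :=
  [/\ s 8 0 = size R,
      mkseq (s 9) (size R) = [seq size rho | rho <- R],
      mkseq (s 10) (size (flatten R)) = [seq val e.1 | e <- flatten R] &
      mkseq (s 11) (size (flatten R)) = [seq val e.2 | e <- flatten R]].

(* Main.v *)
From Stdlib Require Import Classical.
Require Import Defs.
From mathcomp Require Import all_boot zify.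

Set Implicit Arguments.
Unset Strict Implicit.
Unset Printing Implicit Defensive.

(** Let M be the matching M_X^{T'} / R(rho) and N = M / rho. A matching met
    while passing from M to N moves only the agents of rho, each between its
    two partners, so besides T' it can only use the edges of T strictly
    between both pairs of partners: call this set the gap of rho. Adding the
    whole gap to T' keeps M and N stable, so M is joined to N by successive
    rotations of the enlarged table. By the dichotomy "a stable matching lies
    entirely before or entirely after a rotation" none of these is a rotation
    of T' unless the chain is rho alone, which happens exactly when the gap is
    empty, and then no admissible set R exists. The chain is produced by
    walking in the functional graph of exposed rotations with a stack; the
    list of each agent x is scanned once, whence the quadratic time bound.

    R(rho) itself is read off a chain from M_X^{T'} to the X-best stable
    matching in which rho is exposed. *)

(** * Ranks and the lattice of stable matchings *)

Section Theory.
Variables (X Y : finType) (T : instance X Y).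
Implicit Types (U M N P Q : {set X * Y}) (rho sigma tau : seq (X * Y)).
Implicit Types (x : X) (y : Y) (e f g : X * Y).

(** Matchings are compared through ranks, a small rank being a good one. The walk cannot get lost
    because interests are opposite: if N makes x worse off than P does, then the first y that would
    leave its partner in P for x is better off in N, so that partner has to move as well. The
    successor function thus maps the agents still short of N to themselves; a walk must close up,
    and its cycle is an exposed rotation. Usable edges of the enlarged table are recognised by a
    window of ranks on each side. The windows are empty outside [rho], so the program works with the
    partners and ranks of the agents of [rho] alone.

    Two demands of the specification shape the details. The fallback answer is the list [rho]
    itself, not a cyclic shift of it; hence the first walk starts at the head of [rho], and the
    invariant follows that head. Words of the machine are bounded by a polynomial; hence only values
    are written that exceed the stored ones by at most one, and the running time then bounds every
    number that occurs. *)

Definition posX x y := index y (prefX T x).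
Definition posY y x := index x (prefY T y).
Definition rankX P x := rank (prefX T x) (mateX P x).
Definition rankY P y := rank (prefY T y) (mateY P y).

(* [next] retyped, so that its components are syntactically in [X] and [Y]. *)
Definition nxt sigma e : X * Y := next sigma e.

Lemma mem_nxt sigma e : (nxt sigma e \in sigma) = (e \in sigma).
Proof. exact: mem_next. Qed.

Lemma prev_nxt sigma : uniq sigma -> cancel (nxt sigma) (prev sigma).
Proof. exact: prev_next. Qed.

Lemma nxt_prev sigma : uniq sigma -> cancel (prev sigma) (nxt sigma).
Proof. exact: next_prev. Qed.

Lemma mem_fstP sigma x : x \in map fst sigma -> exists2 e : X * Y, e \in sigma & x = e.1.
Proof. by case/mapP=> e; exists e. Qed.

Lemma mem_sndP sigma y : y \in map snd sigma -> exists2 e : X * Y, e \in sigma & y = e.2.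
Proof. by case/mapP=> e; exists e. Qed.

Lemma mem_edges x y : ((x, y) \in edges T) = (y \in prefX T x).
Proof. by rewrite inE. Qed.

Lemma mem_edgesY x y : ((x, y) \in edges T) = (x \in prefY T y).
Proof. by rewrite inE accept_sym. Qed.

Lemma posX_inj x y y' : (x, y) \in edges T -> posX x y = posX x y' -> y = y'.
Proof.
rewrite mem_edges /posX => h1 E.
have h2 : y' \in prefX T x by rewrite -index_mem -E index_mem.
by rewrite -(nth_index y h1) E nth_index.
Qed.

Lemma posY_inj y x x' : (x, y) \in edges T -> posY y x = posY y x' -> x = x'.
Proof.
rewrite mem_edgesY /posY => h1 E.
have h2 : x' \in prefY T y by rewrite -index_mem -E index_mem.
by rewrite -(nth_index x h1) E nth_index.
Qed.

Lemma mateX_in P x y : is_matching P -> (x, y) \in P -> mateX P x = Some y.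
Proof.
case=> h _ hxy; rewrite /mateX; case: pickP => [y' h'|/(_ y)]; last by rewrite hxy.
by rewrite (h _ _ _ h' hxy).
Qed.

Lemma mateY_in P x y : is_matching P -> (x, y) \in P -> mateY P y = Some x.
Proof.
case=> _ h hxy; rewrite /mateY; case: pickP => [y' h'|/(_ x)]; last by rewrite hxy.
by rewrite (h _ _ _ h' hxy).
Qed.

Lemma rankX_in P x y : is_matching P -> (x, y) \in P -> rankX P x = posX x y.
Proof. by move=> mP h; rewrite /rankX (mateX_in mP h). Qed.

Lemma rankY_in P x y : is_matching P -> (x, y) \in P -> rankY P y = posY y x.
Proof. by move=> mP h; rewrite /rankY (mateY_in mP h). Qed.

Lemma rankX_le P x : rankX P x <= size (prefX T x).
Proof. by rewrite /rankX; case: mateX => //= y; apply: index_size. Qed.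

Lemma rankY_le P y : rankY P y <= size (prefY T y).
Proof. by rewrite /rankY; case: mateY => //= x; apply: index_size. Qed.

Lemma rankX_mate P x : rankX P x < size (prefX T x) -> {y | (x, y) \in P}.
Proof.
by rewrite /rankX /mateX; case: pickP => [y h _|_] /=; [exists y | rewrite ltnn].
Qed.

Lemma rankY_mate P y : rankY P y < size (prefY T y) -> {x | (x, y) \in P}.
Proof.
by rewrite /rankY /mateY; case: pickP => [x h _|_] /=; [exists x | rewrite ltnn].
Qed.

Lemma rankX_inj P x y : P \subset edges T -> is_matching P ->
  (x, y) \in edges T -> rankX P x = posX x y -> (x, y) \in P.
Proof.
move=> sP mP hxy E.
have lt : rankX P x < size (prefX T x) by rewrite E /posX /posY index_mem -mem_edges.
have [y' h] := rankX_mate lt.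
by move: E; rewrite (rankX_in mP h) => /(posX_inj (subsetP sP _ h)) <-.
Qed.

Lemma rankY_inj P x y : P \subset edges T -> is_matching P ->
  (x, y) \in edges T -> rankY P y = posY y x -> (x, y) \in P.
Proof.
move=> sP mP hxy E.
have lt : rankY P y < size (prefY T y) by rewrite E /posX /posY index_mem -mem_edgesY.
have [x' h] := rankY_mate lt.
by move: E; rewrite (rankY_in mP h) => /(posY_inj (subsetP sP _ h)) <-.
Qed.

Lemma eq_matching P Q : P \subset edges T -> Q \subset edges T ->
  is_matching P -> is_matching Q -> (forall x, rankX P x = rankX Q x) -> P = Q.
Proof.
move=> sP sQ mP mQ E; apply/setP=> -[x y]; apply/idP/idP=> h.
  by apply: rankX_inj => //; [exact: (subsetP sP) | rewrite -E (rankX_in mP h)].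
by apply: rankX_inj => //; [exact: (subsetP sQ) | rewrite E (rankX_in mQ h)].
Qed.

Section Table.
Variable U : {set X * Y}.
Hypothesis sU : U \subset edges T.

Lemma stable_sub P : stable T U P -> P \subset edges T.
Proof. by case=> s _ _; apply: subset_trans s sU. Qed.

Lemma stable_match P : stable T U P -> is_matching P.
Proof. by case. Qed.

Lemma stable_noblock P x y : stable T U P -> (x, y) \in U ->
  posX x y < rankX P x -> posY y x < rankY P y -> False.
Proof. by case=> _ _ h hxy h1 h2; apply: (h x y hxy). Qed.

(* Counting: P injects the agents x better off in P into the agents y better
   off in Q, and Q injects the latter back into the former. *)
Lemma decomposition P Q : stable T U P -> stable T U Q ->
  (forall x, rankX P x < rankX Q x -> exists y y',
     [/\ (x, y) \in P, (x, y') \in Q, rankY Q y < rankY P y & rankY Q y' < rankY P y']) /\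
  (forall y, rankY Q y < rankY P y -> exists x x',
     [/\ (x, y) \in P, (x', y) \in Q, rankX P x < rankX Q x & rankX P x' < rankX Q x']).
Proof.
move=> stP stQ.
have [sP sQ] := (stable_sub stP, stable_sub stQ).
have [mP mQ] := (stable_match stP, stable_match stQ).
pose A := [set x | rankX P x < rankX Q x]; pose B := [set y | rankY Q y < rankY P y].
have PA x : x \in A -> exists2 y, mateX P x = Some y & y \in B.
  rewrite inE => lt.
  have [y h] : {y | (x, y) \in P} by apply: rankX_mate; apply: leq_trans (rankX_le Q x).
  have hU : (x, y) \in U by case: stP => s _ _; apply: (subsetP s).
  exists y; first exact: mateX_in.
  rewrite inE ltnNge; apply/negP=> le; rewrite (rankX_in mP h) in lt.
  apply: (stable_noblock stQ hU lt); rewrite (rankY_in mP h) in le.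
  rewrite ltn_neqAle le andbT; apply/eqP=> E.
  have := rankY_inj sQ mQ (subsetP sU _ hU) (esym E).
  by move/(rankX_in mQ) => E'; rewrite E' ltnn in lt.
have QB y : y \in B -> exists2 x, mateY Q y = Some x & x \in A.
  rewrite inE => lt.
  have [x h] : {x | (x, y) \in Q} by apply: rankY_mate; apply: leq_trans (rankY_le P y).
  have hU : (x, y) \in U by case: stQ => s _ _; apply: (subsetP s).
  exists x; first exact: mateY_in.
  rewrite inE ltnNge; apply/negP=> le; rewrite (rankY_in mQ h) in lt.
  apply: (fun h' => stable_noblock stP hU h' lt); rewrite (rankX_in mQ h) in le.
  rewrite ltn_neqAle le andbT; apply/eqP=> E.
  have := rankX_inj sP mP (subsetP sU _ hU) (esym E).
  by move/(rankY_in mP) => E'; rewrite E' ltnn in lt.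
have mateXP x y : mateX P x = Some y -> (x, y) \in P.
  by rewrite /mateX; case: pickP => // y' h [<-].
have mateYQ x y : mateY Q y = Some x -> (x, y) \in Q.
  by rewrite /mateY; case: pickP => // y' h [<-].
have cA : #|mateX P @: A| = #|A|.
  apply: card_in_imset => x x' /PA [y h _] /PA [y' h' _]; rewrite h h' => -[E].
  by move: h h'; rewrite E => /mateXP h /mateXP h'; case: mP => _ /(_ _ _ _ h h').
have cB : #|mateY Q @: B| = #|B|.
  apply: card_in_imset => x x' /QB [y h _] /QB [y' h' _]; rewrite h h' => -[E].
  by move: h h'; rewrite E => /mateYQ h /mateYQ h'; case: mQ => /(_ _ _ _ h h').
have sA : mateX P @: A \subset Some @: B.
  by apply/subsetP=> _ /imsetP [x /PA [y -> yB] ->]; apply: imset_f.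
have sB : mateY Q @: B \subset Some @: A.
  by apply/subsetP=> _ /imsetP [x /QB [y -> yB] ->]; apply: imset_f.
have cS (Z : finType) (C : {set Z}) : #|Some @: C| = #|C|.
  by apply: card_imset => a b [].
have lAB : #|A| <= #|B| by rewrite -cA -(cS _ B) subset_leq_card.
have lBA : #|B| <= #|A| by rewrite -cB -(cS _ A) subset_leq_card.
have eA : mateX P @: A = Some @: B.
  by apply/eqP; rewrite eqEcard sA cA cS.
have eB : mateY Q @: B = Some @: A.
  by apply/eqP; rewrite eqEcard sB cB cS.
split=> [x xA|y yB].
  have {}xA : x \in A by rewrite inE.
  have [y h yB] := PA _ xA.
  have : Some x \in Some @: A by apply: imset_f.
  rewrite -eB => /imsetP [y' yB' /esym h'].
  move: yB yB'; rewrite !inE => yB yB'.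
  by exists y, y'; split=> //; [apply: mateXP | apply: mateYQ].
have {}yB : y \in B by rewrite inE.
have [x h xA] := QB _ yB.
have : Some y \in Some @: B by apply: imset_f.
rewrite -eA => /imsetP [x' xA' /esym h'].
move: xA xA'; rewrite !inE => xA xA'.
by exists x', x; split=> //; [apply: mateXP | apply: mateYQ].
Qed.

(** [decomposition] names a partner in P, and uniqueness of partners identifies it with the given
    one. Along an edge of either matching the two ends have opposite interests. *)
Lemma trade_l P Q x y : stable T U P -> stable T U Q -> (x, y) \in P ->
  (rankX P x < rankX Q x) = (rankY Q y < rankY P y).
Proof.
move=> stP stQ h; have [h1 h2] := decomposition stP stQ.
have [mX mY] := stable_match stP.
apply/idP/idP=> [/h1 [y1 [_ [/mX/(_ h) -> //]]]|/h2 [x1 [_ [/mY/(_ h) -> //]]]].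
Qed.

Lemma trade_r P Q x y : stable T U P -> stable T U Q -> (x, y) \in Q ->
  (rankX P x < rankX Q x) = (rankY Q y < rankY P y).
Proof.
move=> stP stQ h; have [h1 h2] := decomposition stP stQ.
have [mX mY] := stable_match stQ.
apply/idP/idP.
  by move=> /h1 [_ [y1 [_ hy1 _]]]; rewrite (mX _ _ _ hy1 h).
by move=> /h2 [_ [x1 [_ hx1 _]]]; rewrite (mY _ _ _ hx1 h).
Qed.

Lemma stable_opposite P Q : stable T U P -> stable T U Q ->
  (forall x, rankX P x <= rankX Q x) -> forall y, rankY Q y <= rankY P y.
Proof.
move=> stP stQ le y; rewrite leqNgt; apply/negP=> lt.
have [_ /(_ y lt) [x [_ [_ _ lt' _]]]] := decomposition stQ stP.
by have := le x; lia.
Qed.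

(** A small rank is a good one, so [join] is the supremum for the order of X although it takes
    minima of ranks. *)
Definition join P Q := [set e | if rankX P e.1 <= rankX Q e.1 then e \in P else e \in Q].
Definition meet P Q := [set e | if rankX P e.1 <= rankX Q e.1 then e \in Q else e \in P].

Lemma in_join P Q x y :
  ((x, y) \in join P Q) = if rankX P x <= rankX Q x then (x, y) \in P else (x, y) \in Q.
Proof. by rewrite inE. Qed.

Lemma in_meet P Q x y :
  ((x, y) \in meet P Q) = if rankX P x <= rankX Q x then (x, y) \in Q else (x, y) \in P.
Proof. by rewrite inE. Qed.

(** * Joins and meets of stable matchings *)

Section Lattice.
Variables (P Q : {set X * Y}) (stP : stable T U P) (stQ : stable T U Q).

Let mP := stable_match stP.
Let mQ := stable_match stQ.
Let sP := stable_sub stP.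
Let sQ := stable_sub stQ.

Lemma equal_rankX x y : (x, y) \in P -> (rankX P x == rankX Q x) = ((x, y) \in Q).
Proof.
move=> h; apply/eqP/idP=> [E|h']; last by rewrite (rankX_in mP h) (rankX_in mQ h').
by apply: rankX_inj => //; [exact: (subsetP sP) | rewrite -E (rankX_in mP h)].
Qed.

Lemma equal_rankX' x y : (x, y) \in Q -> (rankX P x == rankX Q x) = ((x, y) \in P).
Proof.
move=> h; apply/eqP/idP=> [E|h']; last by rewrite (rankX_in mP h') (rankX_in mQ h).
by apply: rankX_inj => //; [exact: (subsetP sQ) | rewrite E (rankX_in mQ h)].
Qed.

Lemma join_matching : is_matching (join P Q).
Proof.
split=> [x y y'|x x' y]; rewrite !in_join.
  by case: leqP => _; [apply: mP.1 | apply: mQ.1].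
(* If z reaches y through P and z' reaches it through Q, opposite interests make y strictly prefer
   each of P and Q to the other. The only way out is that z has equal ranks, and then P and Q agree
   at z. *)
have mixed z z' : rankX P z <= rankX Q z -> rankX Q z' < rankX P z' ->
    (z, y) \in P -> (z', y) \in Q -> z = z'.
  move=> le lt h h'; case: (eqVneq (rankX P z) (rankX Q z)) => [/eqP|ne].
    by rewrite (equal_rankX h) => h''; apply: mQ.2 h'' h'.
  have lt' : rankX P z < rankX Q z by rewrite ltn_neqAle ne.
  rewrite (trade_l stP stQ h) in lt'; rewrite (trade_l stQ stP h') in lt; lia.
case: leqP => l1; case: leqP => l2 h1 h2; [exact: mP.2 h1 h2| | |exact: mQ.2 h1 h2].
  exact: mixed l1 l2 h1 h2.
by apply/esym; apply: mixed l2 l1 h2 h1.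
Qed.

Lemma meet_matching : is_matching (meet P Q).
Proof.
split=> [x y y'|x x' y]; rewrite !in_meet.
  by case: leqP => _; [apply: mQ.1 | apply: mP.1].
have mixed z z' : rankX P z <= rankX Q z -> rankX Q z' < rankX P z' ->
    (z, y) \in Q -> (z', y) \in P -> z = z'.
  move=> le lt h h'; case: (eqVneq (rankX P z) (rankX Q z)) => [/eqP|ne].
    by rewrite (equal_rankX' h) => h''; apply: mP.2 h'' h'.
  have lt' : rankX P z < rankX Q z by rewrite ltn_neqAle ne.
  rewrite (trade_r stP stQ h) in lt'; rewrite (trade_r stQ stP h') in lt; lia.
case: leqP => l1; case: leqP => l2 h1 h2; [exact: mQ.2 h1 h2| | |exact: mP.2 h1 h2].
  exact: mixed l1 l2 h1 h2.
by apply/esym; apply: mixed l2 l1 h2 h1.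
Qed.

Lemma rankY_unmatched (R : {set X * Y}) y : (forall x, (x, y) \notin R) ->
  rankY R y = size (prefY T y).
Proof.
move=> h; have := rankY_le R y; rewrite leq_eqVlt => /orP [/eqP //|/rankY_mate [x h']].
by have := h x; rewrite h'.
Qed.

Lemma rankX_join x : rankX (join P Q) x = minn (rankX P x) (rankX Q x).
Proof.
suff -> : rankX (join P Q) x = if rankX P x <= rankX Q x then rankX P x else rankX Q x.
  by case: leqP.
case: leqP => le; congr rank; apply: eq_pick => y;
  by rewrite /= in_join ?le ?(leqNgt (rankX P x)) ?le.
Qed.

Lemma rankX_meet x : rankX (meet P Q) x = maxn (rankX P x) (rankX Q x).
Proof.
suff -> : rankX (meet P Q) x = if rankX P x <= rankX Q x then rankX Q x else rankX P x.
  by case: leqP.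
case: leqP => le; congr rank; apply: eq_pick => y;
  by rewrite /= in_meet ?le ?(leqNgt (rankX P x)) ?le.
Qed.

Lemma rankY_join y : rankY (join P Q) y = maxn (rankY P y) (rankY Q y).
Proof.
case: (pickP [pred x | (x, y) \in join P Q]) => [x /= h|h].
  rewrite (rankY_in join_matching h); move: h; rewrite in_join; case: leqP => le h.
    rewrite -(rankY_in mP h); case: (eqVneq (rankX P x) (rankX Q x)) => [/eqP|ne].
      by rewrite (equal_rankX h) => h'; rewrite (rankY_in mP h) (rankY_in mQ h') maxnn.
    by have := trade_l stP stQ h; lia.
  by rewrite -(rankY_in mQ h); have := trade_l stQ stP h; lia.
rewrite rankY_unmatched; last by move=> x; have /= -> := h x.
apply/eqP; rewrite eqn_leq; apply/andP; split; last by have := rankY_le P y; have := rankY_le Q y; lia.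
(* If y had a partner in both matchings but none in the join, both partners would be drawn to the
   respective other matching, and y would strictly prefer P to Q and Q to P. *)
rewrite leqNgt gtn_max; apply/negP=> /andP [/rankY_mate [x hx] /rankY_mate [x' hx']].
have := h x; have := h x'; rewrite /= !in_join; case: leqP => l1; rewrite ?hx' // => _.
case: leqP => l2; rewrite ?hx // => h3.
case: (eqVneq (rankX P x') (rankX Q x')) => [/eqP|ne].
  by rewrite (equal_rankX' hx') => hh; move: l1 l2; rewrite (mP.2 _ _ _ hx hh); lia.
by have := trade_r stP stQ hx'; have := trade_r stQ stP hx; lia.
Qed.

Lemma rankY_meet y : rankY (meet P Q) y = minn (rankY P y) (rankY Q y).
Proof.
case: (pickP [pred x | (x, y) \in meet P Q]) => [x /= h|h].
  rewrite (rankY_in meet_matching h); move: h; rewrite in_meet; case: leqP => le h.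
    rewrite -(rankY_in mQ h); case: (eqVneq (rankX P x) (rankX Q x)) => [/eqP|ne].
      by rewrite (equal_rankX' h) => h'; rewrite (rankY_in mQ h) (rankY_in mP h') minnn.
    by have := trade_r stP stQ h; lia.
  by rewrite -(rankY_in mP h); have := trade_r stQ stP h; lia.
rewrite rankY_unmatched; last by move=> x; have /= -> := h x.
suff [hP hQ] : (forall x, (x, y) \notin P) /\ (forall x, (x, y) \notin Q).
  by rewrite !rankY_unmatched // minnn.
(* If the meet drops the edge xy of one matching, x prefers that matching, so y is better off in the
   other one. There [decomposition] gives y a partner who also prefers the former, and the meet
   keeps this edge. *)
split=> x; apply/negP=> hx; have := h x; rewrite /= in_meet hx; case: leqP => // le.
  move=> nQ; have ne : rankX P x != rankX Q x by rewrite (equal_rankX hx) nQ.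
  have : rankX P x < rankX Q x by rewrite ltn_neqAle ne.
  rewrite (trade_l stP stQ hx) => lt.
  have [_ /(_ y lt) [_ [x' [_ h' _ l']]]] := decomposition stP stQ.
  by have := h x'; rewrite /= in_meet (ltnW l') h'.
move: (le); rewrite (trade_l stQ stP hx) => lt _.
have [_ /(_ y lt) [_ [x' [_ h' _ l']]]] := decomposition stQ stP.
by have := h x'; rewrite /= in_meet leqNgt l' h'.
Qed.

Lemma join_stable : stable T U (join P Q).
Proof.
split=> [||x y hU].
- apply/subsetP=> -[x y]; rewrite in_join.
  by case: leqP => _; [case: stP | case: stQ] => /subsetP s _ _ /s.
- exact: join_matching.
move=> [l1 l2]; have {l1} : posX x y < rankX (join P Q) x := l1; have {l2} : posY y x < rankY (join P Q) y := l2.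
rewrite rankX_join rankY_join leq_min leq_max => h3 /andP [h1 h2].
by case/orP: h3 => h3; [apply: (stable_noblock stP hU) | apply: (stable_noblock stQ hU)].
Qed.

Lemma meet_stable : stable T U (meet P Q).
Proof.
split=> [||x y hU].
- apply/subsetP=> -[x y]; rewrite in_meet.
  by case: leqP => _; [case: stQ | case: stP] => /subsetP s _ _ /s.
- exact: meet_matching.
move=> [l1 l2]; have {l1} : posX x y < rankX (meet P Q) x := l1; have {l2} : posY y x < rankY (meet P Q) y := l2.
rewrite rankX_meet rankY_meet leq_min leq_max => /andP [h1 h2] h3.
by case/orP: h3 => h3; [apply: (stable_noblock stP hU) | apply: (stable_noblock stQ hU)].
Qed.

End Lattice.

Lemma exposed_stable P sigma : exposed T U P sigma -> stable T U P.
Proof. by case. Qed.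

(** * Elimination of an exposed rotation *)

Section Elim.
Variables (P : {set X * Y}) (sigma : seq (X * Y)).
Hypothesis ex : exposed T U P sigma.

Let stP := exposed_stable ex.
Let mP := stable_match stP.

Lemma exposed_uniq : uniq sigma.
Proof. by case: ex => _ [_ /map_uniq]. Qed.

Lemma exposed_ne : exists e : X * Y, e \in sigma.
Proof.
case: ex => _ [ne _ _ _] _; case: sigma ne => // e s _; exists e; exact: mem_head.
Qed.

Lemma exposed_in e : e \in sigma -> e \in P.
Proof. by case: ex => _ [_ _ _ h] _ /h []. Qed.

Lemma exposed_table e : e \in sigma -> (e.1, (nxt sigma e).2) \in U.
Proof. by case: ex => _ [_ _ _ h] _ /h []. Qed.

Lemma exposed_ltX e : e \in sigma -> posX e.1 e.2 < posX e.1 (nxt sigma e).2.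
Proof. by case: ex => _ [_ _ _ h] _ /h []. Qed.

Lemma exposed_ltY e : e \in sigma ->
  posY (nxt sigma e).2 e.1 < posY (nxt sigma e).2 (nxt sigma e).1.
Proof. by case: ex => _ [_ _ _ h] _ /h []. Qed.

Lemma exposed_gap e y : e \in sigma -> (e.1, y) \in U -> posX e.1 e.2 < posX e.1 y ->
  posX e.1 y < posX e.1 (nxt sigma e).2 -> rankY P y < posY y e.1.
Proof. by case: ex => _ _ h; apply: h. Qed.

Lemma exposed_inj1 e f : e \in sigma -> f \in sigma -> e.1 = f.1 -> e = f.
Proof.
case: e f => [x y] [x' y'] /exposed_in h /exposed_in h' /= E.
by rewrite -E in h' *; rewrite (mP.1 _ _ _ h h').
Qed.

Lemma exposed_inj2 e f : e \in sigma -> f \in sigma -> e.2 = f.2 -> e = f.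
Proof.
case: e f => [x y] [x' y'] /exposed_in h /exposed_in h' /= E.
by rewrite -E in h' *; rewrite (mP.2 _ _ _ h h').
Qed.

Lemma exposed_rankX e : e \in sigma -> rankX P e.1 = posX e.1 e.2.
Proof. by move=> h; apply: rankX_in => //; rewrite -surjective_pairing exposed_in. Qed.

Lemma exposed_rankY e : e \in sigma -> rankY P e.2 = posY e.2 e.1.
Proof. by move=> h; apply: rankY_in => //; rewrite -surjective_pairing exposed_in. Qed.

Lemma mem_moved x y : reflect (exists2 e : X * Y, e \in sigma & x = e.1 /\ y = (nxt sigma e).2)
  ((x, y) \in moved sigma).
Proof.
apply: (iffP imsetP) => [[e h [-> ->]]|[e h [-> ->]]]; by exists e.
Qed.

Lemma next_surj e : e \in sigma -> exists2 f : X * Y, f \in sigma & nxt sigma f = e.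
Proof.
by move=> h; exists (prev sigma e); rewrite ?mem_prev ?nxt_prev ?exposed_uniq.
Qed.

Lemma elim_matching : is_matching (elim P sigma).
Proof.
split=> [x y y'|x x' y]; rewrite /elim !in_setU !in_setD !inE.
  case/orP=> [/andP [n1 h1]|/mem_moved [e he [E1 E2]]];
  case/orP=> [/andP [n2 h2]|/mem_moved [f hf [F1 F2]]].
  - exact: mP.1 h1 h2.
  - case/negP: n1; have := exposed_in hf; rewrite (surjective_pairing f) -F1.
    by move=> h; rewrite (mP.1 _ _ _ h1 h) F1 -surjective_pairing.
  - case/negP: n2; have := exposed_in he; rewrite (surjective_pairing e) -E1.
    by move=> h; rewrite (mP.1 _ _ _ h2 h) E1 -surjective_pairing.
  by rewrite E2 F2 (exposed_inj1 he hf) // -E1.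
case/orP=> [/andP [n1 h1]|/mem_moved [e he [E1 E2]]];
case/orP=> [/andP [n2 h2]|/mem_moved [f hf [F1 F2]]].
- exact: mP.2 h1 h2.
- case/negP: n1; have hf' : nxt sigma f \in sigma by rewrite mem_nxt.
  have := exposed_in hf'; rewrite (surjective_pairing (nxt _ _)) -F2.
  by move=> h; rewrite (mP.2 _ _ _ h1 h) F2 -surjective_pairing.
- case/negP: n2; have he' : nxt sigma e \in sigma by rewrite mem_nxt.
  have := exposed_in he'; rewrite (surjective_pairing (nxt _ _)) -E2.
  by move=> h; rewrite (mP.2 _ _ _ h2 h) E2 -surjective_pairing.
have hf' : nxt sigma f \in sigma by rewrite mem_nxt.
have he' : nxt sigma e \in sigma by rewrite mem_nxt.
have E : nxt sigma e = nxt sigma f by apply: exposed_inj2; rewrite -?E2.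
by rewrite E1 F1 -(prev_nxt exposed_uniq e) E prev_nxt // exposed_uniq.
Qed.

Lemma elim_moved e : e \in sigma -> (e.1, (nxt sigma e).2) \in elim P sigma.
Proof. by move=> h; rewrite /elim in_setU; apply/orP; right; apply/mem_moved; exists e. Qed.

Lemma elim_keep x y : (x, y) \in P -> x \notin map fst sigma -> (x, y) \in elim P sigma.
Proof.
move=> h n; rewrite /elim in_setU in_setD h inE andbT; apply/orP; left.
by apply: contra n => /(map_f fst).
Qed.

Lemma rankX_elim_in e : e \in sigma -> rankX (elim P sigma) e.1 = posX e.1 (nxt sigma e).2.
Proof. by move=> h; apply: rankX_in (elim_moved h); apply: elim_matching. Qed.

Lemma rankY_elim_in e : e \in sigma ->
  rankY (elim P sigma) (nxt sigma e).2 = posY (nxt sigma e).2 e.1.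
Proof. by move=> h; apply: rankY_in (elim_moved h); apply: elim_matching. Qed.

Lemma rankX_elim_out x : x \notin map fst sigma -> rankX (elim P sigma) x = rankX P x.
Proof.
move=> n; congr rank; apply: eq_pick => y /=.
rewrite /elim in_setU in_setD inE; case: mem_moved => [[e he [E _]]|_].
  by rewrite E map_f in n.
rewrite orbF; case: (boolP ((x, y) \in sigma)) => //= h.
by move/(map_f fst): h; rewrite (negPf n).
Qed.

Lemma rankY_elim_out y : y \notin map snd sigma -> rankY (elim P sigma) y = rankY P y.
Proof.
move=> n; congr rank; apply: eq_pick => x /=.
rewrite /elim in_setU in_setD inE; case: mem_moved => [[e he [_ E]]|_].
  by rewrite E map_f ?mem_nxt in n.
rewrite orbF; case: (boolP ((x, y) \in sigma)) => //= h.
by move/(map_f snd): h; rewrite (negPf n).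
Qed.

Lemma elim_leX x : rankX P x <= rankX (elim P sigma) x.
Proof.
case: (boolP (x \in map fst sigma)) => [/mem_fstP [e he ->]|n]; last by rewrite rankX_elim_out.
by rewrite (rankX_elim_in he) (exposed_rankX he) ltnW // exposed_ltX.
Qed.

Lemma elim_leY y : rankY (elim P sigma) y <= rankY P y.
Proof.
case: (boolP (y \in map snd sigma)) => [/mem_sndP [e he ->]|n]; last by rewrite rankY_elim_out.
have [f hf <-] := next_surj he.
by rewrite (rankY_elim_in hf) exposed_rankY ?mem_nxt // ltnW // exposed_ltY.
Qed.

(** Agents of Y only gain, so a pair blocking [elim P sigma] already blocks P unless y ranges, for
    x, from its old partner to just before its new one. The old partner has moved to someone better,
    and the agents strictly between are excluded by the last clause of [exposed]. *)
Lemma elim_stable : stable T U (elim P sigma).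
Proof.
split=> [||x y hU [lX0 lY0]].
- apply/subsetP=> -[x y]; rewrite /elim in_setU in_setD.
  case/orP=> [/andP [_ h]|/mem_moved [e he [-> ->]]]; last exact: exposed_table.
  by case: stP => /subsetP s _ _; apply: s.
- exact: elim_matching.
have lX : posX x y < rankX (elim P sigma) x := lX0.
have lY : posY y x < rankY (elim P sigma) y := lY0.
have lX' : rankX P x <= posX x y.
  rewrite leqNgt; apply/negP=> h; apply: (stable_noblock stP hU h).
  exact: leq_trans lY (elim_leY y).
case: (boolP (x \in map fst sigma)) => [/mem_fstP [e he Ex]|n]; last first.
  by rewrite rankX_elim_out // in lX; move: lX'; rewrite leqNgt lX.
move: lX lX' lY hU; rewrite {}Ex rankX_elim_in // exposed_rankX // => lX lX' lY hU.
move: lX'; rewrite leq_eqVlt => /orP [/eqP E|lt].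
  have eU : (e.1, e.2) \in edges T.
    by rewrite -surjective_pairing (subsetP (stable_sub stP)) ?exposed_in.
  have Ey := posX_inj eU E; have := elim_leY y; have := exposed_rankY he; move: lY.
  have [f hf Ef] := next_surj he.
  by have := rankY_elim_in hf; have := exposed_ltY hf; rewrite Ef -Ey; lia.
by have := exposed_gap he hU lt lX; have := elim_leY y; lia.
Qed.

End Elim.

End Table.
End Theory.

(** * Rotations and chains *)

Section Cycles.
Variable A : eqType.
Implicit Types (s t : seq A) (a b : A).

Lemma next_ind s (K : A -> Prop) : uniq s ->
  (forall a, a \in s -> K a -> K (next s a)) ->
  forall a b, a \in s -> b \in s -> K a -> K b.
Proof.
move=> us step a b ha hb Ka.
have [i s' E] := rot_to ha.
have us' : uniq (a :: s') by rewrite -E rot_uniq.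
have : fcycle (next s) (a :: s').
  rewrite -E; have := cycle_next (p := rot i s); rewrite rot_uniq => /(_ us).
  by apply: sub_cycle => x y /= /eqP <-; rewrite next_rot.
rewrite /= rcons_path => /andP [pth _].
have hb' : b \in a :: s' by rewrite -E mem_rot.
have sub : {subset a :: s' <= s} by move=> x; rewrite -E mem_rot.
have : forall c, K c -> c \in s -> {subset s' <= s} -> fpath (next s) c s' ->
    b \in c :: s' -> K b.
  elim: s' {E us' pth hb' sub} => [|d s' IH] c Kc hc sub.
    by move=> _; rewrite inE => /eqP ->.
  move=> /= /andP [/eqP Ed pth]; rewrite inE => /orP [/eqP -> //|hb'].
  apply: (IH d) => //; first by rewrite -Ed; apply: step.
    by apply: sub; rewrite mem_head.
  by move=> x hx; apply: sub; rewrite inE hx orbT.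
move/(_ a Ka ha); apply=> // x hx; apply: sub; by rewrite inE hx orbT.
Qed.

Lemma fpath_return_inj (f : A -> A) e u s t :
  fpath f u (rcons s e) -> fpath f u (rcons t e) -> e \notin s -> e \notin t -> s = t.
Proof.
elim: s t u => [|a s IH] [|b t] u //=.
- by rewrite andbT => /eqP E /andP [/eqP E' _] _; rewrite inE -E -E' eqxx.
- by rewrite andbT => /andP [/eqP E' _] /eqP E; rewrite inE -E -E' eqxx.
move=> /andP [/eqP Ea ps] /andP [/eqP Eb pt]; rewrite !inE !negb_or.
move=> /andP [_ ns] /andP [_ nt]; rewrite -Eb -Ea in ps pt *.
by congr cons; apply: IH ps pt ns nt.
Qed.

(** Both lists are the first return to [a] of one successor function. The conclusion is equality of
    lists and not only equality up to a shift, as needed for the answer [rho]. *)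
Lemma cycle_next_inj s t a : uniq (a :: s) -> uniq (a :: t) ->
  {in a :: t, next (a :: s) =1 next (a :: t)} -> s = t.
Proof.
move=> us ut E; have cs := cycle_next us; have ct := cycle_next ut.
move: us ut => /andP [ns _] /andP [nt _].
apply: fpath_return_inj ns nt; first exact: cs.
have : fcycle (next (a :: s)) (a :: t); last by [].
rewrite -(eq_in_cycle (P := mem (a :: t)) (e := frel (next (a :: t)))) //.
  by move=> x y hx _; apply: (congr1 (eq_op^~ y)); apply/esym; exact: E.
by apply/allP.
Qed.

(** A cycle that follows the successor function of [s] without leaving [s] exhausts [s]. So two
    rotations are identified by an inclusion in one direction. *)
Lemma next_rotation s t : uniq s -> uniq t -> t != [::] ->
  (forall a, a \in t -> a \in s /\ next s a = next t a) ->
  exists k, s = rot k t.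
Proof.
move=> us ut; case: t ut => // a t ut _ h.
have [ha _] := h a (mem_head _ _).
have [i s' E] := rot_to ha.
have us' : uniq (a :: s') by rewrite -E rot_uniq.
have Est : s' = t.
  apply: cycle_next_inj us' ut _ => x hx; rewrite -E next_rot //.
  by case: (h x hx).
by exists (size s - i); rewrite -Est -E -(size_rot i) -/(rotr _ _) rotK.
Qed.

End Cycles.

Lemma functional_cycle (A : finType) (f : A -> A) (K : pred A) a :
  (forall x, K x -> K (f x)) -> K a ->
  exists c, [/\ c != [::], uniq c, all K c & forall x, x \in c -> next c x = f x].
Proof.
(* The orbit of [a] has length [n], so the n-th iterate repeats the entry at some index [m]; from
   there on the orbit is a cycle. *)
move=> cl Ka; pose n := order f a.
have /trajectP [m lt E] : looping f a n by apply: looping_order.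
pose z := iter m f a.
have Et : drop m (traject f a n) = traject f z (n - m).
  by rewrite -{1}(subnKC (ltnW lt)) trajectD drop_size_cat ?size_traject.
have Ez : iter (n - m) f z = z by rewrite -iterD subnK ?(ltnW lt).
have Kz k : K (iter k f a) by elim: k => //= k; apply: cl.
have [k Ek] : exists k, n - m = k.+1 by case: (n - m) (subn_gt0 m n) => [|k]; [lia | exists k].
have fc : fcycle f (traject f z (n - m)).
  rewrite Ek /= rcons_path fpath_traject /= last_traject.
  by rewrite -iterS -Ek Ez.
exists (traject f z (n - m)); split.
- by rewrite Ek.
- by rewrite -Et drop_uniq // orbit_uniq.
- by apply/allP=> x /trajectP [i _ ->]; rewrite -iterD.
- by move=> x hx; apply/esym/eqP; apply: (next_cycle fc).
Qed.

Section Rotations.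
Variables (X Y : finType) (T : instance X Y).
Implicit Types (U M N P Q : {set X * Y}) (rho sigma tau : seq (X * Y)).
Implicit Types (R : seq (seq (X * Y))) (x : X) (y : Y) (e f g : X * Y).

Local Notation posX := (posX T).
Local Notation posY := (posY T).
Local Notation rankX := (rankX T).
Local Notation rankY := (rankY T).

Lemma same_rotation_sym rho sigma : same_rotation rho sigma -> same_rotation sigma rho.
Proof. by case=> k ->; exists (size (rot k rho) - k); rewrite -/(rotr _ _) rotK. Qed.

Lemma same_rotation_mem rho sigma : same_rotation rho sigma -> sigma =i rho.
Proof. by case=> k -> e; rewrite mem_rot. Qed.

Lemma same_rotation_nxt rho sigma : uniq rho -> same_rotation rho sigma ->
  nxt sigma =1 nxt rho.
Proof. by move=> u [k ->] e; rewrite /nxt next_rot. Qed.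

Lemma rotation_agree sigma tau : uniq sigma -> uniq tau -> tau != [::] ->
  (forall e, e \in tau -> e \in sigma /\ nxt sigma e = nxt tau e) ->
  same_rotation tau sigma.
Proof. exact: next_rotation. Qed.

Variable U : {set X * Y}.
Hypothesis sU : U \subset edges T.

Lemma exposed_same P sigma tau :
  exposed T U P sigma -> same_rotation sigma tau -> exposed T U P tau.
Proof.
move=> ex sr; have us := exposed_uniq ex; case: ex => st [ne u1 u2 h] h3.
have mem := same_rotation_mem sr; have nx := same_rotation_nxt us sr.
split=> //; last first.
  move=> e y; rewrite mem => he hU l1 l2; apply: (h3 e) => //.
  by move: l2; rewrite -[next tau e]/(nxt tau e) nx.
case: sr mem nx => k -> mem nx; split.
- by apply: contraNneq ne => /(congr1 size); rewrite size_rot; case: sigma {u1 u2 h h3 us mem nx}.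
- by rewrite map_rot rot_uniq.
- by rewrite map_rot rot_uniq.
- by move=> e; rewrite mem => /h; rewrite -[next (rot _ _) e]/(nxt (rot k sigma) e) nx.
Qed.

(** Suppose Q takes some x_i strictly below y_i. The last clause of [exposed] forbids a partner
    strictly before y_{i+1}. If x_{i+1} were not strictly below y_{i+1}, then y_{i+1} would have in
    Q someone worse than x_i, and x_i y_{i+1} would block Q. So the fall passes on to x_{i+1}, hence
    round the whole cycle. *)
Lemma dichotomy P Q sigma : exposed T U P sigma -> stable T U Q ->
  (forall e, e \in sigma -> rankX Q e.1 <= posX e.1 e.2) \/
  (forall e, e \in sigma -> posX e.1 (nxt sigma e).2 <= rankX Q e.1).
Proof.
move=> ex stQ; have stP := exposed_stable ex.
have [mP mQ] := (stable_match stP, stable_match stQ).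
have [sP sQ] := (stable_sub sU stP, stable_sub sU stQ).
have step e : e \in sigma -> posX e.1 e.2 < rankX Q e.1 ->
    posX e.1 (nxt sigma e).2 <= rankX Q e.1 /\
    posX (nxt sigma e).1 (nxt sigma e).2 < rankX Q (nxt sigma e).1.
  move=> he lt; set f := nxt sigma e.
  have hf : f \in sigma by rewrite mem_nxt.
  have hU := exposed_table ex he; rewrite -/f in hU.
  have le : posX e.1 f.2 <= rankX Q e.1.
    rewrite leqNgt; apply/negP=> lt'.
    have [y hy] : {y | (e.1, y) \in Q}.
      apply: (@rankX_mate _ _ T); apply: (leq_trans lt'); exact: index_size.
    have yU : (e.1, y) \in U by case: stQ => /subsetP s _ _; apply: s.
    rewrite (rankX_in T mQ hy) in lt lt'.
    have := exposed_gap ex he yU lt lt'.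
    have := trade_r sU stP stQ hy.
    by rewrite (exposed_rankX ex he) (rankX_in T mQ hy) (rankY_in T mQ hy) lt; lia.
  split=> //; rewrite ltnNge; apply/negP=> le'.
  have lY : posY f.2 e.1 < rankY Q f.2.
    have ltY := exposed_ltY ex he; rewrite -/f in ltY.
    have fP : (f.1, f.2) \in P by rewrite -surjective_pairing (exposed_in ex).
    move: le'; rewrite leq_eqVlt => /orP [/eqP E|lt'].
      by rewrite (rankY_in T mQ (rankX_inj sQ mQ (subsetP sP _ fP) E)).
    have := trade_r sU stQ stP fP.
    by rewrite (rankX_in T mP fP) lt' (rankY_in T mP fP); lia.
  have le2 : rankX Q e.1 <= posX e.1 f.2.
    by rewrite leqNgt; apply/negP=> l; apply: (stable_noblock stQ hU l lY).
  have eQ : (e.1, f.2) \in Q.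
    by apply: (rankX_inj sQ mQ); [exact: (subsetP sU) | lia].
  by move: lY; rewrite (rankY_in T mQ eQ) ltnn.
case: (boolP (has (fun e => posX e.1 e.2 < rankX Q e.1) sigma)) => [/hasP [e he lt]|/hasPn h].
  right=> f hf; apply: (step f hf _).1.
  apply: (next_ind (K := fun e => posX e.1 e.2 < rankX Q e.1) (exposed_uniq ex)) he hf lt.
  by move=> g hg l; apply: (step g hg l).2.
by left=> e /h; rewrite -leqNgt.
Qed.

(** Each x of [tau] moves within the interval that [sigma] crosses in one step. The dichotomy for
    [sigma], applied to the matchings before and after [tau], forces both ends of the two moves to
    agree; so [tau] follows the successor function of [sigma]. *)
Lemma rotation_between P Q sigma tau :
  exposed T U P sigma -> exposed T U Q tau ->
  (forall e, e \in tau -> rankX P e.1 <= posX e.1 e.2) ->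
  (forall e, e \in tau -> posX e.1 (nxt tau e).2 <= rankX (elim P sigma) e.1) ->
  same_rotation tau sigma.
Proof.
move=> exP exQ lo hi.
have stQ := exposed_stable exQ; have stQ' := elim_stable sU exQ.
have stP := exposed_stable exP.
have mem e : e \in tau ->
    [/\ e \in sigma & posX e.1 (nxt sigma e).2 = posX e.1 (nxt tau e).2].
  move=> he; have lt := exposed_ltX exQ he; have l1 := lo e he; have l2 := hi e he.
  have : e.1 \in map fst sigma.
    by apply: contraT => n; have := rankX_elim_out T P n; lia.
  move=> /mem_fstP [g hg Eg].
  have r1 := exposed_rankX exP hg; have r2 := rankX_elim_in exP hg.
  have q1 := exposed_rankX exQ he; have q2 := rankX_elim_in exQ he.
  rewrite -Eg in r1 r2.
  have Ei : posX e.1 e.2 = posX e.1 g.2.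
    by case: (dichotomy exP stQ) => /(_ _ hg); rewrite -Eg; lia.
  have eg : e = g.
    have eE : (e.1, e.2) \in edges T.
      by rewrite -surjective_pairing (subsetP (stable_sub sU stQ)) ?(exposed_in exQ).
    by rewrite (surjective_pairing e) (surjective_pairing g) -Eg -(posX_inj eE Ei).
  rewrite -eg in hg r1 r2; split=> //.
  by case: (dichotomy exP stQ') => /(_ _ hg); lia.
apply: rotation_agree.
- exact: exposed_uniq exP.
- exact: exposed_uniq exQ.
- by case: exQ => _ [].
move=> e he; have [hs E] := mem e he; split=> //.
have hn : nxt tau e \in sigma by apply: (mem _ _).1; rewrite mem_nxt.
apply: (exposed_inj2 exP) => //; first by rewrite mem_nxt.
by apply: posX_inj E; apply: (subsetP sU); apply: exposed_table exP _ hs.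
Qed.

Lemma elim_seq_cat P R1 R2 Q : elim_seq T U P (R1 ++ R2) Q <->
  exists2 P', elim_seq T U P R1 P' & elim_seq T U P' R2 Q.
Proof.
elim: R1 P => [|sigma R1 IH] P /=; first by split=> [h|[_ -> //]]; exists P.
split=> [[ex /IH [P' h1 h2]]|[P' [ex h1] h2]]; first by exists P'.
by split=> //; apply/IH; exists P'.
Qed.

Lemma elim_seq_stable P R Q : stable T U P -> elim_seq T U P R Q -> stable T U Q.
Proof.
elim: R P => [|sigma R IH] P st /=; first by move=> ->.
by case=> ex; apply: IH; apply: elim_stable.
Qed.

Lemma elim_seq_leX P R Q x : elim_seq T U P R Q -> rankX P x <= rankX Q x.
Proof.
elim: R P => [|sigma R IH] P /=; first by move=> ->.
case=> ex /IH; apply: leq_trans; exact: elim_leX ex x.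
Qed.

Lemma elim_seq_nth P R Q i : elim_seq T U P R Q -> i < size R ->
  exists P', [/\ elim_seq T U P (take i R) P', exposed T U P' (nth [::] R i) &
                 elim_seq T U (elim P' (nth [::] R i)) (drop i.+1 R) Q].
Proof.
move=> h lt; move: h; rewrite -{1}(cat_take_drop i R) (drop_nth [::] lt).
by move=> /elim_seq_cat [P' h1 [ex h2]]; exists P'.
Qed.

Lemma elim_seq_mem P R Q sigma : elim_seq T U P R Q -> sigma \in R ->
  exists P', [/\ exposed T U P' sigma, (forall x, rankX P x <= rankX P' x) &
                 forall x, rankX (elim P' sigma) x <= rankX Q x].
Proof.
move=> h /(nthP [::]) [i lt <-]; have [P' [h1 h2 h3]] := elim_seq_nth h lt.
by exists P'; split=> // x; [apply: elim_seq_leX h1 | apply: elim_seq_leX h3].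
Qed.

Lemma elim_seq_gtX P R Q sigma e : elim_seq T U P R Q -> sigma \in R -> e \in sigma ->
  rankX P e.1 <= posX e.1 e.2 < rankX Q e.1.
Proof.
move=> h hs he; have [P' [ex l1 l2]] := elim_seq_mem h hs.
have := exposed_ltX ex he; rewrite -(rankX_elim_in ex he) => lt.
have := l2 e.1; have := l1 e.1; rewrite (exposed_rankX ex he); lia.
Qed.

(** Each x only falls along a chain, so an edge that has been left is never met again. *)
Lemma elim_seq_disjoint P R Q i j e : elim_seq T U P R Q -> i < j -> j < size R ->
  e \in nth [::] R i -> e \in nth [::] R j -> False.
Proof.
move=> h ij lt hi hj; have [P' [h1 ex h2]] := elim_seq_nth h (ltn_trans ij lt).
have mem : nth [::] R j \in drop i.+1 R.
  have -> : nth [::] R j = nth [::] (drop i.+1 R) (j - i.+1) by rewrite nth_drop subnKC.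
  by rewrite mem_nth // size_drop ltn_sub2r //; apply: leq_ltn_trans ij lt.
have := elim_seq_gtX h2 mem hj; rewrite (rankX_elim_in ex hi).
by have := exposed_ltX ex hi; lia.
Qed.

Lemma elim_seq_distinct P R Q : elim_seq T U P R Q -> distinct_rotations R.
Proof.
move=> h i j li lj /same_rotation_mem mem.
have [P' [_ /exposed_ne [e he] _]] := elim_seq_nth h li.
have he' : e \in nth [::] R j by rewrite mem.
case: (ltngtP i j) => // ij; exfalso.
  exact: elim_seq_disjoint h ij lj he he'.
exact: elim_seq_disjoint h ij li he' he.
Qed.

(** The chain starts before [tau] and ends after it, and every matching in it is on one of these two
    sides. The step that changes sides is [tau]. *)
Lemma rotation_crossed P R Q Q' tau :
  elim_seq T U P R Q -> stable T U P -> exposed T U Q' tau ->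
  (forall e, e \in tau -> rankX P e.1 <= posX e.1 e.2) ->
  (forall e, e \in tau -> posX e.1 (nxt tau e).2 <= rankX Q e.1) ->
  exists2 sigma, sigma \in R & same_rotation tau sigma.
Proof.
elim: R P => [|sigma R IH] P /=.
  move=> -> st ex lo hi; have [e he] := exposed_ne ex.
  by have := lo e he; have := hi e he; have := exposed_ltX ex he; lia.
move=> [exs h] st ex lo hi; have st' := elim_stable sU exs.
case: (dichotomy ex st') => d.
  by have [s hs sr] := IH _ h st' ex d hi; exists s => //; rewrite inE hs orbT.
by exists sigma; [exact: mem_head | exact: rotation_between exs ex lo d].
Qed.

End Rotations.

(** * Existence of chains, and the predecessors of a rotation *)

Section Chains.
Variables (X Y : finType) (T : instance X Y).
Implicit Types (M N P Q : {set X * Y}) (rho sigma tau : seq (X * Y)).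
Implicit Types (R : seq (seq (X * Y))) (x : X) (y : Y) (e f g : X * Y).
Variable U : {set X * Y}.
Hypothesis sU : U \subset edges T.

Local Notation posX := (posX T).
Local Notation posY := (posY T).
Local Notation rankX := (rankX T).
Local Notation rankY := (rankY T).

Lemma nxt_pairs (c : seq X) (m : X -> Y) x : uniq c ->
  nxt [seq (z, m z) | z <- c] (x, m x) = (next c x, m (next c x)).
Proof.
move=> uc; rewrite /nxt.
by rewrite -[(x, m x)]/((fun z => (z, m z)) x) next_map // => a b [].
Qed.

(** Common to the existence of chains and to the program: a cycle of agents with their partners [m]
    and next choices [s] is an exposed rotation. The rejections are assumed only weakly, since
    equality would make xy an edge of P. *)
Lemma cycle_exposed P (c : seq X) (m s : X -> Y) :
  stable T U P -> c != [::] -> uniq c ->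
  (forall x, x \in c ->
    [/\ (x, m x) \in P, (x, s x) \in U & (next c x, s x) \in P]) ->
  (forall x, x \in c -> posX x (m x) < posX x (s x) /\ posY (s x) x < rankY P (s x)) ->
  (forall x y, x \in c -> (x, y) \in U -> posX x (m x) < posX x y ->
     posX x y < posX x (s x) -> rankY P y <= posY y x) ->
  let sigma := [seq (x, m x) | x <- c] in
  exposed T U P sigma /\ (forall x, x \in c -> nxt sigma (x, m x) = (next c x, s x)).
Proof.
move=> st ne uc h1 h2 h3 sigma; have mP := stable_match st.
have Es x : x \in c -> m (next c x) = s x.
  move=> hx; have [_ _ hs] := h1 x hx.
  have [hm _ _] : [/\ (next c x, m (next c x)) \in P, True & True].
    by have [] := h1 (next c x); rewrite ?mem_next.
  exact: mP.1 hm hs.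
have Hn x : x \in c -> nxt sigma (x, m x) = (next c x, s x).
  by move=> hx; rewrite nxt_pairs // Es.
split=> //; split=> //.
  split.
  - by rewrite /sigma; case: c ne {uc h1 h2 h3 sigma Es Hn}.
  - by rewrite -map_comp map_id_in.
  - rewrite -map_comp map_inj_in_uniq // => a b ha hb /= E.
    by have [ma _ _] := h1 a ha; have [mb _ _] := h1 b hb; rewrite E in ma; exact: mP.2 ma mb.
  move=> _ /mapP [x hx ->]; rewrite -[next _ _]/(nxt sigma (x, m x)) Hn //=.
  have [k1 k2 k3] := h1 x hx; have [l1 l2] := h2 x hx.
  by split=> //; rewrite /prefers /=; move: l2; rewrite (rankY_in T mP k3).
move=> _ y /mapP [x hx ->]; rewrite -[next _ _]/(nxt sigma (x, m x)) Hn //= => hU l1 l2.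
have le : rankY P y <= posY y x by apply: h3 l1 l2.
change (rankY P y < posY y x); rewrite ltn_neqAle le andbT; apply/eqP=> E.
have hP := rankY_inj (stable_sub sU st) mP (subsetP sU _ hU) E.
have [k1 _ _] := h1 x hx; have Ey := mP.1 _ _ _ hP k1.
by move: l1; rewrite /prefers Ey /= ltnn.
Qed.

Section Step.
Variables (P Q : {set X * Y}) (stP : stable T U P) (stQ : stable T U Q).
Hypothesis le : forall x, rankX P x <= rankX Q x.

Let mP := stable_match stP.
Let mQ := stable_match stQ.

(** Stability of Q makes y better off in Q, so the partner of y in P is worse off there. This keeps
    the successor function inside the set of agents that still have to move. *)
Lemma better_between x y : (x, y) \in U -> rankX P x < rankX Q x ->
  posX x y <= rankX Q x -> posY y x < rankY P y ->
  exists2 x', (x', y) \in P & rankX P x' < rankX Q x'.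
Proof.
move=> hU lt lX lY.
suff /(decomposition sU stP stQ).2 [x' [_ [h _ h' _]]] : rankY Q y < rankY P y by exists x'.
move: lX; rewrite leq_eqVlt => /orP [/eqP E|lX].
  by rewrite (rankY_in T mQ (rankX_inj (stable_sub sU stQ) mQ (subsetP sU _ hU) (esym E))).
apply: leq_ltn_trans lY; rewrite leqNgt; apply/negP; exact: stable_noblock stQ hU lX.
Qed.

Lemma rotation_toward x0 : rankX P x0 < rankX Q x0 -> exists2 sigma,
  exposed T U P sigma & forall x, rankX (elim P sigma) x <= rankX Q x.
Proof.
move=> lt0; have [y0 _] : {y | (x0, y) \in P}.
  by apply: (@rankX_mate _ _ T); apply: leq_trans lt0 _; apply: rankX_le.
(* [s x] is the first agent after the partner of x that would leave its own partner for x. The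
   partner of x in Q is one, so [s x] does not lie beyond it. The default [y0] is never reached for
   an agent that is worse off in Q. *)
pose cand x y := [&& (x, y) \in U, rankX P x < posX x y & posY y x < rankY P y].
pose s x := nth y0 (prefX T x) (find (cand x) (prefX T x)).
pose m x := odflt y0 (mateX P x).
pose f x := odflt x (mateY P (s x)).
have hs x : rankX P x < rankX Q x ->
    [/\ cand x (s x), posX x (s x) <= rankX Q x & forall y, (x, y) \in U ->
        rankX P x < posX x y -> posX x y < posX x (s x) -> rankY P y <= posY y x].
  move=> lt; have [y [y' [h h' _ lY]]] := (decomposition sU stP stQ).1 x lt.
  have yU : (x, y') \in U by case: stQ => /subsetP S _ _; apply: S.
  have yp : y' \in prefX T x by rewrite -mem_edges (subsetP sU).
  have cy : cand x y'.
    by rewrite /cand yU -(rankX_in T mQ h') lt -(rankY_in T mQ h').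
  have hc : has (cand x) (prefX T x) by apply/hasP; exists y'.
  have Ei : posX x (s x) = find (cand x) (prefX T x).
    by rewrite -[posX x (s x)]/(index (s x) (prefX T x)) /s index_uniq ?prefX_uniq -?has_find.
  split; first exact: nth_find.
    rewrite Ei (rankX_in T mQ h') leqNgt; apply/negP=> l.
    by have := before_find y' l; rewrite nth_index // cy.
  move=> z zU l1 l2; rewrite leqNgt; apply/negP=> l3.
  rewrite Ei in l2; have := before_find y0 l2.
  by rewrite nth_index -?mem_edges ?(subsetP sU) // /cand zU l1 l3.
have hf x : rankX P x < rankX Q x -> (f x, s x) \in P /\ rankX P (f x) < rankX Q (f x).
  move=> lt; have [/and3P [c1 c2 c3] l _] := hs x lt.
  have [x' h' l'] := better_between c1 lt l c3.
  by rewrite /f (mateY_in mP h').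
have hm x : rankX P x < rankX Q x -> (x, m x) \in P.
  move=> lt; have [y [_ [h _ _ _]]] := (decomposition sU stP stQ).1 x lt.
  by rewrite /m (mateX_in mP h).
have [c [ne uc /allP Kc nc]] := functional_cycle (fun x l => (hf x l).2) lt0.
have [] := @cycle_exposed P c m s stP ne uc.
- move=> x hx; have l : rankX P x < rankX Q x := Kc x hx.
  by rewrite nc //; have [/and3P []] := hs x l; have [] := hf x l; split=> //; apply: hm.
- move=> x hx; have l : rankX P x < rankX Q x := Kc x hx.
  by rewrite -(rankX_in T mP (hm x l)); have [/and3P []] := hs x l.
- move=> x y hx; have l : rankX P x < rankX Q x := Kc x hx.
  by rewrite -(rankX_in T mP (hm x l)); have [_ _] := hs x l; apply.
set sigma := map _ _ => ex Hn; exists sigma => // x.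
case: (boolP (x \in map fst sigma)) => [/mem_fstP [e he ->]|n]; last first.
  by rewrite rankX_elim_out.
rewrite (rankX_elim_in ex he); move: he => /mapP [z hz ->]; rewrite Hn //=.
by have [] := hs z (Kc z hz).
Qed.

End Step.

Lemma chain_exists P Q : stable T U P -> stable T U Q ->
  (forall x, rankX P x <= rankX Q x) -> exists R, elim_seq T U P R Q.
Proof.
move=> stP stQ; have [n] := ubnP (\sum_x (rankX Q x - rankX P x)).
elim: n P stP => // n IH P stP ltn le.
case: (pickP [pred x | rankX P x < rankX Q x]) => [x0 /= lt0|h].
  have [sigma ex le'] := rotation_toward stP stQ le lt0.
  have [||R hR] := IH (elim P sigma) _ _ le'; last by exists (sigma :: R).
    exact: elim_stable.
  have [e he] := exposed_ne ex.
  have lt := exposed_ltX ex he; rewrite -(rankX_elim_in ex he) -(exposed_rankX ex he) in lt.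
  apply: leq_trans (ltn : _ <= n); rewrite (bigD1 e.1) //= [leqRHS](bigD1 e.1) //=.
  rewrite -addSn leq_add //; first by have := le' e.1; lia.
  by apply: leq_sum => x _; apply: leq_sub2l; apply: elim_leX ex x.
exists [::]; apply: (eq_matching (T := T)).
- exact: (stable_sub sU stQ).
- exact: (stable_sub sU stP).
- exact: stable_match stQ.
- exact: stable_match stP.
- by move=> x; apply/eqP; rewrite eqn_leq le andbT leqNgt; have /= -> := h x.
Qed.

(** Applied to all stable matchings and to those exposing a given rotation. As long as some Q' beats
    the candidate somewhere, their join has a smaller sum of ranks. *)
Lemma X_best (K : {set X * Y} -> Prop) P :
  (forall Q, K Q -> stable T U Q) ->
  (forall Q Q', K Q -> K Q' -> K (join T Q Q')) -> K P ->
  exists2 Q, K Q & forall Q', K Q' -> forall x, rankX Q x <= rankX Q' x.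
Proof.
move=> Kst Kj; have [n] := ubnP (\sum_x rankX P x).
elim: n P => // n IH P ltn KP.
case: (classic (forall Q', K Q' -> forall x, rankX P x <= rankX Q' x)) => [h|/not_all_ex_not [Q' nh]].
  by exists P.
have {nh} [KQ nh] := imply_to_and _ _ nh.
have {nh} [x0 /negP nh] := not_all_ex_not _ _ nh.
have rj := rankX_join T P Q'.
apply: (IH (join T P Q')); last exact: Kj.
apply: leq_trans (ltn : _ <= n); rewrite (bigD1 x0) //= [leqRHS](bigD1 x0) //=.
rewrite -addSn leq_add ?rj //; first by move: nh; lia.
by apply: leq_sum => x _; rewrite rj geq_minl.
Qed.

Lemma exposed_join P Q rho : exposed T U P rho -> exposed T U Q rho ->
  exposed T U (join T P Q) rho.
Proof.
move=> exP exQ; have [stP stQ] := (exposed_stable exP, exposed_stable exQ).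
have st := join_stable sU stP stQ.
case: (exP) => _ [ne u1 u2 h] h3; split=> //.
  split=> // e he; have [_ ? ? ?] := h e he; split=> //.
  by rewrite [e]surjective_pairing in_join; case: leqP => _;
    rewrite -surjective_pairing ?(exposed_in exP) ?(exposed_in exQ).
move=> e y he hU l1 l2; change (rankY (join T P Q) y < posY y e.1).
rewrite (rankY_join sU) // gtn_max; apply/andP; split.
  exact (exposed_gap exP he hU l1 l2).
exact (exposed_gap exQ he hU l1 l2).
Qed.

(** A matching Q that is still before [rho] does not affect its starting edges in the meet, and the
    agents of Y only gain there, so the last clause of [exposed] persists. *)
Lemma exposed_meet P Q rho : exposed T U P rho -> stable T U Q ->
  (forall e, e \in rho -> rankX Q e.1 <= posX e.1 e.2) -> exposed T U (meet T P Q) rho.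
Proof.
move=> exP stQ le; have stP := exposed_stable exP.
have st := meet_stable sU stP stQ.
have mem e : e \in rho -> e \in meet T P Q.
  move=> he; have r := exposed_rankX exP he; have := le e he; rewrite -r => le'.
  have eP := exposed_in exP he; rewrite [e]surjective_pairing in eP *.
  rewrite in_meet; case: leqP => // l; rewrite -(equal_rankX sU stP stQ eP) /=; lia.
case: (exP) => _ [ne u1 u2 h] h3; split=> //.
  by split=> // e he; have [_ ? ? ?] := h e he; split=> //; apply: mem.
move=> e y he hU l1 l2; change (rankY (meet T P Q) y < posY y e.1).
by rewrite (rankY_meet sU) // gtn_min (exposed_gap exP he hU l1 l2).
Qed.

(** M is the X-best matching that exposes [rho]. Whatever lies on a chain to M must precede [rho],
    because [rho] is never exposed above M; and a rotation not crossed by then can be postponed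
    until after [rho]. *)
Lemma predecessor_elim rho : is_rotation T U rho -> exists M0 M,
  [/\ X_optimal T U M0, elim_set T U M0 (predecessor T U rho) M & exposed T U M rho].
Proof.
case=> P0 ex0.
have [M0 st0 opt0] := X_best (fun Q h => h) (join_stable sU) (exposed_stable ex0).
have [M ex opt] := X_best (K := fun Q => exposed T U Q rho)
  (fun Q => @exposed_stable _ _ T U Q rho) (fun Q Q' => @exposed_join Q Q' rho) ex0.
have stM := exposed_stable ex.
have [R hR] := chain_exists st0 stM (opt0 _ stM).
have oM0 : X_optimal T U M0 by split=> // N stN; apply: opt0.
exists M0, M; split=> //; exists R; split=> //; first exact: elim_seq_distinct hR.
move=> tau; split.
  case=> sigma hs sr; have [P [exs l1 l2]] := elim_seq_mem hR hs.
  have [e he] := exposed_ne exs.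
  have he' : e \in tau by rewrite -(same_rotation_mem sr).
  have ltM : posX e.1 e.2 < rankX M e.1.
    by have /andP [] := elim_seq_gtX sU hR hs he.
  split.
  - by exists P; apply: exposed_same exs _; apply: same_rotation_sym.
  - move=> sr'; have her : e \in rho by rewrite -(same_rotation_mem sr').
    by move: ltM; rewrite (exposed_rankX ex her) ltnn.
  (* If [rho] came first, the matching [Pj] exposing it would be no better than M for any x. But M
     already lies strictly beyond the edge [e], from which the later occurrence of [tau] would have
     to start. *)
  move=> M1 N1 R1 i j oM1 h1 li lj si sj; rewrite ltnNge leq_eqVlt; apply/negP.
  have [Pj [g1 g2 g3]] := elim_seq_nth h1 lj.
  have exj : exposed T U Pj rho by apply: exposed_same g2 _; apply: same_rotation_sym.
  have hei : e \in nth [::] R1 i by rewrite (same_rotation_mem si).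
  case/orP=> [/eqP E|ji].
    move: hei; rewrite -E => hei.
    have her : e \in rho by rewrite -(same_rotation_mem sj).
    by move: ltM; rewrite (exposed_rankX ex her) ltnn.
  have mem : nth [::] R1 i \in drop j.+1 R1.
    have -> : nth [::] R1 i = nth [::] (drop j.+1 R1) (i - j.+1) by rewrite nth_drop subnKC.
    by rewrite mem_nth // size_drop ltn_sub2r //; apply: leq_ltn_trans ji li.
  have /andP [l3 _] := elim_seq_gtX sU g3 mem hei.
  by have := elim_leX g2 e.1; have := opt _ exj e.1; lia.
move=> [rot_tau ns prec]; have [Q exQ] := rot_tau.
have stQ := exposed_stable exQ.
have stM1 := elim_stable sU ex.
have lo0 e : e \in tau -> rankX M0 e.1 <= posX e.1 e.2.
  by move=> he; rewrite -(exposed_rankX exQ he) opt0.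
have chain1 : elim_seq T U M0 (rcons R rho) (elim M rho).
  by rewrite -cats1; apply/elim_seq_cat; exists M.
case: (dichotomy sU exQ stM1) => d; last first.
  have [sigma hs sr] := rotation_crossed sU chain1 st0 exQ lo0 d.
  move: hs; rewrite mem_rcons inE => /orP [/eqP E|hs]; last by exists sigma.
  by case: ns; apply: same_rotation_sym; rewrite -E.
(* A [tau] that [elim M rho] has not crossed is exposed in some matching below it. This yields a
   chain with [tau] after [rho], against the assumed precedence. *)
have exm := exposed_meet exQ stM1 d.
have [|R2 hR2] := chain_exists stM1 (exposed_stable exm).
  by move=> x; rewrite rankX_meet // leq_maxr.
have chain2 : elim_seq T U M0 (rcons R rho ++ rcons R2 tau) (elim (meet T Q (elim M rho)) tau).
  apply/elim_seq_cat; exists (elim M rho) => //.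
  by rewrite -cats1; apply/elim_seq_cat; exists (meet T Q (elim M rho)).
have := prec _ _ _ (size R + (size R2).+1) (size R) oM0 chain2.
rewrite size_cat !size_rcons !nth_cat !size_rcons ltnSn !nth_rcons ltnn eqxx.
rewrite (_ : size R + (size R2).+1 - (size R).+1 = size R2); last by lia.
rewrite ltnn eqxx => prec'; exfalso.
suff : size R + (size R2).+1 < size R by lia.
apply: prec'; [by lia | by lia | | by exists 0; rewrite rot0].
case: ltnP => [|_]; [by lia | by exists 0; rewrite rot0].
Qed.

End Chains.

(** * The gap of a rotation *)

Section Gap.
Variables (X Y : finType) (T : instance X Y).
Implicit Types (U M N P Q W : {set X * Y}) (rho sigma tau : seq (X * Y)).
Implicit Types (R : seq (seq (X * Y))) (x : X) (y : Y) (e f g h : X * Y).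

Local Notation posX := (posX T).
Local Notation posY := (posY T).
Local Notation rankX := (rankX T).
Local Notation rankY := (rankY T).

(* The edges of T that an intermediate matching between M and M / rho can use
   besides those of the two matchings. *)
Definition gap rho : {set X * Y} := [set e in edges T |
  has (fun g : X * Y => [&& e.1 == g.1, posX e.1 g.2 < posX e.1 e.2 &
                 posX e.1 e.2 < posX e.1 (nxt rho g).2]) rho &&
  has (fun h : X * Y => [&& e.2 == (nxt rho h).2, posY e.2 h.1 < posY e.2 e.1 &
                 posY e.2 e.1 < posY e.2 (nxt rho h).1]) rho].

Lemma gapP rho x y : reflect
  (exists g h, [/\ g \in rho, h \in rho, (x, y) \in edges T,
     x = g.1 /\ posX x g.2 < posX x y < posX x (nxt rho g).2 &
     y = (nxt rho h).2 /\ posY y h.1 < posY y x < posY y (nxt rho h).1])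
  ((x, y) \in gap rho).
Proof.
rewrite [_ \in gap rho]in_set; apply: (iffP and3P) => [[hE /hasP [g hg /= /and3P [/eqP E1 l1 l2]]
    /hasP [h hh /= /and3P [/eqP E2 l3 l4]]]|[g [h [hg hh hE [E1 l1] [E2 l2]]]]].
  by exists g, h; split; rewrite ?l1 ?l2 ?l3 ?l4.
split=> //; apply/hasP; [exists g | exists h] => //=; rewrite -?E1 -?E2 eqxx.
  by rewrite andTb.
by rewrite andTb.
Qed.

Definition filled U rho := U :|: gap rho.

Section Fixed.
Variables (U M : {set X * Y}) (rho : seq (X * Y)).
Hypothesis sU : U \subset edges T.
Hypothesis ex : exposed T U M rho.

Local Notation N := (elim M rho).
Local Notation V := (filled U rho).

Let stM := exposed_stable ex.
Let stN := elim_stable sU ex.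

Lemma filled_sub : V \subset edges T.
Proof.
by rewrite subUset sU; apply/subsetP=> -[x y] /gapP [g [h []]].
Qed.

(** A gap edge is worse for its x than the partner in M and worse for its y than the partner in N,
    so it blocks neither matching. *)
Lemma M_stable_filled : stable T V M.
Proof.
case: (stM) => s m nb; split=> //; first exact: subset_trans s (subsetUl _ _).
move=> x y; rewrite in_setU => /orP [/nb //|/gapP [g [h [hg hh hE [E /andP [l1 l2]] _]]]] [].
move=> l _; have {l} : posX x y < rankX M x := l.
by rewrite E (exposed_rankX ex hg) -E; lia.
Qed.

Lemma N_stable_filled : stable T V N.
Proof.
case: (stN) => s m nb; split=> //; first exact: subset_trans s (subsetUl _ _).
move=> x y; rewrite in_setU => /orP [/nb //|/gapP [g [h [hg hh hE _ [E /andP [l1 l2]]]]]] [].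
move=> _ l; have {l} : posY y x < rankY N y := l.
by rewrite E (rankY_elim_in ex hh) -E; lia.
Qed.

Lemma rankX_moved x : rankX M x != rankX N x ->
  exists2 g : X * Y, g \in rho & [/\ x = g.1, rankX M x = posX x g.2 & rankX N x = posX x (nxt rho g).2].
Proof.
move=> ne; have : x \in map fst rho.
  by apply: contraNT ne => n; rewrite (rankX_elim_out T M n).
move=> /mem_fstP [g hg ->]; exists g => //.
by rewrite (exposed_rankX ex hg) (rankX_elim_in ex hg).
Qed.

Lemma rankY_moved y : rankY M y != rankY N y -> exists2 h : X * Y, h \in rho &
  [/\ y = (nxt rho h).2, rankY M y = posY y (nxt rho h).1 & rankY N y = posY y h.1].
Proof.
move=> ne; have : y \in map snd rho.
  by apply: contraNT ne => n; rewrite (rankY_elim_out T M n).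
move=> /mem_sndP [f hf ->]; have [h hh <-] := next_surj ex hf; exists h => //.
by rewrite (exposed_rankY ex) ?mem_nxt // (rankY_elim_in ex hh).
Qed.

(** An edge of P at an x that agrees with M or N lies in U. Any other edge is strictly between for
    x, hence by opposite interests strictly between for y. The table W is arbitrary because it will
    be the extended table of an arbitrary candidate set. *)
Lemma between_filled W P : W \subset edges T ->
  stable T W M -> stable T W N -> stable T W P ->
  (forall x, rankX M x <= rankX P x) -> (forall x, rankX P x <= rankX N x) -> P \subset V.
Proof.
move=> sW wM wN wP lo hi; apply/subsetP=> -[x y] hP.
have mP := stable_match wP; have hE := subsetP (stable_sub sW wP) _ hP.
have rP := rankX_in T mP hP; have rPY := rankY_in T mP hP.
have sM : M \subset U by case: stM. have sN : N \subset U by case: stN.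
rewrite in_setU; case: (eqVneq (rankX M x) (rankX P x)) => [E|ne1].
  rewrite (subsetP sM) //; apply: (rankX_inj (stable_sub sU stM) (stable_match stM)) => //.
  by rewrite E.
case: (eqVneq (rankX P x) (rankX N x)) => [E|ne2].
  rewrite (subsetP sN) //; apply: (rankX_inj (stable_sub sU stN) (stable_match stN)) => //.
  by rewrite -E.
apply/orP; right; apply/gapP.
have l1 : rankX M x < rankX P x by rewrite ltn_neqAle ne1 lo.
have l2 : rankX P x < rankX N x by rewrite ltn_neqAle ne2 hi.
have [g hg [Ex E1 E2]] : exists2 g : X * Y, g \in rho &
    [/\ x = g.1, rankX M x = posX x g.2 & rankX N x = posX x (nxt rho g).2].
  by apply: rankX_moved; lia.
have l3 : rankY P y < rankY M y by rewrite -(trade_r sW wM wP hP).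
have l4 : rankY N y < rankY P y by rewrite -(trade_l sW wP wN hP).
have [h hh [Ey E3 E4]] : exists2 h : X * Y, h \in rho &
  [/\ y = (nxt rho h).2, rankY M y = posY y (nxt rho h).1 & rankY N y = posY y h.1].
  by apply: rankY_moved; lia.
by exists g, h; split=> //; split=> //; lia.
Qed.

(** A gap edge is a violation of the last clause of [exposed]: its y lies between the two partners
    of x and prefers x to its partner in M. *)
Lemma exposed_filled_gap : exposed T V M rho -> gap rho = set0.
Proof.
move=> exV; apply/setP=> -[x y]; rewrite [RHS]inE; apply/negP=> h0.
have hV : (x, y) \in V by rewrite in_setU h0 orbT.
move: h0 => /gapP [g [h [hg hh hE [Ex /andP [l1 l2]] [Ey /andP [l3 l4]]]]].
have hn : nxt rho h \in rho by rewrite mem_nxt.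
rewrite Ex in hV l1 l2.
have := exposed_gap exV hg hV l1 l2.
by rewrite {1}Ey (exposed_rankY ex hn) -Ey -Ex; lia.
Qed.

(** By [rotation_between], a rotation of U met between M and N is [rho] up to a shift. It then
    carries every agent of [rho] the whole way and leaves nothing for the other steps. *)
Lemma rotation_in_chain R sigma : elim_seq T V M R N -> sigma \in R ->
  is_rotation T U sigma -> R = [:: sigma].
Proof.
move=> hR hs [Q exQ]; move: hs => /(nthP [::]) [i li Ei].
have [P [h1 exP h2]] := elim_seq_nth hR li; rewrite Ei in exP h2.
have lo x : rankX M x <= rankX P x by apply: elim_seq_leX h1.
have hi x : rankX (elim P sigma) x <= rankX N x by apply: elim_seq_leX h2.
have sr : same_rotation sigma rho.
  apply: rotation_between ex exQ _ _ => // e he.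
    by rewrite -(exposed_rankX exP he).
  by rewrite -(rankX_elim_in exP he).
have mem := same_rotation_mem sr.
have nx := same_rotation_nxt (exposed_uniq exP) sr.
have Pg g : g \in rho -> rankX P g.1 = rankX M g.1 /\ rankX (elim P sigma) g.1 = rankX N g.1.
  move=> hg; have hg' : g \in sigma by rewrite -mem.
  by rewrite (exposed_rankX ex hg) (exposed_rankX exP hg') (rankX_elim_in ex hg) (rankX_elim_in exP hg') nx.
(* An earlier step would have moved an agent of [rho] away from its partner in M, from which [sigma]
   still starts. The steps after [sigma] are excluded in the same way at the end N. *)
have t0 : take i R = [::].
  case E: (take i R) h1 => [//|tau R1] h1.
  have [e he] : exists e, e \in tau by case: h1 => /exposed_ne.
  have ht : tau \in tau :: R1 by apply: mem_head.
  have lt := elim_seq_gtX filled_sub h1 ht he.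
  have [|g hg [Eg _ _]] := @rankX_moved e.1.
    by have := elim_leX exP e.1; have := hi e.1; lia.
  by have [E' _] := Pg g hg; rewrite Eg in lt; lia.
have d0 : drop i.+1 R = [::].
  case E: (drop i.+1 R) h2 => [//|tau R1] h2.
  have [e he] : exists e, e \in tau by case: h2 => /exposed_ne.
  have ht : tau \in tau :: R1 by apply: mem_head.
  have lt := elim_seq_gtX filled_sub h2 ht he.
  have [|g hg [Eg _ _]] := @rankX_moved e.1.
    by have := elim_leX exP e.1; have := lo e.1; lia.
  by have [_ E'] := Pg g hg; rewrite Eg in lt; lia.
by rewrite -(cat_take_drop i R) (drop_nth [::] li) t0 d0 Ei.
Qed.

(** [sigma] is exposed in the filled table and [rho] in U, while the dichotomy speaks of a single
    table. Instead the edges are compared: both rotations lead from M to the same matching N. *)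
Lemma single_chain sigma : elim_seq T V M [:: sigma] N -> same_rotation sigma rho.
Proof.
move=> [exs EN].
have mem e : e \in sigma -> [/\ e \in rho & (nxt rho e).2 = (nxt sigma e).2].
  move=> he; have r1 := exposed_rankX exs he; have r2 := rankX_elim_in exs he.
  have lt := exposed_ltX exs he; rewrite -EN in r2.
  have [|g hg [Eg E1 E2]] := @rankX_moved e.1; first by lia.
  have eE : (e.1, e.2) \in edges T.
    by rewrite -surjective_pairing (subsetP (stable_sub sU stM)) ?(exposed_in exs).
  have eg : e = g.
    rewrite (surjective_pairing e) (surjective_pairing g) -Eg -(@posX_inj _ _ T e.1 e.2 g.2) //.
    by rewrite -r1.
  rewrite -eg in hg E2; split=> //; apply: (@posX_inj _ _ T e.1); last by rewrite -E2 r2.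
  exact: (subsetP sU) _ (exposed_table ex hg).
apply: rotation_agree.
- exact: exposed_uniq ex.
- exact: exposed_uniq exs.
- by case: exs => _ [].
move=> e he; have [hr E] := mem e he; split=> //.
apply: (exposed_inj2 ex) => //; first by rewrite mem_nxt.
by apply: (mem _ _).1; rewrite mem_nxt.
Qed.

Lemma exposed_subtable W P sigma : W \subset V -> P \subset W ->
  rot_edges sigma \subset W -> exposed T V P sigma -> exposed T W P sigma.
Proof.
move=> sW sP sE [[_ m nb] [ne u1 u2 k] k3]; split.
- by split=> // x y hW; apply: nb; apply: (subsetP sW).
- split=> // e he; have [? _ ? ?] := k e he; split=> //.
  by apply: (subsetP sE); rewrite in_setU; apply/orP; right; apply/mem_moved; exists e.
- by move=> e y he hW; apply: k3 => //; apply: (subsetP sW).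
Qed.

Lemma elim_sub P sigma W : P \subset W -> rot_edges sigma \subset W ->
  elim P sigma \subset W.
Proof.
move=> sP sE; rewrite /elim subUset (subset_trans (subsetDl _ _) sP) /=.
exact: subset_trans (subsetUr _ _) sE.
Qed.

Lemma rot_edges_exposed W P sigma : exposed T W P sigma ->
  rot_edges sigma \subset P :|: elim P sigma.
Proof.
move=> exs; apply/subsetP=> -[x y].
rewrite [_ \in rot_edges _]in_setU in_set [_ \in P :|: _]in_setU => /orP [/(exposed_in exs) -> //|h].
by apply/orP; right; rewrite in_setU h orbT.
Qed.

Lemma chain_subtable W R P Q : W \subset V -> P \subset W ->
  (forall sigma, sigma \in R -> rot_edges sigma \subset W) ->
  elim_seq T V P R Q -> elim_seq T W P R Q.
Proof.
move=> sW; elim: R P => [|sigma R IH] P sP sE //= [exs h].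
have sEs : rot_edges sigma \subset W by apply: sE; apply: mem_head.
split; first exact: exposed_subtable exs.
by apply: IH => //; [apply: elim_sub | move=> tau ht; apply: sE; rewrite inE ht orbT].
Qed.

Lemma mem_extended R sigma : sigma \in R -> rot_edges sigma \subset extended_table U R.
Proof.
move=> hs; rewrite /extended_table; apply: subset_trans (subsetUr _ _).
by rewrite (big_rem _ hs) subsetUl.
Qed.

Lemma extended_sub R W : U \subset W ->
  (forall sigma, sigma \in R -> rot_edges sigma \subset W) -> extended_table U R \subset W.
Proof.
move=> sW h; rewrite /extended_table subUset sW /=.
elim: R h => [|sigma R IH] h; first by rewrite big_nil sub0set.
rewrite big_cons subUset h ?mem_head //= IH // => tau ht.
by rewrite h // inE ht orbT.
Qed.

(** The chain is found with the whole gap available, but the extended table contains only the edges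
    of its rotations. Stability and exposure pass down to a subtable that keeps the edges of the
    matchings and rotations involved. *)
Lemma chain_dissecting M0 R : X_optimal T U M0 ->
  elim_set T U M0 (predecessor T U rho) M ->
  elim_seq T V M R N -> size R != 1 -> dissecting T U rho R.
Proof.
move=> opt pre hR sz.
have sE sigma : sigma \in R -> rot_edges sigma \subset V.
  move=> hs; have [P [exs _ _]] := elim_seq_mem hR hs.
  apply: subset_trans (rot_edges_exposed exs) _; rewrite subUset.
  by case: (exposed_stable exs) => -> _ _; case: (elim_stable filled_sub exs) => ->.
have sW : extended_table U R \subset V by apply: extended_sub => //; apply: subsetUl.
have hW : elim_seq T (extended_table U R) M R N.
  apply: chain_subtable hR => //; last exact: mem_extended.
  by case: stM => s _ _; apply: subset_trans s (subsetUl _ _).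
have dR := elim_seq_distinct filled_sub hR.
split=> //; first exact: subset_trans sW filled_sub.
  move=> sigma hs; split; first by have [P [exs _ _]] := elim_seq_mem hW hs; exists P.
  by move/(rotation_in_chain hR hs) => E; rewrite E in sz.
by exists M0, M; split=> //; exists R; split.
Qed.

End Fixed.

(** With an empty gap every matching met between M and N uses edges of U only, so the extended table
    is U itself. Then a member of R would be both a rotation and not a rotation of U, while an empty
    R cannot lead from M to a different matching. *)
Lemma dissecting_gap U rho R : U \subset edges T -> dissecting T U rho R ->
  gap rho != set0.
Proof.
move=> sU [_ sE rots [M0 [M [_ _ ex [R1 [_ same chain]]]]]]; apply/eqP=> g0.
have V0 : filled U rho = U by rewrite /filled g0 setU0.
set W := extended_table U R in sE rots chain.
have stM := exposed_stable ex; have stN := elim_stable sU ex.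
have [e0 he0] := exposed_ne ex.
have neMN : M <> elim M rho.
  move=> E; have := exposed_ltX ex he0; rewrite -(exposed_rankX ex he0).
  by rewrite -(rankX_elim_in ex he0) -E ltnn.
have wM : stable T W M.
  (* The first rotation, being exposed in W, carries the stability of M in W; with no rotation at
     all M would equal M / [rho]. *)
  by case: R1 chain {same} => [/esym //|sigma R1 [/exposed_stable]].
have wN : stable T W (elim M rho) by apply: elim_seq_stable chain.
have sub1 sigma : sigma \in R1 -> rot_edges sigma \subset U.
  move=> hs; have [P [exs lo hi]] := elim_seq_mem chain hs.
  apply: subset_trans (rot_edges_exposed exs) _; rewrite subUset -V0.
  have stP := exposed_stable exs; have stP' := elim_stable sE exs.
  rewrite (between_filled sU ex sE wM wN stP) // => [|x]; last first.
    exact: leq_trans (elim_leX exs x) (hi x).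
  apply: (between_filled sU ex sE wM wN stP') => // x.
  exact: leq_trans (lo x) (elim_leX exs x).
have sub sigma : sigma \in R -> rot_edges sigma \subset U.
  move=> hs; have : in_rotations R sigma by exists sigma => //; exists 0; rewrite rot0.
  move/same=> [tau ht sr]; apply: subset_trans (sub1 _ ht).
  have [[P /exposed_uniq us] _] := rots _ hs.
  apply/subsetP=> -[x y]; rewrite !in_setU !inE.
  rewrite -(same_rotation_mem sr) => /orP [-> //|/mem_moved [e he [-> ->]]].
  apply/orP; right; apply/mem_moved; exists e; first by rewrite (same_rotation_mem sr).
  by rewrite (same_rotation_nxt us sr).
have EW : W = U.
  by apply/eqP; rewrite eqEsubset subsetUl andbT; apply: extended_sub.
case: R @W EW sub rots same chain {sE wM wN sub1} => [|sigma R] W EW sub rots same chain.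
  case: R1 same chain => [|sigma R1] same /=; first by move/esym.
  by have [] := (same sigma).1; first by exists sigma; [apply: mem_head | exists 0; rewrite rot0].
have [rot nrot] := rots sigma (mem_head _ _).
by apply: nrot; rewrite EW in rot.
Qed.

(** A chain of length other than one is an admissible set. A chain of length one is [rho] up to a
    shift, and then the gap is empty and no admissible set exists. The last hypothesis fixes the
    starting index. *)
Lemma chain_solves_DR U M0 M rho R : U \subset edges T -> exposed T U M rho ->
  X_optimal T U M0 -> elim_set T U M0 (predecessor T U rho) M ->
  elim_seq T (filled U rho) M R (elim M rho) ->
  (forall sigma, R = [:: sigma] -> forall e, ohead rho = Some e ->
     e.1 \in map fst sigma -> omap fst (ohead sigma) = Some e.1) ->
  solves_DR T U rho R.
Proof.
move=> sU ex opt pre hR hd.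
case: (eqVneq (size R) 1) => [sz|sz]; last first.
  have d := chain_dissecting sU ex opt pre hR sz.
  by split=> [//|[]]; exists R.
case: R sz hR hd => [//|sigma [|//]] _ hR /(_ sigma erefl) hd.
have sr := single_chain sU ex hR.
have us : uniq sigma by case: hR => /exposed_uniq.
have E : sigma = rho.
  case: rho sr ex hd {pre hR} => [|e rho] sr ex hd; first by case: ex => _ [].
  have he : e \in sigma by rewrite -(same_rotation_mem sr) mem_head.
  have := hd e erefl (map_f fst he).
  case: sigma us sr he {hd} => [//|f sigma] us sr he [E1].
  have fe : f = e.
    apply: (exposed_inj1 ex) => //; last exact: mem_head.
    by rewrite (same_rotation_mem sr) mem_head.
  rewrite fe in us sr *; congr cons; apply/esym.
  apply: (cycle_next_inj (exposed_uniq ex) us) => g _.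
  exact: (same_rotation_nxt us sr).
have no : ~ exists R', dissecting T U rho R'.
  move=> [R' /(dissecting_gap sU) /negP]; apply; apply/eqP.
  by apply: (exposed_filled_gap ex); case: hR; rewrite E.
by split=> [//|_]; rewrite E.
Qed.

End Gap.

(** * The stack algorithm *)

Section StackAlgorithm.
Variables (X Y : finType) (T : instance X Y).
Variables (U M : {set X * Y}) (rho : seq (X * Y)).
Hypothesis sU : U \subset edges T.
Hypothesis ex : exposed T U M rho.
Implicit Types (P : {set X * Y}) (sigma : seq (X * Y)) (R : seq (seq (X * Y))).
Implicit Types (x z : X) (y : Y) (e : X * Y) (stk : seq X) (ptr : X -> nat).

Local Notation posX := (posX T).
Local Notation posY := (posY T).
Local Notation rankX := (rankX T).
Local Notation rankY := (rankY T).
Local Notation N := (elim M rho).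
Local Notation V := (filled T U rho).

Let sV : V \subset edges T := filled_sub rho sU.
Let stM : stable T V M := M_stable_filled ex.
Let stN : stable T V N := N_stable_filled sU ex.

(** The window on the Y side: y would leave its partner in P for x, and x is no better than its
    partner in N. For positions of x up to its partner in N this decides whether xy is a usable edge
    of the filled table. *)
Definition cond P x y := rankY N y <= posY y x < rankY P y.

Definition link P ptr : rel X := fun x z =>
  [exists y, [&& (z, y) \in P, y \in prefX T x, posX x y == ptr x & cond P x y]].

Lemma linkP P ptr x z : reflect
  (exists y, [/\ (z, y) \in P, y \in prefX T x, posX x y = ptr x & cond P x y])
  (link P ptr x z).
Proof.
apply: (iffP existsP) => [[y /and4P [h1 h2 /eqP h3 h4]]|[y [h1 h2 h3 h4]]].
  by exists y.
by exists y; rewrite h1 h2 h3 eqxx.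
Qed.

(* [stk] is a walk, bottom first, in the functional graph whose cycles are the
   rotations exposed in [P]; positions of the list of x between its partner
   and [ptr x] are already known not to lead anywhere. *)
Record walk_inv P R stk ptr (i : nat) : Prop := WalkInv {
  inv_chain : elim_seq T V M R P;
  inv_hi : forall x, rankX P x <= rankX N x;
  inv_ptr : forall e, e \in rho -> rankX P e.1 < ptr e.1;
  inv_scan : forall e y, e \in rho -> y \in prefX T e.1 ->
    rankX P e.1 < posX e.1 y < ptr e.1 -> ~~ cond P e.1 y;
  inv_uniq : uniq stk;
  inv_stk : forall x, x \in stk -> rankX P x < rankX N x;
  inv_link : sorted (link P ptr) stk;
  inv_done : forall e, e \in take i rho -> rankX P e.1 = rankX N e.1;
  inv_first : R = [::] -> i = 0 /\ forall e, ohead rho = Some e ->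
    forall x s, stk = x :: s -> x = e.1;
  inv_head : forall sigma R', R = sigma :: R' -> forall e, ohead rho = Some e ->
    e.1 \in map fst sigma -> omap fst (ohead sigma) = Some e.1 }.

Lemma moved_rho P x : (forall x, rankX M x <= rankX P x) -> rankX P x < rankX N x ->
  exists2 e : X * Y, e \in rho & e.1 = x.
Proof.
move=> lo lt; have [|g hg [-> _ _]] := rankX_moved ex (x := x); last by exists g.
by have := lo x; lia.
Qed.

Lemma rho_ltX e : e \in rho -> rankX M e.1 < rankX N e.1.
Proof.
by move=> he; rewrite (exposed_rankX ex he) (rankX_elim_in ex he) (exposed_ltX ex).
Qed.

Section Inv.
Variables (P : {set X * Y}) (R : seq (seq (X * Y))).
Variables (stk : seq X) (ptr : X -> nat) (i : nat).
Hypothesis I : walk_inv P R stk ptr i.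

Lemma inv_stable : stable T V P.
Proof. exact: (elim_seq_stable sV stM (inv_chain I)). Qed.

Let stP := inv_stable.
Let mP := stable_match stP.

Lemma inv_lo x : rankX M x <= rankX P x.
Proof. exact: elim_seq_leX (inv_chain I). Qed.

Lemma inv_hiY y : rankY N y <= rankY P y.
Proof. exact: (stable_opposite sV stP stN (inv_hi I)). Qed.

Lemma inv_loY y : rankY P y <= rankY M y.
Proof. exact: (stable_opposite sV stM stP inv_lo). Qed.

Lemma inv_stk_rho x : x \in stk -> exists2 e : X * Y, e \in rho & e.1 = x.
Proof. by move=> /(inv_stk I); apply: moved_rho; apply: inv_lo. Qed.

Lemma cond_filled x y : rankX P x < posX x y -> posX x y <= rankX N x ->
  y \in prefX T x -> cond P x y -> (x, y) \in V.
Proof.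
move=> l1 l2 hy /andP [l3 l4].
have hE : (x, y) \in edges T by rewrite mem_edges.
have sN : N \subset U by case: (elim_stable sU ex).
have mN := stable_match stN; have sN' := stable_sub sV stN.
rewrite in_setU; move: l2; rewrite leq_eqVlt => /orP [/eqP E|l2].
  by rewrite (subsetP sN) //; apply: (rankX_inj sN' mN).
have ne : rankY N y != posY y x.
  apply/eqP=> E; have := rankX_in T mN (rankY_inj sN' mN hE E); lia.
have [|g hg [Ex E1 E2]] := rankX_moved ex (x := x); first by have := inv_lo x; lia.
have [|h hh [Ey E3 E4]] := rankY_moved ex (y := y); first by have := inv_loY y; lia.
apply/orP; right; apply/gapP; exists g, h; split=> //; split=> //.
  by have := inv_lo x; lia.
by have := inv_loY y; lia.
Qed.

(** The lower end of the window holds because xy does not block N. *)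
Lemma filled_cond x y : (x, y) \in V -> posX x y <= rankX N x -> posY y x < rankY P y ->
  cond P x y.
Proof.
move=> hV l1 l2; rewrite /cond l2 andbT; move: l1; rewrite leq_eqVlt => /orP [/eqP E|l1].
  have hN := rankX_inj (stable_sub sV stN) (stable_match stN) (subsetP sV _ hV) (esym E).
  by rewrite (rankY_in T (stable_match stN) hN).
by rewrite leqNgt; apply/negP; apply: stable_noblock stN hV l1.
Qed.

(** The partner of x in N always passes the test, so the scan cannot run past it; in particular no
    list is exhausted. *)
Lemma inv_ptr_le x : x \in stk -> rankX P x < ptr x <= rankX N x /\ rankX N x < size (prefX T x).
Proof.
move=> hx; have [e he Ex] := inv_stk_rho hx; have lt := inv_stk I hx.
have [y [y' [h h' _ lY]]] := (decomposition sV stP stN).1 x lt.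
have mN := stable_match stN; have yp : y' \in prefX T x.
  by rewrite -mem_edges (subsetP (stable_sub sV stN)).
have r := rankX_in T mN h'.
have c : cond P x y' by rewrite /cond -(rankY_in T mN h') leqnn.
split; last by rewrite r index_mem.
have l1 := inv_ptr I he; have n := inv_scan I he (y := y'); rewrite Ex in l1 n.
rewrite l1 /= leqNgt; apply/negP=> l2.
by have := n yp; rewrite -r lt l2 c => /(_ isT).
Qed.

Lemma inv_candidate x : x \in stk -> exists y, [/\ y \in prefX T x, posX x y = ptr x &
  rankX P x < posX x y <= rankX N x].
Proof.
move=> hx; have [l1 l2] := inv_ptr_le hx.
have [y0 _] : {y | (x, y) \in N} by apply: (@rankX_mate _ _ T).
have lt : ptr x < size (prefX T x) by lia.
exists (nth y0 (prefX T x) (ptr x)).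
by rewrite mem_nth // /posX index_uniq ?prefX_uniq.
Qed.

Lemma inv_link_lt x z : x \in stk -> link P ptr x z -> rankX P z < rankX N z.
Proof.
move=> hx /linkP [y [hP yp E c]]; have [/andP [l1 l2] _] := inv_ptr_le hx.
rewrite -E in l1 l2; have hV := cond_filled l1 l2 yp c.
have [|x' h' l'] := better_between sV stP stN hV (inv_stk I hx) l2.
  by case/andP: c.
by rewrite (mP.2 _ _ _ hP h').
Qed.

Lemma inv_link_candidate x y : x \in stk -> y \in prefX T x -> posX x y = ptr x ->
  cond P x y -> exists2 z, (z, y) \in P & link P ptr x z.
Proof.
move=> hx yp E c; have [/andP [l1 l2] _] := inv_ptr_le hx; rewrite -E in l1 l2.
have [|z hz _] := better_between sV stP stN (cond_filled l1 l2 yp c) (inv_stk I hx) l2.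
  by case/andP: c.
by exists z => //; apply/linkP; exists y.
Qed.

Lemma inv_rankY_out y : y \notin map snd rho -> rankY N y = rankY P y.
Proof.
move=> n; have := rankY_elim_out T M n; have := inv_hiY y; have := inv_loY y; lia.
Qed.

(** Outside [rho] the window is empty, which is why the program may store 0 for both of its ends. *)
Lemma cond_snd x y : cond P x y -> y \in map snd rho.
Proof. by apply: contraTT => /inv_rankY_out E; rewrite /cond E; lia. Qed.

Lemma inv_mate e : e \in rho -> exists y, (e.1, y) \in P.
Proof.
move=> he; have [|y h] := @rankX_mate _ _ T P e.1; last by exists y.
apply: leq_ltn_trans (inv_hi I e.1) _; rewrite (rankX_elim_in ex he) index_mem -mem_edges.
exact: (subsetP sU) _ (exposed_table ex he).
Qed.

Lemma inv_mate_snd x y : (x, y) \in P -> x \in map fst rho -> y \in map snd rho.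
Proof.
move=> h /mem_fstP [e he Ex]; apply: contraT => n.
have E : rankY M y = posY y x.
  rewrite -(rankY_in T mP h); have := rankY_elim_out T M n; have := inv_hiY y.
  by have := inv_loY y; lia.
have mM := stable_match stM.
have hM := rankY_inj (stable_sub sV stM) mM (subsetP (stable_sub sV stP) _ h) E.
have := exposed_in ex he; rewrite (surjective_pairing e) -Ex => hM'.
by move: n; rewrite (mM.1 _ _ _ hM hM') map_f.
Qed.

(** The program stores final and current ranks on the Y side only; whether x has arrived is read off
    its partner. *)
Lemma inv_done_test x y : (x, y) \in P -> (rankY N y == rankY P y) = (rankX P x == rankX N x).
Proof.
move=> h; have hE := subsetP (stable_sub sV stP) _ h.
have [mN sN] := (stable_match stN, stable_sub sV stN).
rewrite (rankX_in T mP h) (rankY_in T mP h); apply/eqP/eqP => E.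
  by rewrite (rankX_in T mN (rankY_inj sN mN hE E)).
by rewrite (rankY_in T mN (rankX_inj sN mN hE (esym E))).
Qed.

End Inv.

Lemma invariant_init ptr : (forall e, e \in rho -> ptr e.1 = (posX e.1 e.2).+1) ->
  walk_inv M [::] [::] ptr 0.
Proof.
move=> hp; split=> //.
- by move=> x; apply: elim_leX ex x.
- by move=> e he; rewrite (exposed_rankX ex he) hp.
- by move=> e y he hy; rewrite (exposed_rankX ex he) hp //; lia.
- by rewrite take0.
Qed.

Lemma invariant_final P R stk ptr : walk_inv P R stk ptr (size rho) -> P = N.
Proof.
move=> I; have stP := inv_stable I.
apply: (eq_matching (T := T)).
- exact: (stable_sub sV stP).
- exact: (stable_sub sV stN).
- exact: stable_match stP.
- exact: stable_match stN.
move=> x; apply/eqP; rewrite eqn_leq (inv_hi I) leqNgt; apply/negP=> lt.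
have [e he Ex] := moved_rho (inv_lo I) lt.
by have := inv_done I (e := e); rewrite take_size Ex => /(_ he); lia.
Qed.

Lemma invariant_skip P R s x y ptr ptr' i :
  walk_inv P R (rcons s x) ptr i -> y \in prefX T x -> posX x y = ptr x -> ~~ cond P x y ->
  ptr' x = (ptr x).+1 -> (forall z, z != x -> ptr' z = ptr z) ->
  walk_inv P R (rcons s x) ptr' i.
Proof.
move=> I yp E nc Ex Ez; case: (I) => c1 c2 c3 c4 c5 c6 c7 c8 c9 c10; split=> //.
- move=> e he; case: (eqVneq e.1 x) => [Ee|/Ez -> //]; last exact: c3.
  by rewrite Ee Ex; have := c3 e he; rewrite Ee; lia.
- move=> e y' he hy; case: (eqVneq e.1 x) => [Ee|/Ez ->]; last exact: c4.
  rewrite Ee Ex ltnS => /andP [l1]; rewrite leq_eqVlt => /orP [/eqP E'|l2].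
    have hE : (x, y') \in edges T by rewrite mem_edges -Ee.
    by rewrite (posX_inj hE (y' := y)) // E' E.
  by have := c4 e y' he hy; rewrite Ee l1 l2; apply.
(* Only the pointer of the top of the stack changes, and the top is the source of no link in the
   walk. *)
apply/(sortedP x) => k lt; move/(sortedP x): c7 => /(_ k lt) /linkP [z [h1 h2 h3 h4]].
rewrite size_rcons ltnS in lt; rewrite nth_rcons lt in h2 h3 h4 *.
apply/linkP; exists z; split=> //; rewrite Ez //.
by move: c5; rewrite rcons_uniq => /andP [n _]; apply: contraNneq n => <-; apply: mem_nth.
Qed.

Lemma invariant_push P R s x z ptr i :
  walk_inv P R (rcons s x) ptr i -> link P ptr x z -> z \notin rcons s x ->
  walk_inv P R (rcons (rcons s x) z) ptr i.
Proof.
move=> I l nz; case: (I) => c1 c2 c3 c4 c5 c6 c7 c8 c9 c10; split=> //.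
- by rewrite rcons_uniq nz.
- move=> w; rewrite mem_rcons inE => /orP [/eqP ->|/c6 //].
  by apply: (inv_link_lt I) l; rewrite mem_rcons mem_head.
- case: s {I c5 c6 c9 nz} c7 => [|w s] /=; first by rewrite l.
  by rewrite !rcons_path last_rcons l => -> .
- move=> R0; have [i0 h] := c9 R0; split=> // e he w t E.
  by case: s E h {I c5 c6 c7 c9 nz} => [|w' s] [E _] h; rewrite -E; apply: h he _ _ erefl.
Qed.

Lemma invariant_start P R e ptr i : walk_inv P R [::] ptr i -> i < size rho ->
  e = nth e rho i -> rankX P e.1 < rankX N e.1 -> walk_inv P R [:: e.1] ptr i.
Proof.
move=> I li E lt; case: (I) => c1 c2 c3 c4 c5 c6 c7 c8 c9 c10; split=> //.
  by move=> x; rewrite inE => /eqP ->.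
move=> R0; have [i0 _] := c9 R0; split=> // e' he' x s [<- _].
by rewrite E i0; case: rho he' => //= a t [->].
Qed.

Lemma invariant_next P R e ptr i : walk_inv P R [::] ptr i -> i < size rho ->
  e = nth e rho i -> rankX P e.1 = rankX N e.1 -> walk_inv P R [::] ptr i.+1.
Proof.
move=> I li E Er; case: (I) => c1 c2 c3 c4 c5 c6 c7 c8 c9 c10; split=> //.
  move=> e'; rewrite (take_nth e li) mem_rcons inE => /orP [/eqP ->|/c8 //].
  by rewrite -E.
(* Before the first emission P is still M, in which every agent of [rho] has to move; so the head of
   [rho] cannot be skipped. *)
move=> R0; rewrite R0 /= in c1.
have he : e \in rho by rewrite E mem_nth.
by have := rho_ltX he; rewrite -Er c1 ltnn.
Qed.

(** * Emission of the cycle that closes at the top of the stack *)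

Section Emit.
Variables (P : {set X * Y}) (R : seq (seq (X * Y))) (s1 c : seq X).
Variables (ptr : X -> nat) (i : nat) (m s : X -> Y).
Hypothesis I : walk_inv P R (s1 ++ c) ptr i.
Hypothesis closed : if c is z :: c' then link P ptr (last z c') z else False.
Hypothesis m_mate : forall x, x \in c -> (x, m x) \in P.
Hypothesis s_ptr : forall x, x \in c -> s x \in prefX T x /\ posX x (s x) = ptr x.

Let sigma := [seq (x, m x) | x <- c].
Let stP := inv_stable I.
Let mP := stable_match stP.

Let uc : uniq c.
Proof. by have := inv_uniq I; rewrite cat_uniq => /and3P []. Qed.

Lemma emit_cycle : cycle (link P ptr) c.
Proof.
have : sorted (link P ptr) c by have := inv_link I; case/cat_sorted2.
by case: c closed => //= z c' l; rewrite rcons_path l andbT.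
Qed.

Lemma emit_next x : x \in c -> (next c x, s x) \in P /\ cond P x (s x).
Proof.
move=> hx; have /linkP [y [h1 h2 h3 h4]] := next_cycle emit_cycle hx.
have [hs Es] := s_ptr hx.
have hE : (x, y) \in edges T by rewrite mem_edges.
by rewrite -(posX_inj hE (y' := s x)) // Es.
Qed.

Lemma emit_stk x : x \in c -> x \in s1 ++ c.
Proof. by rewrite mem_cat orbC => ->. Qed.

(** The last clause of [exposed] is the record of the scan: an entry skipped between the partner and
    the pointer failed the test, and [filled_cond] says that an entry violating the clause would
    have passed it. *)
Lemma emit_exposed : exposed T V P sigma /\
  (forall x, x \in c -> nxt sigma (x, m x) = (next c x, s x)).
Proof.
have ne : c != [::] by case: c closed.
apply: cycle_exposed => //.
- move=> x hx; have [h1 h2] := emit_next hx; have [hs Es] := s_ptr hx.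
  have [/andP [l1 l2] _] := inv_ptr_le I (emit_stk hx); rewrite -Es in l1 l2.
  split=> //; first exact: m_mate.
  exact: (cond_filled I).
- move=> x hx; have [h1 /andP [h2 h3]] := emit_next hx; have [hs Es] := s_ptr hx.
  have [/andP [l1 l2] _] := inv_ptr_le I (emit_stk hx).
  by rewrite -(rankX_in T mP (m_mate hx)) Es.
move=> x y hx hV; rewrite -(rankX_in T mP (m_mate hx)); have [hs ->] := s_ptr hx => l1 l2.
have [/andP [_ l3] _] := inv_ptr_le I (emit_stk hx).
rewrite leqNgt; apply/negP=> l4.
have [e he Ex] := inv_stk_rho I (emit_stk hx).
have yp : y \in prefX T x by rewrite -mem_edges (subsetP sV).
have := inv_scan I he (y := y); rewrite Ex l1 l2 (filled_cond hV) //.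
  by move=> /(_ yp isT).
by lia.
Qed.

Let exs := emit_exposed.1.

Lemma emit_fst : map fst sigma = c.
Proof. by rewrite /sigma -map_comp map_id_in. Qed.

Lemma emit_rankX x : rankX (elim P sigma) x = if x \in c then ptr x else rankX P x.
Proof.
case: ifP => hx; last by rewrite rankX_elim_out // emit_fst hx.
have hs : (x, m x) \in sigma by apply: map_f.
by rewrite (rankX_elim_in exs hs) emit_exposed.2 //=; case: (s_ptr hx).
Qed.

Lemma emit_mateX x : x \in c -> (x, s x) \in elim P sigma.
Proof.
move=> hx; have hs : (x, m x) \in sigma by apply: map_f.
by have := elim_moved P hs; rewrite emit_exposed.2.
Qed.

Lemma emit_snd y : (y \in map snd sigma) = (y \in map s c).
Proof.
have E x : x \in c -> m (next c x) = s x.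
  move=> hx; have [h _] := emit_next hx; apply: (mP.1 _ _ _ _ h).
  by apply: m_mate; rewrite mem_next.
rewrite /sigma -map_comp; apply/mapP/mapP => -[x hx ->] /=.
  exists (prev c x); first by rewrite mem_prev.
  by rewrite -E ?mem_prev // next_prev.
by exists (next c x); rewrite ?mem_next //= E.
Qed.

Lemma emit_keep x y : (x, y) \in P -> x \notin c -> (x, y) \in elim P sigma.
Proof. by move=> h n; apply: elim_keep; rewrite ?emit_fst. Qed.

Lemma emit_rankY_out y : y \notin map s c -> rankY (elim P sigma) y = rankY P y.
Proof. by move=> n; apply: rankY_elim_out; rewrite emit_snd. Qed.

Lemma emit_rankY_in x : x \in c -> rankY (elim P sigma) (s x) = posY (s x) x.
Proof.
by move=> hx; apply: rankY_in (emit_mateX hx); apply: elim_matching exs.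
Qed.

Lemma invariant_emit ptr' : (forall x, ptr' x = ptr x + (x \in c)) ->
  walk_inv (elim P sigma) (rcons R sigma) s1 ptr' i.
Proof.
move=> hp; case: (I) => c1 c2 c3 c4 c5 c6 c7 c8 c9 c10.
have hi x : rankX (elim P sigma) x <= rankX N x.
  rewrite emit_rankX; case: ifP => // hx.
  by have [/andP [] //] := inv_ptr_le I (emit_stk hx).
have n1 x : x \in s1 -> x \notin c.
  move=> hx; move: c5; rewrite cat_uniq => /and3P [_ /hasPn n _].
  by apply/negP=> /n; rewrite hx.
split=> //.
- by rewrite -cats1; apply/elim_seq_cat; exists P.
- move=> e he; rewrite emit_rankX hp; case: ifP => _; first by rewrite addn1.
  by rewrite addn0 c3.
(* On the cycle the scanned interval becomes empty, since the partner moves to the old pointer.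
   Elsewhere a failed test stays failed, because the agents of Y only improve. *)
- move=> e y he hy; rewrite emit_rankX hp; case: ifP => _; first by lia.
  rewrite addn0 => h; have := c4 e y he hy h; apply: contra.
  rewrite /cond => /andP [-> l] /=; apply: leq_trans l _; exact: elim_leY exs y.
- by move: c5; rewrite cat_uniq => /andP [].
- by move=> x hx; rewrite emit_rankX (negPf (n1 x hx)) c6 // mem_cat hx.
(* The links inside the remaining stack lead to agents outside the cycle, whose partners and ranks
   are unchanged. *)
- have : sorted (link P ptr) s1 by case/cat_sorted2: c7.
  apply: (sub_in_sorted (P := mem s1)); last by apply/allP.
  move=> x z hx hz /linkP [y [h1 h2 h3 h4]]; apply/linkP; exists y.
  rewrite hp (negPf (n1 x hx)) addn0.
  have h1' := emit_keep h1 (n1 z hz); split=> //.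
  move: h4; rewrite /cond (rankY_in T mP h1).
  by rewrite (rankY_in T _ h1') //; apply: elim_matching exs.
- move=> e he; apply/eqP; rewrite eqn_leq hi -(c8 e he).
  exact: elim_leX exs e.1.
- by case: (R).
(* The first walk has the head of [rho] at its bottom. If the first cycle contains this agent,
   nothing is left below the cycle, and so it begins there. *)
move=> tau R' E e he ht; case: (R) c9 c10 E => [|r0 R0] c9 c10 /= [E _]; last first.
  by rewrite -E; apply: c10 he _; rewrite // E.
have [_ /(_ e he) hd] := c9 erefl.
move: ht; rewrite -E emit_fst => ht.
case: (s1) c5 hd => [|w s1'] c5 hd; last first.
  by move: c5; rewrite (hd w (s1' ++ c)) //= mem_cat ht orbT.
by rewrite /sigma; case: (c) ht hd => //= z c' ht hd; rewrite (hd z c').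
Qed.

End Emit.
End StackAlgorithm.

(** * Word RAM programs *)

Fixpoint den (s : store) (e : expr) : nat :=
  match e with
  | Const v => v
  | Read a e1 => s a (den s e1)
  | Add e1 e2 => den s e1 + den s e2
  | Defs.Sub e1 e2 => den s e1 - den s e2
  | Mul e1 e2 => den s e1 * den s e2
  | Eq e1 e2 => den s e1 == den s e2
  | Lt e1 e2 => den s e1 < den s e2
  end.

(* [exec] without the bound on machine words. *)
Inductive uexec : cmd -> store -> nat -> store -> Prop :=
| USkip s : uexec Skip s 1 s
| UWrite s a e1 e2 :
    uexec (Write a e1 e2) s (cost e1 + cost e2).+1 (update s a (den s e1) (den s e2))
| USeq p1 p2 s1 s2 s3 t1 t2 :
    uexec p1 s1 t1 s2 -> uexec p2 s2 t2 s3 -> uexec (Seq p1 p2) s1 (t1 + t2).+1 s3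
| UIf e p1 p2 s s' t :
    uexec (if den s e != 0 then p1 else p2) s t s' ->
    uexec (If e p1 p2) s (cost e + t).+1 s'
| UWhileStop e p s : den s e = 0 -> uexec (While e p) s (cost e).+1 s
| UWhileStep e p s1 s2 s3 t1 t2 :
    den s1 e != 0 -> uexec p s1 t1 s2 -> uexec (While e p) s2 t2 s3 ->
    uexec (While e p) s1 (cost e + t1 + t2).+1 s3.

Definition bounded (B : nat) (s : store) := forall a i, s a i <= B.

Fixpoint consts_le (B : nat) (e : expr) : bool :=
  match e with
  | Const v => v <= B
  | Read _ e1 => consts_le B e1
  | Add e1 e2 | Defs.Sub e1 e2 | Mul e1 e2 | Eq e1 e2 | Lt e1 e2 =>
      consts_le B e1 && consts_le B e2
  end.

Definition increment (e : expr) : bool :=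
  match e with
  | Const v => v <= 1
  | Read _ _ => true
  | Add (Read _ _) (Const v) => v <= 1
  | Defs.Sub (Read _ _) _ => true
  | _ => false
  end.

(** Constants up to 2 are needed to address the three cells of array 0. *)
Definition small (K : nat) (e : expr) := (cost e <= K) && consts_le 2 e.

(* In a tame program one step increases the largest value in memory by at most
   one, so that running time bounds word size. *)
Fixpoint tame (K : nat) (p : cmd) : bool :=
  match p with
  | Skip => true
  | Write _ e1 e2 => [&& small K e1, small K e2 & increment e2]
  | Seq p1 p2 => tame K p1 && tame K p2
  | If e p1 p2 => [&& small K e, tame K p1 & tame K p2]
  | While e p => small K e && tame K p
  end.

Lemma cost_gt0 e : 0 < cost e.
Proof. by case: e. Qed.

Lemma expn_add_le B a b : 2 <= B -> B ^ a + B ^ b <= B ^ (a + b).+1.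
Proof.
move=> B2; have h (c d : nat) : B ^ c <= B ^ (c + d).
  by rewrite leq_exp2l ?leq_addr.
by have := h a b; have := h b a; rewrite expnS (addnC b); nia.
Qed.

(** Multiplication is the worst case: it multiplies the bounds, so their exponents add up, as the
    costs do. For sums [2 <= B] makes the extra unit of cost suffice. *)
Lemma eval_den W B s e : bounded B s -> 2 <= B -> consts_le 2 e -> B ^ cost e < W ->
  eval W s e = Some (den s e) /\ den s e <= B ^ cost e.
Proof.
move=> bd B2; have B0 : 0 < B by lia.
have mono a b : a <= b -> B ^ a <= B ^ b by rewrite leq_exp2l.
have w v k : v <= B ^ k -> B ^ k < W -> word W v = Some v.
  by move=> h1 h2; rewrite /word (leq_ltn_trans h1 h2).
have bin (op : nat -> nat -> nat) e1 e2 :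
    (consts_le 2 e1 -> B ^ cost e1 < W ->
       eval W s e1 = Some (den s e1) /\ den s e1 <= B ^ cost e1) ->
    (consts_le 2 e2 -> B ^ cost e2 < W ->
       eval W s e2 = Some (den s e2) /\ den s e2 <= B ^ cost e2) ->
    (forall u v, u <= B ^ cost e1 -> v <= B ^ cost e2 ->
       op u v <= B ^ (cost e1 + cost e2).+1) ->
    consts_le 2 e1 && consts_le 2 e2 -> B ^ (cost e1 + cost e2).+1 < W ->
    (if (eval W s e1, eval W s e2) is (Some v1, Some v2) then word W (op v1 v2) else None)
      = Some (op (den s e1) (den s e2)) /\
    op (den s e1) (den s e2) <= B ^ (cost e1 + cost e2).+1.
  move=> IH1 IH2 hop /andP [c1 c2] lt.
  have [-> l1] : eval W s e1 = Some (den s e1) /\ den s e1 <= B ^ cost e1.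
    by apply: IH1 => //; apply: leq_ltn_trans lt; apply: mono; lia.
  have [-> l2] : eval W s e2 = Some (den s e2) /\ den s e2 <= B ^ cost e2.
    by apply: IH2 => //; apply: leq_ltn_trans lt; apply: mono; lia.
  have h := hop _ _ l1 l2; split=> //; exact: w h lt.
have add_le a b u v : u <= B ^ a -> v <= B ^ b -> u + v <= B ^ (a + b).+1.
  by move=> h1 h2; apply: leq_trans (leq_add h1 h2) (expn_add_le _ _ B2).
have one_le k (b : bool) : b <= B ^ k.+1.
  by apply: (leq_trans (leq_b1 b)); rewrite expn_gt0 B0.
elim: e => [v|a e1 IH|e1 IH1 e2 IH2|e1 IH1 e2 IH2|e1 IH1 e2 IH2|e1 IH1 e2 IH2|e1 IH1 e2 IH2].
- move=> /= hv lt; have h : v <= B ^ 1 by rewrite expn1; lia.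
  by split=> //; apply: w h lt.
- move=> /= hc lt; have [] := IH hc; first by apply: leq_ltn_trans lt; apply: mono.
  move=> -> l; have h : s a (den s e1) <= B ^ (cost e1).+1.
    by apply: (leq_trans (bd _ _)); rewrite -{1}(expn1 B) mono.
  by split=> //; apply: w h lt.
- by apply: (bin addn) => // u v; apply: add_le.
- apply: (bin subn) => // u v h1 h2.
  by apply: leq_trans (add_le _ _ _ _ h1 h2); lia.
- apply: (bin muln) => // u v h1 h2; apply: (leq_trans (leq_mul h1 h2)).
  by rewrite -expnD mono.
- by apply: (bin (fun u v => nat_of_bool (u == v))) => // u v _ _; apply: one_le.
- by apply: (bin (fun u v => nat_of_bool (u < v))) => // u v _ _; apply: one_le.
Qed.

Lemma den_increment B s e : bounded B s -> 2 <= B -> increment e -> den s e <= B.+1.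
Proof.
move=> bd B2; case: e => //=; first by move=> v; lia.
- by move=> a e _; apply: leqW.
- case=> // a e1; case=> // v /=; have := bd a (den s e1); lia.
- by case=> // a e1 e2 _ /=; apply: leqW; apply: leq_trans (leq_subr _ _) (bd _ _).
Qed.

Lemma bounded_leq B B' s : B <= B' -> bounded B s -> bounded B' s.
Proof. by move=> le bd a i; apply: leq_trans (bd a i) le. Qed.

(** After t steps of a tame program the memory is bounded by [B + t], and its expressions by the
    K-th power of this; above that word size both semantics agree. *)
Lemma uexec_exec K W p s t s' : uexec p s t s' -> forall B, tame K p -> bounded B s ->
  2 <= B -> (B + t) ^ K < W -> exec W p s t s' /\ bounded (B + t) s'.
Proof.
have ev B t0 s0 e : small K e -> bounded B s0 -> 2 <= B -> (B + t0) ^ K < W ->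
    eval W s0 e = Some (den s0 e).
  move=> /andP [hc hk] bd B2 lt; have [] // := @eval_den W B s0 e bd B2 hk.
  apply: leq_ltn_trans lt; apply: (@leq_trans (B ^ K)); first by rewrite leq_exp2l.
  by rewrite leq_exp2r ?leq_addr //; apply: leq_trans hc; apply: cost_gt0.
have pw a b : a <= b -> b ^ K < W -> a ^ K < W.
  move=> le; apply: leq_ltn_trans; case: (K) => [|k]; first by rewrite !expn0.
  by rewrite leq_exp2r.
elim=> {p s t s'} [s|s a e1 e2|p1 p2 s1 s2 s3 t1 t2 _ IH1 _ IH2|e p1 p2 s s' t _ IH|e p s E|
    e p s1 s2 s3 t1 t2 nz _ IH1 _ IH2] B.
- by move=> _ bd _ _; split; [constructor | apply: bounded_leq bd; lia].
- move=> /= /and3P [k1 k2 inc] bd B2 lt; split.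
    by constructor; [apply: ev lt | apply: ev lt].
  move=> b j; rewrite /update; case: ifP => _; last by apply: leq_trans (bd b j) _; lia.
  by apply: leq_trans (den_increment bd B2 inc) _; lia.
- move=> /= /andP [h1 h2] bd B2 lt.
  have [] := IH1 B h1 bd B2; first by apply: pw lt; lia.
  move=> ex1 bd1; have [] := IH2 (B + t1) h2 bd1; [by lia | by apply: pw lt; lia|].
  by move=> ex2 bd2; split; [apply: ExecSeq ex1 ex2 | apply: bounded_leq bd2; lia].
- move=> /= /and3P [hs h1 h2] bd B2 lt.
  have [] := IH B _ bd B2; [by case: ifP | by apply: pw lt; lia |].
  move=> ex1 bd1; split; last by apply: bounded_leq bd1; lia.
  by apply: ExecIf ex1; apply: ev lt.
- move=> /= /andP [hs h] bd B2 lt; split; last by apply: bounded_leq bd; lia.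
  by constructor; rewrite (ev B _ s e hs bd B2 lt) E.
- move=> /= /andP [hs h] bd B2 lt.
  have [] := IH1 B h bd B2; first by apply: pw lt; lia.
  move=> ex1 bd1; have [] := IH2 (B + t1); rewrite /= ?hs //; [by lia | by apply: pw lt; lia|].
  move=> ex2 bd2; split; last by apply: bounded_leq bd2; lia.
  by apply: ExecWhileStep nz ex1 ex2; apply: ev lt.
Qed.

(** A Hoare triple for total correctness with a time budget [b]. *)
Definition runs (p : cmd) (s : store) (b : nat) (Q : store -> Prop) : Prop :=
  exists t s', [/\ uexec p s t s', t <= b & Q s'].

Lemma runs_weaken p s b b' (Q Q' : store -> Prop) : runs p s b Q -> b <= b' ->
  (forall s', Q s' -> Q' s') -> runs p s b' Q'.
Proof.
by move=> [t [s' [h1 h2 h3]]] le h; exists t, s'; split; [| exact: leq_trans le | apply: h].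
Qed.

Lemma runs_seq p1 p2 s b1 b2 Q :
  runs p1 s b1 (fun s1 => runs p2 s1 b2 Q) -> runs (Seq p1 p2) s (b1 + b2).+1 Q.
Proof.
move=> [t1 [s1 [h1 l1 [t2 [s2 [h2 l2 q]]]]]]; exists (t1 + t2).+1, s2.
by split=> //; [apply: USeq h1 h2 | lia].
Qed.

Lemma runs_if e p1 p2 s b Q :
  runs (if den s e != 0 then p1 else p2) s b Q -> runs (If e p1 p2) s (cost e + b).+1 Q.
Proof.
by move=> [t [s' [h l q]]]; exists (cost e + t).+1, s'; split=> //; [apply: UIf | lia].
Qed.

(** The amortised form of the loop rule: the budget [b] of an iteration may depend on the state,
    provided that the potential drops by enough to pay for it. *)
Lemma runs_while e p (I : store -> Prop) (phi : store -> nat) s :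
  (forall s1, I s1 -> den s1 e != 0 -> exists2 b,
     runs p s1 b (fun s2 => I s2 /\ (cost e + b + phi s2).+1 <= phi s1) & True) ->
  I s -> runs (While e p) s (phi s + (cost e).+1) (fun s' => I s' /\ den s' e = 0).
Proof.
move=> step; have [n] := ubnP (phi s); elim: n s => // n IH s lt Is.
case: (eqVneq (den s e) 0) => [E|nz].
  by exists (cost e).+1, s; split; [constructor | lia |].
have [b [t1 [s2 [h1 l1 [I2 l2]]]] _] := step s Is nz.
have [|t2 [s3 [h2 l3 q]]] := IH s2 _ I2; first by lia.
by exists (cost e + t1 + t2).+1, s3; split=> //; [apply: UWhileStep h1 h2 | lia].
Qed.

(** The value on loops is a dummy; [sem] describes executions of loop-free programs. *)
Fixpoint sem (p : cmd) (s : store) : store :=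
  match p with
  | Skip => s
  | Write a e1 e2 => update s a (den s e1) (den s e2)
  | Seq p1 p2 => sem p2 (sem p1 s)
  | If e p1 p2 => if den s e != 0 then sem p1 s else sem p2 s
  | While _ _ => s
  end.

Fixpoint loopfree (p : cmd) : bool :=
  match p with
  | Skip | Write _ _ _ => true
  | Seq p1 p2 | If _ p1 p2 => loopfree p1 && loopfree p2
  | While _ _ => false
  end.

(** An upper bound rather than the exact time, since both branches of a test are counted. *)
Fixpoint steps (p : cmd) : nat :=
  match p with
  | Skip => 1
  | Write _ e1 e2 => (cost e1 + cost e2).+1
  | Seq p1 p2 => (steps p1 + steps p2).+1
  | If e p1 p2 => (cost e + (steps p1 + steps p2)).+1
  | While _ _ => 0
  end.

Lemma runs_sem p s (Q : store -> Prop) : loopfree p -> Q (sem p s) -> runs p s (steps p) Q.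
Proof.
elim: p s Q => //=.
- by move=> s Q _ q; exists 1, s; split=> //; constructor.
- by move=> a e1 e2 s Q _ q; do 2 eexists; split; [constructor | | exact: q].
- move=> p1 IH1 p2 IH2 s Q /andP [h1 h2] q; apply: runs_seq.
  by apply: IH1 => //; apply: IH2.
- move=> e p1 IH1 p2 IH2 s Q /andP [h1 h2] q.
  apply: (@runs_weaken _ _ (cost e + (steps p1 + steps p2)).+1 _ Q) => //; apply: runs_if.
  move: q; case: ifP => _ q.
    by apply: runs_weaken (IH1 _ _ h1 q) _ _ => //; lia.
  by apply: runs_weaken (IH2 _ _ h2 q) _ _ => //; lia.
Qed.

Lemma runs_sem_seq p1 p2 s b Q : loopfree p1 ->
  runs p2 (sem p1 s) b Q -> runs (Seq p1 p2) s (steps p1 + b).+1 Q.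
Proof. by move=> l h; apply: runs_seq; apply: runs_sem. Qed.

(** * The program *)

Notation cell a := (Read a (Const 0)).
Notation "a <~ e" := (Write a (Const 0) e) (at level 60, no associativity).
Notation "p ;; q" := (Seq p q) (at level 65, right associativity).
Notation "e +1" := (Add e (Const 1)) (at level 7, format "e +1").
Notation at2 u w v := (Add (Mul u w) v).
Notation nX := (Read 0 (Const 0)).
Notation nY := (Read 0 (Const 1)).
Notation nR := (Read 0 (Const 2)).

(* Memory layout, besides the input and output arrays (x, y are agents):
   12: rank of x in the list of y        13: rank of y in the list of x
   14: current partner of y
   15, 16: ranks, in the list of y, of its final and current partners, both 0
           for the agents y outside rho
   17: next position to examine in the list of x
   18: current partner of x
   20: stack of agents x                 21: 1 + position of x in the stack, or 0
   22-32: local variables *)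

Definition fill_body (list rk : nat) (w : expr) : cmd :=
  Write rk (at2 (cell 22) w (Read list (at2 (cell 22) w (cell 30)))) (cell 30) ;;
  30 <~ (cell 30)+1.

Definition fill_row (len list rk : nat) (w : expr) : cmd :=
  30 <~ Const 0 ;;
  While (Lt (cell 30) (Read len (cell 22))) (fill_body list rk w) ;;
  22 <~ (cell 22)+1.

Definition fill (len list rk : nat) (m w : expr) : cmd :=
  22 <~ Const 0 ;;
  While (Lt (cell 22) m) (fill_row len list rk w).

(** Cell 29 holds the x of the preceding pair, cyclically: it is the partner that the present y has
    after the elimination of [rho]. *)
Definition init_body : cmd :=
  26 <~ Read 6 (cell 22) ;;
  27 <~ Read 7 (cell 22) ;;
  Write 18 (cell 26) (cell 27) ;;
  Write 14 (cell 27) (cell 26) ;;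
  Write 17 (cell 26) (Read 13 (at2 (cell 26) nY (cell 27)))+1 ;;
  Write 16 (cell 27) (Read 12 (at2 (cell 27) nX (cell 26))) ;;
  Write 15 (cell 27) (Read 12 (at2 (cell 27) nX (cell 29))) ;;
  29 <~ cell 26 ;;
  22 <~ (cell 22)+1.

Definition init : cmd :=
  (29 <~ Read 6 (Defs.Sub nR (Const 1)) ;; 22 <~ Const 0) ;;
  While (Lt (cell 22) nR) init_body.

Definition push (v : nat) : cmd :=
  Write 20 (cell 23) (cell v) ;;
  23 <~ (cell 23)+1 ;;
  Write 21 (cell v) (cell 23).

Definition emit_body : cmd :=
  26 <~ Read 20 (cell 25) ;;
  Write 10 (cell 24) (cell 26) ;;
  Write 11 (cell 24) (Read 18 (cell 26)) ;;
  27 <~ Read 2 (at2 (cell 26) nY (Read 17 (cell 26))) ;;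
  Write 18 (cell 26) (cell 27) ;;
  Write 14 (cell 27) (cell 26) ;;
  Write 16 (cell 27) (Read 12 (at2 (cell 27) nX (cell 26))) ;;
  Write 17 (cell 26) (Read 17 (cell 26))+1 ;;
  Write 21 (cell 26) (Const 0) ;;
  24 <~ (cell 24)+1 ;;
  25 <~ (cell 25)+1.

(** Array 21 stores positions plus one, so cell 32 receives the place of the repeated agent, where
    the stack will be cut. *)
Definition emit_head : cmd :=
  32 <~ Defs.Sub (Read 21 (cell 28)) (Const 1) ;;
  25 <~ cell 32 ;;
  Write 9 (cell 8) (Defs.Sub (cell 23) (cell 25)) ;;
  8 <~ (cell 8)+1.

Definition emit : cmd :=
  emit_head ;;
  While (Lt (cell 25) (cell 23)) emit_body ;;
  23 <~ cell 32.

Definition start_step : cmd :=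
  26 <~ Read 6 (cell 22) ;;
  If (Eq (Read 15 (Read 18 (cell 26))) (Read 16 (Read 18 (cell 26))))
     (22 <~ (cell 22)+1)
     (push 26).

Definition load_top : cmd :=
  26 <~ Read 20 (Defs.Sub (cell 23) (Const 1)) ;;
  27 <~ Read 2 (at2 (cell 26) nY (Read 17 (cell 26))) ;;
  31 <~ Read 12 (at2 (cell 27) nX (cell 26)) ;;
  28 <~ Read 14 (cell 27).

(** The test [cond] in arithmetic: negation is subtraction from 1, conjunction a product. *)
Definition top_test : expr :=
  Mul (Defs.Sub (Const 1) (Lt (cell 31) (Read 15 (cell 27))))
      (Lt (cell 31) (Read 16 (cell 27))).

Definition main_body : cmd :=
  If (Eq (cell 23) (Const 0))
     start_step
     (load_top ;;
      If top_test
         (If (Eq (Read 21 (cell 28)) (Const 0)) (push 28) emit)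
         (Write 17 (cell 26) (Read 17 (cell 26))+1)).

Definition fills : cmd := fill 3 4 12 nY nX ;; fill 1 2 13 nX nY.

Definition prog : cmd :=
  fills ;;
  (init ;; 22 <~ Const 0) ;;
  While (Lt (cell 22) nR) main_body.

(** Symbolic execution one write at a time, with address and value replaced by their known meanings
    so that terms stay small. *)
Lemma sem_write a e1 e2 p s i v : den s e1 = i -> den s e2 = v ->
  sem (Write a e1 e2 ;; p) s = sem p (update s a i v).
Proof. by move=> <- <-. Qed.

Lemma sem_write_last a e1 e2 s i v : den s e1 = i -> den s e2 = v ->
  sem (Write a e1 e2) s = update s a i v.
Proof. by move=> <- <-. Qed.

Lemma update_eq s a i v : update s a i v a i = v.
Proof. by rewrite /update !eqxx. Qed.

Lemma update_array s a i v b j : b != a -> update s a i v b j = s b j.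
Proof. by rewrite /update => /negPf ->. Qed.

Lemma update_index s a i v b j : j != i -> update s a i v b j = s b j.
Proof. by rewrite /update => /negPf ->; rewrite andbF. Qed.

Lemma grid_inj w u v u' v' : v < w -> v' < w -> u * w + v = u' * w + v' ->
  u = u' /\ v = v'.
Proof.
move=> l l' E.
have w0 : 0 < w by lia.
have := congr1 (divn^~ w) E; rewrite !divnMDl // !divn_small // !addn0 => Eu.
by split=> //; move: E; rewrite Eu => /addnI.
Qed.

(** * Inversion of the preference lists into rank tables *)

Section Fill.
Variables (len list rk : nat) (m w : expr) (m0 w0 : nat) (L : nat -> seq nat).
Hypothesis fresh0 : 0 \notin [:: rk; 22; 30].
Hypothesis fresh_len : len \notin [:: rk; 22; 30].
Hypothesis fresh_list : list \notin [:: rk; 22; 30].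
Hypothesis fresh_rk : rk \notin [:: 22; 30].
Hypothesis em : m = nX \/ m = nY.
Hypothesis ew : w = nX \/ w = nY.
Variable s0 : store.
Hypothesis hm : den s0 m = m0.
Hypothesis hw : den s0 w = w0.
Hypothesis L_uniq : forall u, u < m0 -> uniq (L u).
Hypothesis L_lt : forall u v, u < m0 -> v \in L u -> v < w0.
Hypothesis L_len : forall u, u < m0 -> s0 len u = size (L u).
Hypothesis L_list : forall u k, u < m0 -> k < size (L u) ->
  s0 list (u * w0 + k) = nth 0 (L u) k.

Definition fill_frame (s : store) :=
  forall a i, a \notin [:: rk; 22; 30] -> s a i = s0 a i.

Definition fill_inv (s : store) := [/\ fill_frame s, s 22 0 <= m0 &
  forall u v, u < s 22 0 -> v \in L u -> s rk (u * w0 + v) = index v (L u)].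

Definition row_inv (u : nat) (s : store) :=
  [/\ fill_inv s, s 22 0 = u, s 30 0 <= size (L u) &
  forall k, k < s 30 0 -> s rk (u * w0 + nth 0 (L u) k) = k].

Lemma fill_w s : fill_frame s -> den s w = w0.
Proof. by move=> fr; rewrite -hw; case: ew => -> /=; rewrite fr. Qed.

Lemma fill_m s : fill_frame s -> den s m = m0.
Proof. by move=> fr; rewrite -hm; case: em => -> /=; rewrite fr. Qed.

Lemma row_size u : u < m0 -> size (L u) <= w0.
Proof.
move=> hu; have := uniq_leq_size (L_uniq hu) (s2 := iota 0 w0).
by rewrite size_iota; apply=> v hv; rewrite mem_iota add0n (L_lt hu).
Qed.

Lemma rk22 : 22 != rk.
Proof. by move: fresh_rk; rewrite !inE negb_or eq_sym => /andP []. Qed.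

Lemma rk30 : 30 != rk.
Proof. by move: fresh_rk; rewrite !inE negb_or (eq_sym rk 30) => /andP []. Qed.

Lemma frame_update s a i v : a \in [:: rk; 22; 30] -> fill_frame s ->
  fill_frame (update s a i v).
Proof.
move=> ha fr b j nb; rewrite update_array ?fr //.
by apply: contraNneq nb => ->.
Qed.

Lemma fill_row_step u s : u < m0 -> row_inv u s -> s 30 0 < size (L u) ->
  row_inv u (sem (fill_body list rk w) s) /\
  sem (fill_body list rk w) s 30 0 = (s 30 0).+1.
Proof.
move=> hu [[fr le hv] E1 le2 hk] lt; set k := s 30 0 in lt hk le2 *.
have nk := mem_nth 0 lt.
rewrite /fill_body (@sem_write _ _ _ _ _ (u * w0 + nth 0 (L u) k) k) //; last first.
  by rewrite /= E1 (fill_w fr) fr // L_list.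
rewrite (@sem_write_last _ _ _ _ 0 k.+1) //; last first.
  by rewrite /= update_array ?rk30 // addn1.
rewrite !update_eq; split=> //; split.
- split.
  + by apply: frame_update; rewrite ?inE ?eqxx ?orbT //;
      apply: frame_update; rewrite ?inE ?eqxx.
  + by rewrite !update_array ?rk22.
  move=> u' v; rewrite [X in _ < X](_ : _ = u) => [lu hv'|]; last by rewrite !update_array ?rk22.
  rewrite update_array ?(eq_sym rk) ?rk30 // update_index; last first.
    apply/eqP => /grid_inj [||E _]; [|exact: L_lt nk|by lia].
    by apply: L_lt hv'; apply: leq_trans hu; apply: ltnW.
  by apply: hv; rewrite ?E1.
- by rewrite !update_array ?rk22.
- by rewrite update_eq.
move=> k'; rewrite update_eq ltnS => lk'.
rewrite update_array ?(eq_sym rk) ?rk30 //.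
case: (eqVneq k' k) => [->|ne]; first by rewrite update_eq.
have lt' : k' < k by lia.
rewrite update_index ?hk //; apply/eqP => /grid_inj [||_ /eqP].
- by apply: (@L_lt u) => //; apply: mem_nth; apply: ltn_trans lt.
- exact: L_lt nk.
by rewrite nth_uniq ?L_uniq ?(negPf ne) //; apply: ltn_trans lt.
Qed.

Lemma fill_row_spec s : fill_inv s -> s 22 0 < m0 ->
  runs (fill_row len list rk w) s (100 * w0 + 100)
    (fun s' => fill_inv s' /\ s' 22 0 = (s 22 0).+1).
Proof.
move=> [fr le hv] lt; set u := s 22 0 in lt hv le *.
have cw : cost w = 2 by case: ew => ->.
apply: (@runs_weaken _ _ _ _ (fun s' => fill_inv s' /\ s' 22 0 = u.+1)).
- apply: runs_sem_seq => //; apply: runs_seq.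
  apply: (runs_weaken (b' := 100 * size (L u) + 10)).
  + apply: (@runs_while _ _ (row_inv u) (fun s => 100 * (size (L u) - s 30 0))).
      move=> s1 rI; have [[fr1 _ _] E1 _ _] := rI.
      rewrite /= E1 (fr1 len) // L_len // eqb0 negbK => lt1.
      exists (steps (fill_body list rk w)) => //; apply: runs_sem => //.
      have [I2 E2] := fill_row_step lt rI lt1; split=> //; rewrite E2 /= cw; lia.
    rewrite (@sem_write_last _ _ _ _ 0 0) //; split.
    * split; first by apply: frame_update; rewrite ?inE ?eqxx ?orbT.
        by rewrite update_array.
      move=> u' v; rewrite !update_array ?(eq_sym rk) ?rk30 //; exact: hv.
    * by rewrite update_array.
    * by rewrite update_eq.
    * by rewrite update_eq.
  + by rewrite /= update_eq /=; lia.
  move=> s2 [[[fr2 le2 hv2] E2 le3 hk2]]; rewrite /= E2 (fr2 len) // L_len // => /eqP.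
  rewrite eqb0 -leqNgt => ge.
  apply: runs_sem => //; rewrite (@sem_write_last _ _ _ _ 0 u.+1) //; last first.
    by rewrite /= E2 addn1.
  split; last by rewrite update_eq.
  split; first by apply: frame_update; rewrite ?inE ?eqxx ?orbT.
    by rewrite update_eq.
  move=> u' v; rewrite update_eq ltnS update_array ?(eq_sym rk) ?rk22 // => lu hv'.
  case: (eqVneq u' u) => [Eu|ne]; last by apply: hv2; rewrite // E2; lia.
  rewrite Eu in hv' *; rewrite -{1}(nth_index 0 hv') hk2 //.
  by apply: leq_trans ge; rewrite index_mem.
- by rewrite /=; have := row_size lt; lia.
by [].
Qed.

Lemma fill_spec : runs (fill len list rk m w) s0 ((100 * w0 + 120) * m0 + 20)
  (fun s => fill_frame s /\ forall u v, u < m0 -> v \in L u -> s rk (u * w0 + v) = index v (L u)).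
Proof.
have cm : cost m = 2 by case: em => ->.
apply: runs_weaken.
- apply: runs_sem_seq => //.
  apply: (@runs_while _ _ fill_inv (fun s => (100 * w0 + 120) * (m0 - s 22 0))).
    move=> s1 I1; have [fr1 le1 _] := I1; rewrite /= (fill_m fr1) eqb0 negbK => lt1.
    eexists; last by []; apply: runs_weaken (fill_row_spec I1 lt1) (leqnn _) _.
    move=> s2 [I2 E2]; split=> //; rewrite E2 cm.
    have -> : m0 - s1 22 0 = (m0 - (s1 22 0).+1).+1 by lia.
    by rewrite [X in _ <= X]mulnS; lia.
  rewrite (@sem_write_last _ _ _ _ 0 0) //; split.
  + by apply: frame_update; rewrite ?inE ?eqxx ?orbT.
  + by rewrite update_eq.
  + by rewrite update_eq.
- by rewrite /= cm update_eq subn0; lia.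
move=> s2 [[fr2 le2 hv2]]; rewrite /= (fill_m fr2) => /eqP.
rewrite eqb0 -leqNgt => ge; split=> // u v hu; apply: hv2; exact: leq_trans ge.
Qed.

End Fill.

(** * The loop that copies a cycle to the output and rematches its agents *)

Section EmitLoop.
Variables (p q : nat) (c : seq 'I_p) (m sg : 'I_p -> 'I_q) (r : 'I_p -> nat).
Variables (s0 : store) (b o : nat).
Hypothesis uc : uniq c.
Hypothesis sg_inj : {in c &, injective sg}.
Hypothesis hp : s0 0 0 = p.
Hypothesis hq : s0 0 1 = q.
Hypothesis hstk : forall x, x \in c -> s0 20 (b + index x c) = x.
Hypothesis hcur : forall x, x \in c -> s0 18 x = m x.
Hypothesis hsg : forall x, x \in c -> s0 2 (x * q + s0 17 x) = sg x.
Hypothesis hrk : forall x, x \in c -> s0 12 (sg x * p + x) = r x.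
Hypothesis hsp : s0 23 0 = b + size c.

Definition emit_arrays := [:: 10; 11; 14; 16; 17; 18; 21; 24; 25; 26; 27].

(** In the output fields the old content of the cell serves as default of [nth], so one equation
    covers the cells written and those beyond them. *)
Record emitted (c1 : seq 'I_p) (s : store) : Prop := Emitted {
  em_frame : forall a i, a \notin emit_arrays -> s a i = s0 a i;
  em_j : s 25 0 = b + size c1;
  em_o : s 24 0 = o + size c1;
  em_outx : forall k, s 10 k = if o <= k then nth (s0 10 k) (map val c1) (k - o) else s0 10 k;
  em_outy : forall k, s 11 k =
    if o <= k then nth (s0 11 k) (map (fun x => val (m x)) c1) (k - o) else s0 11 k;
  em_my_in : forall x, x \in c1 -> s 14 (sg x) = x;
  em_my_out : forall y : 'I_q, y \notin map sg c1 -> s 14 y = s0 14 y;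
  em_hi_in : forall x, x \in c1 -> s 16 (sg x) = r x;
  em_hi_out : forall y : 'I_q, y \notin map sg c1 -> s 16 y = s0 16 y;
  em_ptr : forall x : 'I_p, s 17 x = s0 17 x + (x \in c1);
  em_cur : forall x : 'I_p, s 18 x = if x \in c1 then sg x : nat else s0 18 x;
  em_pos : forall x : 'I_p, s 21 x = if x \in c1 then 0 else s0 21 x }.

Lemma emit_body_step c1 x c2 s : c = c1 ++ x :: c2 -> emitted c1 s ->
  emitted (rcons c1 x) (sem emit_body s).
Proof.
move=> Ec [fr ej eo ex ey m1 m2 h1 h2 ep ec epos].
have hx : x \in c by rewrite Ec mem_cat mem_head orbT.
have nx : x \notin c1.
  by move: uc; rewrite Ec cat_uniq => /and3P [_ /norP [] ].
have sub z : z \in c1 -> z \in c by rewrite Ec mem_cat => ->.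
have Ei : index x c = size c1 by rewrite Ec index_cat (negPf nx) /= eqxx addn0.
(* The new partners are distinct, so the cells written for x do not overwrite those of the agents
   already treated. *)
have ns : sg x \notin map sg c1.
  by apply/mapP=> -[z hz E]; move: nx; rewrite (sg_inj hx (sub _ hz) E) hz.
have ptr0 : s 17 x = s0 17 x by rewrite ep (negPf nx) addn0.
rewrite /emit_body.
rewrite (@sem_write _ _ _ _ _ 0 x) //; last first.
  by rewrite /= ej fr // -Ei hstk.
rewrite (@sem_write _ _ _ _ _ (o + size c1) x) //.
rewrite (@sem_write _ _ _ _ _ (o + size c1) (m x)) //; last first.
  by rewrite /= /update /= ec (negPf nx) hcur.
rewrite (@sem_write _ _ _ _ _ 0 (sg x)) //; last first.
  by rewrite /= /update /= ptr0 !fr // hq hsg.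
rewrite (@sem_write _ _ _ _ _ x (sg x)) //.
rewrite (@sem_write _ _ _ _ _ (sg x) x) //.
rewrite (@sem_write _ _ _ _ _ (sg x) (r x)) //; last first.
  by rewrite /= /update /= !fr // hp hrk.
rewrite (@sem_write _ _ _ _ _ x (s0 17 x).+1) //; last first.
  by rewrite /= /update /= ptr0 addn1.
rewrite (@sem_write _ _ _ _ _ x 0) //.
rewrite (@sem_write _ _ _ _ _ 0 (o + size c1).+1) //; last first.
  by rewrite /= /update /= eo addn1.
rewrite (@sem_write_last _ _ _ _ 0 (b + size c1).+1) //; last first.
  by rewrite /= /update /= ej addn1.
split; rewrite ?size_rcons ?addnS //.
- move=> a i na; rewrite !update_array ?fr //;
    by apply: contraNneq na => ->.
- move=> k; rewrite /update /= ex; case: eqVneq => [->|ne].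
    by rewrite leq_addr addKn map_rcons nth_rcons size_map ltnn eqxx.
  case: leqP => // le; rewrite map_rcons nth_rcons size_map.
  case: ltnP => // l1; case: eqVneq => [E|_]; first by lia.
  by rewrite nth_default ?size_map.
- move=> k; rewrite /update /= ey; case: eqVneq => [->|ne].
    by rewrite leq_addr addKn map_rcons nth_rcons size_map ltnn eqxx.
  case: leqP => // le; rewrite map_rcons nth_rcons size_map.
  case: ltnP => // l1; case: eqVneq => [E|_]; first by lia.
  by rewrite nth_default ?size_map.
- move=> z; rewrite mem_rcons inE => /orP [/eqP ->|hz]; first by rewrite /update /= eqxx.
  rewrite /update /= ifN ?m1 //; apply: contraNneq ns => E.
  by apply/mapP; exists z => //; apply/val_inj.
- move=> y; rewrite map_rcons mem_rcons inE negb_or => /andP [n1 n2].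
  by rewrite /update /= ifN ?m2.
- move=> z; rewrite mem_rcons inE => /orP [/eqP ->|hz]; first by rewrite /update /= eqxx.
  rewrite /update /= ifN ?h1 //; apply: contraNneq ns => E.
  by apply/mapP; exists z => //; apply/val_inj.
- move=> y; rewrite map_rcons mem_rcons inE negb_or => /andP [n1 n2].
  by rewrite /update /= ifN ?h2.
- move=> z; rewrite mem_rcons inE /update /= -[val z == x]/(z == x).
  by case: eqVneq => [->|_]; rewrite ?ep ?addn1.
- move=> z; rewrite mem_rcons inE /update /= -[val z == x]/(z == x).
  by case: eqVneq => [->|_] /=; rewrite ?ec.
- move=> z; rewrite mem_rcons inE /update /= -[val z == x]/(z == x).
  by case: eqVneq => [//|_]; rewrite epos.
Qed.

Lemma emit_loop_spec : s0 25 0 = b -> s0 24 0 = o ->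
  runs (While (Lt (cell 25) (cell 23)) emit_body) s0 (200 * size c + 10) (emitted c).
Proof.
move=> hj ho.
pose Inv (s : store) := exists c1 c2, c = c1 ++ c2 /\ emitted c1 s.
apply: (@runs_weaken _ _ _ _ (fun s => Inv s /\ den s (Lt (cell 25) (cell 23)) = 0)).
- apply: (@runs_while _ _ Inv (fun s => 200 * (b + size c - s 25 0))).
    move=> s1 [c1 [c2 [Ec em]]].
    rewrite /= (em_j em) (em_frame em) // hsp eqb0 negbK ltn_add2l => lt.
    exists (steps emit_body) => //; apply: runs_sem => //.
    case: c2 Ec lt => [|x c2] Ec lt; first by rewrite Ec cats0 ltnn in lt.
    have em2 := emit_body_step Ec em; split.
      by exists (rcons c1 x), c2; rewrite cat_rcons.
    by rewrite (em_j em2) size_rcons /=; lia.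
  exists [::], c; split=> //; split=> //=; rewrite ?addn0 //.
  - by move=> k; rewrite nth_nil if_same.
  - by move=> k; rewrite nth_nil if_same.
  - by move=> x; rewrite addn0.
- by rewrite /= hj addKn; lia.
move=> s [[c1 [c2 [Ec em]]]] /eqP.
rewrite /= (em_j em) (em_frame em) // hsp eqb0 ltn_add2l -leqNgt Ec size_cat => le.
have E2 : c2 = [::] by case: c2 {Ec} le => //= a l; lia.
by rewrite E2 cats0 in Ec *.
Qed.

End EmitLoop.

Lemma mkseq_cat (A : Type) (f f' : nat -> A) n (l l' : seq A) :
  mkseq f n = l -> (forall k, k < n -> f' k = f k) ->
  (forall k a, k < size l' -> f' (n + k) = nth a l' k) -> mkseq f' (n + size l') = l ++ l'.
Proof.
move=> <- h1 h2; rewrite /mkseq iotaD map_cat add0n; congr cat.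
  by apply/eq_in_map => k; rewrite mem_iota => /h1.
case: l' h2 => [//|a l'] h2; apply: (@eq_from_nth _ a); rewrite size_map size_iota // => k lt.
by rewrite (nth_map 0) ?size_iota // nth_iota // (h2 k a).
Qed.

(** * The memory as a representation of the walk *)

Section MainLoop.
Variables (p q : nat) (T : instance 'I_p 'I_q).
Variables (U M : {set 'I_p * 'I_q}) (rho : seq ('I_p * 'I_q)).
Hypothesis sU : U \subset edges T.
Hypothesis ex : exposed T U M rho.
Implicit Types (P : {set 'I_p * 'I_q}) (R : seq (seq ('I_p * 'I_q))).
Implicit Types (x z : 'I_p) (y : 'I_q) (e : 'I_p * 'I_q) (stk : seq 'I_p) (s : store).

Local Notation posX := (posX T).
Local Notation posY := (posY T).
Local Notation rankX := (rankX T).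
Local Notation rankY := (rankY T).
Local Notation N := (elim M rho).
Local Notation walk_inv := (walk_inv T U M rho).
Local Notation cond := (cond T M rho).
Local Notation link := (link T M rho).

Record static s : Prop := Static {
  st_p : s 0 0 = p;
  st_q : s 0 1 = q;
  st_r : s 0 2 = size rho;
  st_list : forall x y, y \in prefX T x -> s 2 (x * q + posX x y) = y;
  st_rank : forall x y, x \in prefY T y -> s 12 (y * p + x) = posY y x;
  st_rho : forall k e, k < size rho -> s 6 k = (nth e rho k).1 }.

Lemma static_frame s s' : (forall a i, a \in [:: 0; 2; 6; 12] -> s' a i = s a i) ->
  static s -> static s'.
Proof.
move=> fr [h1 h2 h3 h4 h5 h6]; split; try by rewrite fr.
- by move=> x y hy; rewrite fr // h4.
- by move=> x y hy; rewrite fr // h5.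
- by move=> k e hk; rewrite fr // (h6 k e).
Qed.

Lemma static_update s a j v : a \notin [:: 0; 2; 6; 12] -> static s -> static (update s a j v).
Proof.
by move=> na; apply: static_frame => b k hb; rewrite update_array //; apply: contraNneq na => <-.
Qed.

(** Partners are recorded for the agents of [rho] only, as no others move between M and N. *)
Record rep s P R stk (i : nat) : Prop := Rep {
  rep_my : forall x y, (x, y) \in P -> y \in map snd rho -> s 14 y = x;
  rep_lo : forall y, s 15 y = if y \in map snd rho then rankY N y else 0;
  rep_hi : forall y, s 16 y = if y \in map snd rho then rankY P y else 0;
  rep_cur : forall x y, (x, y) \in P -> x \in map fst rho -> s 18 x = y;
  rep_stk : forall x, x \in stk -> s 20 (index x stk) = x;
  rep_pos : forall x, s 21 x = if x \in stk then (index x stk).+1 else 0;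
  rep_i : s 22 0 = i;
  rep_sp : s 23 0 = size stk;
  rep_o : s 24 0 = size (flatten R);
  rep_out : outputs s R }.

Definition ptr s : 'I_p -> nat := fun x => s 17 x.

Definition unscanned s := \sum_(x : 'I_p) (q.+1 - s 17 x).

(** A push gains one unit, a skipped list entry two. Popping a cycle advances one pointer per agent,
    worth two units each, and loses one unit each on the stack; the unit left over pays for the
    copying. The factor 1000 dominates the cost of the straight-line code in an iteration. *)
Definition phi s := 1000 * (2 * unscanned s + (size rho - s 22 0) + (p - s 23 0)).

Definition main_inv s := static s /\ exists P R stk i,
  [/\ rep s P R stk i, walk_inv P R stk (ptr s) i & i <= size rho].

Lemma unscanned_update s s' (c : seq 'I_p) : uniq c -> (forall x, x \in c -> s 17 x <= q) ->
  (forall x, s' 17 x = s 17 x + (x \in c)) -> unscanned s = unscanned s' + size c.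
Proof.
move=> uc le h; rewrite -(card_uniqP uc) -sum1_card [X in _ + X]big_mkcond -big_split /=.
apply: eq_bigr => x _; rewrite h; case: ifP => hx; last by rewrite !addn0.
by have := le x hx; lia.
Qed.

Lemma stk_size stk : uniq stk -> size stk <= p.
Proof. by move=> u; have := max_card (mem stk); rewrite (card_uniqP u) card_ord. Qed.

Section Step.
Variables (s : store) (P : {set 'I_p * 'I_q}) (R : seq (seq ('I_p * 'I_q))).
Variables (stk : seq 'I_p) (i : nat).
Hypothesis st : static s.
Hypothesis rp : rep s P R stk i.
Hypothesis I : walk_inv P R stk (ptr s) i.
Hypothesis li : i < size rho.

Lemma push_step v z : s v 0 = z -> v \in [:: 26; 28] -> z \notin stk ->
  walk_inv P R (rcons stk z) (ptr s) i ->
  main_inv (sem (push v) s) /\ phi s = phi (sem (push v) s) + 1000.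
Proof.
move=> hv vin nz I'; case: (rp) => m1 m2 m3 m4 m5 m6 m7 m8 m9 m10.
have nv : v != 20 /\ v != 23.
  by move: vin; rewrite !inE => /orP [] /eqP ->.
rewrite /push (@sem_write _ _ _ _ _ (size stk) z) //.
rewrite (@sem_write _ _ _ _ _ 0 (size stk).+1) //; last first.
  by rewrite /= /update /= m8 addn1.
rewrite (@sem_write_last _ _ _ _ z (size stk).+1) //; last first.
  by move: hv vin; rewrite !inE => hv /orP [] /eqP Ev; rewrite Ev /= /update /= -?Ev.
set s' := update _ _ _ _.
have fr a j : a \notin [:: 20; 21; 23] -> s' a j = s a j.
  move=> na; rewrite /s' !update_array //; by apply: contraNneq na => ->.
have E23 : s' 23 0 = (size stk).+1 by [].
split; last first.
  rewrite /phi /unscanned E23 fr // m8; have := stk_size (inv_uniq I'); rewrite size_rcons => le.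
  rewrite (eq_bigr (fun x : 'I_p => q.+1 - s' 17 x)) => [|x _]; last by rewrite fr.
  by lia.
split; first by apply: static_frame st => a j ha; apply: fr; move: ha; rewrite !inE; lia.
exists P, R, (rcons stk z), i; split=> //; last exact: ltnW.
split; try (by move=> *; rewrite fr //; auto).
- move=> x; rewrite mem_rcons inE => /orP [/eqP ->|hx].
    by rewrite -cats1 index_cat (negPf nz) /= eqxx addn0 /s' /update /= eqxx.
  rewrite -cats1 index_cat hx /s' /update /= ifN ?m5 //.
  by apply: contraTneq hx => E; rewrite -index_mem E ltnn.
- move=> x; rewrite mem_rcons inE -cats1 index_cat /s' /update /= -[val x == z]/(x == z) m6.
  by case: eqVneq => [->|_] /=; rewrite ?(negPf nz) /= ?eqxx ?addn0 //; case: ifP.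
- by rewrite size_rcons.
Qed.

Lemma skip_step (s1 : seq 'I_p) x y : stk = rcons s1 x -> s 26 0 = x -> y \in prefX T x ->
  posX x y = s 17 x -> ~~ cond P x y ->
  let s' := sem (Write 17 (cell 26) (Read 17 (cell 26))+1) s in
  main_inv s' /\ phi s = phi s' + 2000.
Proof.
move=> Es hx hy Ei nc; case: (rp) => m1 m2 m3 m4 m5 m6 m7 m8 m9 m10.
rewrite /= hx addn1; set s' := update _ _ _ _.
have hs : x \in stk by rewrite Es mem_rcons mem_head.
have h17 z : s' 17 z = s 17 z + (z \in [:: x]).
  rewrite /s' /update /= inE -[val z == x]/(z == x).
  by case: eqVneq => [->|_]; rewrite ?addn1 ?addn0.
split; last first.
  rewrite /phi (unscanned_update (s' := s') (c := [:: x])) //; first by rewrite -[s' 22 0]/(s 22 0) -[s' 23 0]/(s 23 0) /=; lia.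
  move=> z; rewrite inE => /eqP ->; have [/andP [_ l1] l2] := inv_ptr_le sU ex I hs.
  have := uniq_leq_size (prefX_uniq T x) (s2 := enum 'I_q); rewrite size_enum_ord.
  move=> l3; apply: leq_trans l1 _; apply: ltnW; apply: leq_trans l2 (l3 _) => w _.
  by rewrite mem_enum.
split; first exact: static_update st.
exists P, R, stk, i; split; [by [] | | exact: ltnW].
have I0 := I; rewrite Es in I0 *; apply: (invariant_skip sU I0 hy Ei nc).
  by rewrite /ptr h17 mem_head addn1.
by move=> z ne; rewrite /ptr h17 inE (negPf ne) addn0.
Qed.

Lemma next_step : stk = [::] -> (exists e, e = nth e rho i /\ rankX P e.1 = rankX N e.1) ->
  let s' := sem (22 <~ (cell 22)+1) s in
  main_inv s' /\ phi s = phi s' + 1000.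
Proof.
move=> Es [e [He Er]]; case: (rp) => m1 m2 m3 m4 m5 m6 m7 m8 m9 m10.
rewrite /= m7 addn1; set s' := update _ _ _ _; split.
  split; first exact: static_update st.
  exists P, R, stk, i.+1; split; [by [] | | by []].
  by have I0 := I; rewrite Es in I0 *; apply: (invariant_next ex I0 li He Er).
have -> : phi s' = 1000 * (2 * unscanned s + (size rho - i.+1) + (p - s 23 0)) by [].
by rewrite /phi m7; lia.
Qed.

Lemma emit_step (s1 : seq 'I_p) z c' : let c := z :: c' in stk = s1 ++ c -> s 28 0 = z ->
  link P (ptr s) (last z c') z ->
  runs emit s (200 * size c + 100)
    (fun s' => main_inv s' /\ phi s = phi s' + 1000 * size c).
Proof.
move=> c Es hz lk; case: (rp) => m1 m2 m3 m4 m5 m6 m7 m8 m9 m10.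
have [e0 he0] := exposed_ne ex; pose y0 := e0.2.
(* On the cycle these are the partner in P and the list entry under the pointer; the default [y0]
   occurs only elsewhere. *)
pose m x := odflt y0 (mateX P x); pose sg x := nth y0 (prefX T x) (s 17 x).
have mP := stable_match (inv_stable sU ex I).
have us := inv_uniq I; rewrite Es in us.
have uc : uniq c by move: us; rewrite cat_uniq => /and3P [].
have disj x : x \in c -> x \notin s1.
  by move=> hx; move: us; rewrite cat_uniq => /and3P [_ /hasPn/(_ x hx)].
have cs x : x \in c -> x \in stk by rewrite Es mem_cat orbC => ->.
have cr x : x \in c -> x \in map fst rho.
  by move=> /cs /(inv_stk_rho sU ex I) [e he <-]; apply: map_f.
have m_mate x : x \in c -> (x, m x) \in P.
  move=> /cs /(inv_stk_rho sU ex I) [e he <-]; have [y hy] := inv_mate sU ex I he.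
  by rewrite /m (mateX_in mP hy).
have s_ptr x : x \in c -> sg x \in prefX T x /\ posX x (sg x) = ptr s x.
  move=> /cs hx; have [y [hy Ey _]] := inv_candidate sU ex I hx.
  by rewrite /sg -[s 17 x]/(ptr s x) -Ey nth_index.
have I0 := I; rewrite Es in I0.
have cl : if c is w :: c'' then link P (ptr s) (last w c'') w else False by [].
have nxP x := emit_next I0 cl s_ptr (x := x).
have sg_inj : {in c &, injective sg}.
  move=> x x' hx hx' E; have [h1 _] := nxP x hx; have [h2 _] := nxP x' hx'.
  rewrite E in h1; have := mP.2 _ _ _ h1 h2.
  by move/(congr1 (prev c)); rewrite !prev_next.
have nz : z \notin s1 by apply: disj; apply: mem_head.
have iz : index z stk = size s1 by rewrite Es index_cat (negPf nz) /= eqxx addn0.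
pose b := size s1.
have szs : size stk = b + size c by rewrite Es size_cat.
(* The memory after [emit_head]: the stack is to be cut at height [b], and the new rotation has
   length [size c]. *)
pose t0 := update (update (update (update s 32 0 b) 25 0 b) 9 (size R) (size c)) 8 0 (size R).+1.
have E8 : s 8 0 = size R by case: m10.
have Et : sem emit_head s = t0.
  rewrite /emit_head (@sem_write _ _ _ _ _ 0 b) //; last first.
    by rewrite /= hz m6 cs ?mem_head // iz subn1.
  rewrite (@sem_write _ _ _ _ _ 0 b) //.
  rewrite (@sem_write _ _ _ _ _ (size R) (size c)) //; last first.
    by rewrite /= /update /= m8 szs addKn.
  by rewrite (@sem_write_last _ _ _ _ 0 (size R).+1) // /= /update /= E8 addn1.
pose sigma := [seq (x, m x) | x <- c].
have P'e := emit_exposed sU ex I0 cl m_mate s_ptr.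
have m' : is_matching (elim P sigma) by apply: elim_matching P'e.1.
have P'in := emit_mateX sU ex I0 cl m_mate s_ptr.
have hrk x : x \in c -> s 12 (sg x * p + x) = posY (sg x) x.
  by move=> hx; rewrite (st_rank st) // -accept_sym; case: (s_ptr x hx).
apply: (@runs_weaken _ _ ((steps emit_head + (200 * size c + 10 + 10).+1).+1) _
  (fun s' => main_inv s' /\ phi s = phi s' + 1000 * size c)); last by [].
  apply: runs_sem_seq => //; rewrite Et; apply: runs_seq.
  apply: runs_weaken (emit_loop_spec (p := p) (q := q) (c := c) (m := m) (sg := sg)
    (r := fun x => posY (sg x) x) (s0 := t0) (b := b) (o := size (flatten R)) uc sg_inj
    _ _ _ _ _ _ _ _ _) (leqnn _) _ => //.
  - exact: st_p st.
  - exact: st_q st.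
  - move=> x hx; rewrite -[t0 20 _]/(s 20 (b + index x c)) -(m5 x (cs x hx)).
    by rewrite Es index_cat (negPf (disj x hx)).
  - by move=> x hx; apply: m4 (m_mate x hx) (cr x hx).
  - move=> x hx; rewrite -[t0 2 _]/(s 2 (x * q + ptr s x)); have [h1 <-] := s_ptr x hx.
    exact (st_list st h1).
  - by rewrite -[RHS]szs -m8.
  move=> s2 [fr ej eo ex2 ey2 my1 my2 h1 h2 ep ec epos].
  apply: (@runs_weaken _ _ (steps (23 <~ cell 32)) _ (fun s' => main_inv s' /\ phi s = phi s' + 1000 * size c)); [|by []|by []].
  apply: runs_sem => //; rewrite (@sem_write_last _ _ _ _ 0 b) //; last by rewrite /= fr.
  set s' := update _ _ _ _.
  have sz1 : size s1 <= p by apply: stk_size; move: us; rewrite cat_uniq => /andP [].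
  split; last first.
    rewrite /phi (unscanned_update (s' := s') (c := c)) //.
    + rewrite -[s' 22 0]/(s2 22 0) -[s' 23 0]/b fr // -[t0 22 0]/(s 22 0) m8 szs.
      by have := stk_size (inv_uniq I); rewrite szs; lia.
    + move=> x hx; have [/andP [_ l1] l2] := inv_ptr_le sU ex I (cs x hx).
      have l3 := uniq_leq_size (prefX_uniq T x) (s2 := enum 'I_q); rewrite size_enum_ord in l3.
      apply: leq_trans l1 _; apply: ltnW; apply: leq_trans l2 (l3 _) => w _.
      by rewrite mem_enum.
  split.
    apply: static_frame st => a j ha; rewrite /s' update_array; last by move: ha; rewrite !inE; lia.
    rewrite fr; last by move: ha; rewrite !inE; lia.
    by rewrite /t0 !update_array //; move: ha; rewrite !inE; lia.
  exists (elim P sigma), (rcons R sigma), s1, i; split; last exact: ltnW.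
  2: { apply: (invariant_emit sU ex I0 cl m_mate s_ptr) => x.
       by rewrite /ptr -[s' 17 x]/(s2 17 x) ep. }
  split.
  - move=> x y hP' hy; rewrite -[s' 14 y]/(s2 14 y).
    case: (boolP (y \in map sg c)) => [/mapP [x' hx' Ey]|n].
      by rewrite Ey my1 //; congr val; rewrite Ey in hP'; apply: m'.2 (P'in _ hx') hP'.
    rewrite my2 // -[t0 14 y]/(s 14 y); apply: m1 hy.
    have nx : x \notin c.
      by apply: contra n => hx; rewrite (m'.1 _ _ _ hP' (P'in _ hx)) map_f.
    move: hP'; rewrite /elim in_setU in_setD => /orP [/andP [] //|/mem_moved [e he [Ex _]]].
    by move: nx; rewrite Ex; case/mapP: he => w hw ->; rewrite hw.
  - by move=> y; rewrite -[s' 15 y]/(s2 15 y) fr // -m2.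
  - move=> y; rewrite -[s' 16 y]/(s2 16 y).
    case: (boolP (y \in map sg c)) => [/mapP [x hx ->]|n].
      have [_ /(cond_snd sU ex I0) ->] := nxP x hx.
      by rewrite h1 // (emit_rankY_in sU ex I0 cl m_mate s_ptr).
    by rewrite h2 // (emit_rankY_out sU ex I0 cl m_mate s_ptr) // -m3.
  - move=> x y hP' hx; rewrite -[s' 18 x]/(s2 18 x) ec; case: ifP => hxc.
      by congr val; apply: m'.1 (P'in _ hxc) hP'.
    rewrite -[t0 18 x]/(s 18 x); apply: m4 hx.
    move: hP'; rewrite /elim in_setU in_setD => /orP [/andP [] //|/mem_moved [e he [Ex _]]].
    by move: hxc; rewrite Ex; case/mapP: he => w hw ->; rewrite hw.
  - move=> x hx; rewrite -[s' 20 _]/(s2 20 (index x s1)) fr // -[t0 20 _]/(s 20 (index x s1)).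
    by have := m5 x; rewrite Es mem_cat index_cat hx; apply.
  - move=> x; rewrite -[s' 21 _]/(s2 21 x) epos -[t0 21 x]/(s 21 x) m6 Es mem_cat index_cat.
    case: ifP => [hx|hx]; first by rewrite (negPf (disj x hx)).
    by rewrite hx orbF; case: (x \in s1).
  - by rewrite -[s' 22 0]/(s2 22 0) fr // -m7.
  - by [].
  - by rewrite -[s' 24 0]/(s2 24 0) eo flatten_rcons size_cat size_map.
  have [_ o9 o10 o11] := m10; split.
  - by rewrite -[s' 8 0]/(s2 8 0) fr // size_rcons.
  - have -> : size (rcons R sigma) = size R + size [:: size sigma] by rewrite size_rcons addn1.
    rewrite -cats1 map_cat; apply: (mkseq_cat o9).
      move=> k lt; rewrite -[s' 9 k]/(s2 9 k) fr // /t0 /update /= ifN //.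
      by rewrite neq_ltn lt.
    by case=> // a _; rewrite addn0 -[s' 9 _]/(s2 9 (size R)) fr // /t0 /update /= eqxx size_map.
  - rewrite flatten_rcons size_cat map_cat -(size_map (fun e => val e.1) sigma).
    apply: (mkseq_cat o10).
      by move=> k lt; rewrite -[s' 10 k]/(s2 10 k) ex2 leqNgt lt.
    move=> k a; rewrite size_map => lt; rewrite -[s' 10 _]/(s2 10 (size (flatten R) + k)) ex2.
    rewrite leq_addr addKn -map_comp; apply: set_nth_default.
    by rewrite size_map; rewrite size_map in lt.
  - rewrite flatten_rcons size_cat map_cat -(size_map (fun e => val e.2) sigma).
    apply: (mkseq_cat o11).
      by move=> k lt; rewrite -[s' 11 k]/(s2 11 k) ey2 leqNgt lt.
    move=> k a; rewrite size_map => lt; rewrite -[s' 11 _]/(s2 11 (size (flatten R) + k)) ey2.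
    rewrite leq_addr addKn -map_comp; apply: set_nth_default.
    by rewrite size_map; rewrite size_map in lt.
by rewrite /=; lia.
Qed.
End Step.
End MainLoop.

(** * One iteration of the main loop, and the loop as a whole *)

Section MainStep.
Variables (p q : nat) (T : instance 'I_p 'I_q).
Variables (U M : {set 'I_p * 'I_q}) (rho : seq ('I_p * 'I_q)).
Hypothesis sU : U \subset edges T.
Hypothesis ex : exposed T U M rho.

Local Notation posX := (posX T).
Local Notation posY := (posY T).
Local Notation rankX := (rankX T).
Local Notation rankY := (rankY T).
Local Notation N := (elim M rho).
Local Notation walk_inv := (walk_inv T U M rho).
Local Notation cond := (cond T M rho).
Local Notation static := (static T rho).
Local Notation rep := (rep T M rho).
Local Notation main_inv := (main_inv T U M rho).
Local Notation phi := (phi rho).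

Section Step.
Variables (s : store) (P : {set 'I_p * 'I_q}) (R : seq (seq ('I_p * 'I_q))).
Variables (stk : seq 'I_p) (i : nat).
Hypothesis st : static s.
Hypothesis rp : rep s P R stk i.
Hypothesis I : walk_inv P R stk (ptr s) i.
Hypothesis li : i < size rho.

Lemma start_step_spec : stk = [::] ->
  runs start_step s 100 (fun s' => main_inv s' /\ phi s = phi s' + 1000).
Proof.
move=> Es; have [e0 he0] := exposed_ne ex.
pose e := nth e0 rho i; have he : e \in rho by apply: mem_nth.
have Ee : e = nth e rho i by apply: set_nth_default.
have [y hy] := inv_mate sU ex I he.
have hf : e.1 \in map fst rho by apply: map_f.
have hs := inv_mate_snd sU ex I hy hf.
pose t := update s 26 0 e.1.
apply: (@runs_weaken _ _ (steps (26 <~ Read 6 (cell 22)) +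
  (cost (Eq (Read 15 (Read 18 (cell 26))) (Read 16 (Read 18 (cell 26)))) + 30).+1).+1 _
  (fun s' => main_inv s' /\ phi s = phi s' + 1000)); [|by []|by []].
apply: runs_sem_seq => //; rewrite (@sem_write_last _ _ _ _ 0 e.1) //; last first.
  by rewrite /= (rep_i rp) (st_rho st e0 li).
rewrite -/t; apply: runs_if.
have st' : static t by apply: static_update st.
have rp' : rep t P R stk i by case: rp.
have I' : walk_inv P R stk (ptr t) i by [].
have -> : den t (Eq (Read 15 (Read 18 (cell 26))) (Read 16 (Read 18 (cell 26)))) =
    (rankX P e.1 == rankX N e.1).
  rewrite -(inv_done_test sU ex I hy).
  rewrite -[LHS]/(nat_of_bool (s 15 (s 18 e.1) == s 16 (s 18 e.1))) (rep_cur rp hy hf).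
  by rewrite (rep_lo rp) (rep_hi rp) hs.
rewrite eqb0 negbK; case: eqP => E.
  apply: (@runs_weaken _ _ (steps (22 <~ (cell 22)+1)) _
    (fun s' => main_inv s' /\ phi t = phi s' + 1000)); [|by []|by []].
  apply: runs_sem => //.
  by apply: (next_step sU ex st' rp' I' li Es); exists e.
apply: (@runs_weaken _ _ (steps (push 26)) _
  (fun s' => main_inv s' /\ phi t = phi s' + 1000)); [|by []|by []].
apply: runs_sem => //; apply: (push_step (z := e.1) sU st' rp' li) => //.
  by rewrite Es.
rewrite Es; rewrite Es in I'; apply: (invariant_start I' li Ee).
by rewrite ltn_neqAle (inv_hi I) andbT; apply/eqP.
Qed.

Lemma top_step_spec s1 x : stk = rcons s1 x ->
  exists2 b, runs (load_top ;;
      If top_test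
         (If (Eq (Read 21 (cell 28)) (Const 0)) (push 28) emit)
         (Write 17 (cell 26) (Read 17 (cell 26))+1)) s b
     (fun s' => main_inv s' /\ b + phi s' + 50 <= phi s) & True.
Proof.
move=> Es; have hx : x \in stk by rewrite Es mem_rcons mem_head.
have us := inv_uniq I; have [y [hy Ey _]] := inv_candidate sU ex I hx.
have ix1 : index x stk = size s1.
  move: us; rewrite Es rcons_uniq => /andP [n _].
  by rewrite -cats1 index_cat (negPf n) /= eqxx addn0.
pose t := update (update (update (update s 26 0 x) 27 0 y) 31 0 (posY y x)) 28 0 (s 14 y).
have Et : sem load_top s = t.
  rewrite /load_top (@sem_write _ _ _ _ _ 0 x) //; last first.
    by rewrite /= (rep_sp rp) Es size_rcons subn1 -ix1 (rep_stk rp).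
  rewrite (@sem_write _ _ _ _ _ 0 y) //; last first.
    by rewrite /= /update /= (st_q st) -[s 17 x]/(ptr s x) -Ey (st_list st).
  rewrite (@sem_write _ _ _ _ _ 0 (posY y x)) //; last first.
    by rewrite /= /update /= (st_p st) (st_rank st) // -accept_sym.
have st' : static t by do 4 apply: static_update => //.
have rp' : rep t P R stk i by case: rp.
have I' : walk_inv P R stk (ptr t) i by [].
have ph : phi t = phi s by [].
have test : den t top_test = cond P x y.
  rewrite -[LHS]/((1 - (posY y x < s 15 y)) * (posY y x < s 16 y)).
  rewrite (rep_lo rp) (rep_hi rp) /cond.
  case: ifP => hs.
    by rewrite (ltnNge (posY y x)); case: (rankY N y <= posY y x); case: (posY y x < rankY P y).
  by rewrite (inv_rankY_out sU ex I) ?hs // muln0 [X in _ && X]ltnNge andbN.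
(* Loading the top of the stack and evaluating the test are charged to the difference between 150
   and 50. *)
have go b : (exists2 b', runs (if cond P x y then
      (If (Eq (Read 21 (cell 28)) (Const 0)) (push 28) emit) else
      (Write 17 (cell 26) (Read 17 (cell 26))+1)) t b'
      (fun s' => main_inv s' /\ b' + phi s' + 150 <= phi s) & b' = b) ->
   exists2 b, runs (load_top ;;
      If top_test
         (If (Eq (Read 21 (cell 28)) (Const 0)) (push 28) emit)
         (Write 17 (cell 26) (Read 17 (cell 26))+1)) s b
     (fun s' => main_inv s' /\ b + phi s' + 50 <= phi s) & True.
  move=> [b' hr _]; exists (steps load_top + (cost top_test + b').+1).+1 => //.
  apply: runs_sem_seq => //; rewrite Et; apply: runs_if; rewrite test eqb0 negbK.
  by apply: runs_weaken hr (leqnn _) _ => s' [h1 h2]; split=> //=; move: h2; rewrite /=; lia.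
case: (boolP (cond P x y)) go => [c|nc] go; last first.
  apply: go; exists (steps (Write 17 (cell 26) (Read 17 (cell 26))+1)) => //.
  apply: runs_sem => //.
  have [h1 h2] := skip_step sU ex st' rp' I' li Es (erefl _) hy Ey nc.
  by split=> //; rewrite -ph h2 /=; lia.
have [z hz lk] := inv_link_candidate sU ex I hx hy Ey c.
have ty : t 28 0 = z by apply: (rep_my rp hz (cond_snd sU ex I c)).
have d21 : den t (Eq (Read 21 (cell 28)) (Const 0)) = (z \notin stk).
  by rewrite -[LHS]/(nat_of_bool (s 21 (t 28 0) == 0)) ty (rep_pos rp); case: ifP.
case: (boolP (z \in stk)) => zs; last first.
  apply: go; exists (cost (Eq (Read 21 (cell 28)) (Const 0)) + steps (push 28)).+1 => //.
  apply: runs_if; rewrite d21 (negPf zs) /=.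
  apply: runs_sem => //.
  have I2 : walk_inv P R (rcons stk z) (ptr t) i.
    by rewrite Es in I' zs *; apply: (invariant_push sU ex I' lk zs).
  have [h1 h2] := push_step sU st' rp' li ty (isT : 28 \in [:: 26; 28]) zs I2.
  by split=> //; rewrite -ph h2 /=; lia.
have [s2 [c' Ec]] : exists s2 c', stk = s2 ++ z :: c'.
  by case/splitPr: zs => a b; exists a, b.
(* The top of the stack is the last agent of the segment starting at z, so its link to z closes the
   cycle. *)
have lz : last z c' = x.
  have := congr1 (last x) Es; rewrite last_rcons Ec last_cat /=; done.
have := emit_step sU ex st' rp' I' li Ec ty; rewrite lz => /(_ lk) hr.
apply: go; exists (cost (Eq (Read 21 (cell 28)) (Const 0)) +
   (200 * size (z :: c') + 100)).+1 => //.
apply: runs_if; rewrite d21 zs /=.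
apply: runs_weaken hr (leqnn _) _ => s' [h1 h2]; split=> //.
by rewrite -ph h2 /=; lia.
Qed.

End Step.

Lemma main_step s : main_inv s -> den s (Lt (cell 22) nR) != 0 -> exists2 b,
  runs main_body s b (fun s' => main_inv s' /\
    (cost (Lt (cell 22) nR) + b + phi s').+1 <= phi s) & True.
Proof.
move=> [st [P [R [stk [i [rp I _]]]]]]; rewrite /= (st_r st) (rep_i rp) eqb0 negbK => li.
case/lastP: stk rp I => [|s1 x] rp I.
  exists (cost (Eq (cell 23) (Const 0)) + 100).+1 => //.
  apply: runs_if; rewrite /= (rep_sp rp) /=.
  apply: runs_weaken (start_step_spec st rp I li erefl) (leqnn _) _.
  by move=> s' [h1 h2]; split=> //; rewrite h2; lia.
have [b hr _] := top_step_spec st rp I li erefl.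
exists (cost (Eq (cell 23) (Const 0)) + b).+1 => //.
apply: runs_if; rewrite /= (rep_sp rp) size_rcons /=.
apply: runs_weaken hr (leqnn _) _.
by move=> s' [h1 h2]; split=> //; move: h2; lia.
Qed.

Lemma main_loop_spec s : main_inv s ->
  runs (While (Lt (cell 22) nR) main_body) s (phi s + 10)
    (fun s' => exists R, [/\ outputs s' R, elim_seq T (filled T U rho) M R N &
       forall sigma, R = [:: sigma] -> forall e, ohead rho = Some e ->
         e.1 \in map fst sigma -> omap fst (ohead sigma) = Some e.1]).
Proof.
move=> I; apply: runs_weaken (runs_while main_step I) _ _; first by rewrite /=; lia.
move=> s' [[st [P [R [stk [i [rp I' le]]]]]] /=]; rewrite (st_r st) (rep_i rp) => /eqP.
rewrite eqb0 -leqNgt => ge; have Ei : i = size rho by lia.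
rewrite Ei in I'; exists R; split; first exact: rep_out rp.
  by have := inv_chain I'; rewrite (invariant_final sU ex I').
by move=> sigma E e he; apply: (inv_head I' E he).
Qed.

End MainStep.

(** * Initial memory *)

Lemma nth_flatten_rows (A : Type) (a : A) (ss : seq (seq A)) w u k :
  all (fun r => size r == w) ss -> k < w ->
  nth a (flatten ss) (u * w + k) = nth a (nth [::] ss u) k.
Proof.
move=> h lt; elim: ss u h => [|r ss IH] u /=; first by rewrite !nth_nil.
case/andP=> /eqP sr h; rewrite nth_cat sr; case: u => [|u] /=; first by rewrite lt.
rewrite ltnNge mulSn -addnA leq_addr /= addKn; exact: IH.
Qed.

Lemma nth_pad w l k : nth 0 (pad w l) k = nth 0 l k.
Proof.
rewrite /pad nth_cat; case: ltnP => // le; rewrite (nth_default _ le).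
by rewrite nth_nseq if_same.
Qed.

Lemma size_pad w l : size l <= w -> size (pad w l) = w.
Proof. by move=> le; rewrite size_cat size_nseq subnKC. Qed.

Lemma nth_ord_map n (A : Type) (a : A) (f : 'I_n -> A) (u : 'I_n) :
  nth a [seq f v | v <- enum 'I_n] u = f u.
Proof. by rewrite (nth_map u) ?size_enum_ord // nth_ord_enum. Qed.

Lemma uniq_ord_size n (l : seq 'I_n) : uniq l -> size l <= n.
Proof. by move=> u; have := max_card (mem l); rewrite (card_uniqP u) card_ord. Qed.

Section Input.
Variables (p q : nat) (T : instance 'I_p 'I_q).
Variables (U : {set 'I_p * 'I_q}) (rho : seq ('I_p * 'I_q)).

Local Notation inp := (input T U rho).

Lemma input_lenX (x : 'I_p) : inp 1 x = size (prefX T x).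
Proof. exact: nth_ord_map. Qed.

Lemma input_lenY (y : 'I_q) : inp 3 y = size (prefY T y).
Proof. exact: nth_ord_map. Qed.

Lemma input_listX (x : 'I_p) k : k < size (prefX T x) ->
  inp 2 (x * q + k) = nth 0 [seq val y | y <- prefX T x] k.
Proof.
move=> lt; rewrite /input /= nth_flatten_rows.
- by rewrite nth_ord_map nth_pad.
- by apply/allP=> _ /mapP [z _ ->]; rewrite size_pad // size_map uniq_ord_size ?prefX_uniq.
- exact: leq_trans lt (uniq_ord_size (prefX_uniq T x)).
Qed.

Lemma input_listY (y : 'I_q) k : k < size (prefY T y) ->
  inp 4 (y * p + k) = nth 0 [seq val x | x <- prefY T y] k.
Proof.
move=> lt; rewrite /input /= nth_flatten_rows.
- by rewrite nth_ord_map nth_pad.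
- by apply/allP=> _ /mapP [z _ ->]; rewrite size_pad // size_map uniq_ord_size ?prefY_uniq.
- exact: leq_trans lt (uniq_ord_size (prefY_uniq T y)).
Qed.

Lemma input_rhoX k e : k < size rho -> inp 6 k = (nth e rho k).1.
Proof. by move=> lt; rewrite /input /= (nth_map e). Qed.

Lemma input_rhoY k e : k < size rho -> inp 7 k = (nth e rho k).2.
Proof. by move=> lt; rewrite /input /= (nth_map e). Qed.

Lemma input_zero a k : 8 <= a -> inp a k = 0.
Proof. by move=> le; rewrite /input nth_default ?nth_nil // nth_default. Qed.

Lemma nth_all_leq (l : seq nat) n k : all (leq^~ n) l -> nth 0 l k <= n.
Proof.
move=> /allP h; case: (ltnP k (size l)) => lt; first by apply: h; apply: mem_nth.
by rewrite nth_default.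
Qed.

Lemma input_bounded : 1 <= p + q -> size rho <= p + q -> bounded (p + q) inp.
Proof.
move=> pq1 sr a k.
case: (ltnP a 8) => la; last by rewrite input_zero.
have ordX (x : 'I_p) : x <= p + q by apply: leq_trans (ltnW (ltn_ord x)) (leq_addr _ _).
have ordY (y : 'I_q) : y <= p + q by apply: leq_trans (ltnW (ltn_ord y)) (leq_addl _ _).
have padl w (l : seq nat) : all (leq^~ (p + q)) l -> all (leq^~ (p + q)) (pad w l).
  by move=> h; rewrite all_cat h; apply/allP=> v; rewrite mem_nseq => /andP [_ /eqP ->].
have flat (ss : seq (seq nat)) : all (all (leq^~ (p + q))) ss -> all (leq^~ (p + q)) (flatten ss).
  by move/allP=> h; apply/allP=> v /flattenP [l /h /allP hl]; apply: hl.
case: a la => [|[|[|[|[|[|[|[|a]]]]]]]] // _; apply: nth_all_leq => /=.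
- by rewrite leq_addr leq_addl sr.
- by apply/allP=> _ /mapP [x _ ->]; apply: leq_trans (uniq_ord_size (prefX_uniq T x)) (leq_addl _ _).
- apply: flat; apply/allP=> _ /mapP [x _ ->]; apply: padl.
  by apply/allP=> _ /mapP [y _ ->].
- by apply/allP=> _ /mapP [x _ ->]; apply: leq_trans (uniq_ord_size (prefY_uniq T x)) (leq_addr _ _).
- apply: flat; apply/allP=> _ /mapP [x _ ->]; apply: padl.
  by apply/allP=> _ /mapP [y _ ->].
- apply: flat; apply/allP=> _ /mapP [x _ ->]; apply/allP=> _ /mapP [y _ ->].
  exact: leq_trans (leq_b1 _) pq1.
- by apply/allP=> _ /mapP [e _ ->].
- by apply/allP=> _ /mapP [e _ ->].
Qed.

Definition tabled (s : store) :=
  [/\ forall a i, a \notin [:: 12; 13; 22; 30] -> s a i = inp a i,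
      forall (x : 'I_p) (y : 'I_q), x \in prefY T y -> s 12 (y * p + x) = posY T y x &
      forall (x : 'I_p) (y : 'I_q), y \in prefX T x -> s 13 (x * q + y) = posX T x y].

Lemma fills_spec :
  runs fills inp (((100 * p + 120) * q + 20) + ((100 * q + 120) * p + 20)).+1 tabled.
Proof.
pose LY u := oapp (fun y : 'I_q => [seq val x | x <- prefY T y]) [::] (insub u).
pose LX u := oapp (fun x : 'I_p => [seq val y | y <- prefX T x]) [::] (insub u).
have LYE (y : 'I_q) : LY y = [seq val x | x <- prefY T y] by rewrite /LY valK.
have LXE (x : 'I_p) : LX x = [seq val y | y <- prefX T x] by rewrite /LX valK.
apply: runs_seq; apply: runs_weaken.
- apply: (@fill_spec 3 4 12 nY nX q p LY) => //; try (by left); try (by right).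
  + by move=> u lt; rewrite (LYE (Ordinal lt)) map_inj_uniq ?prefY_uniq //; apply: val_inj.
  + by move=> u v lt; rewrite (LYE (Ordinal lt)) => /mapP [x _ ->]; apply: ltn_ord.
  + by move=> u lt; rewrite (LYE (Ordinal lt)) size_map -input_lenY.
  + move=> u k lt; rewrite (LYE (Ordinal lt)) size_map => lk.
    by rewrite -(input_listY lk).
- exact: leqnn.
move=> s1 [fr1 h1]; apply: runs_weaken.
- apply: (@fill_spec 1 2 13 nX nY p q LX) => //; try (by left); try (by right).
  + by rewrite /= fr1.
  + by rewrite /= fr1.
  + by move=> u lt; rewrite (LXE (Ordinal lt)) map_inj_uniq ?prefX_uniq //; apply: val_inj.
  + by move=> u v lt; rewrite (LXE (Ordinal lt)) => /mapP [x _ ->]; apply: ltn_ord.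
  + by move=> u lt; rewrite (LXE (Ordinal lt)) size_map fr1 // -input_lenX.
  + move=> u k lt; rewrite (LXE (Ordinal lt)) size_map => lk.
    by rewrite fr1 // -(input_listX lk).
- exact: leqnn.
move=> s2 [fr2 h2]; split.
- move=> a i; rewrite !inE !negb_or => /and4P [n1 n2 n3 n4].
  by rewrite fr2 ?fr1 // !inE !negb_or ?n1 ?n2 ?n3 ?n4.
- move=> x y hx; rewrite fr2 // h1 ?LYE ?ltn_ord //; last by apply: map_f.
  by rewrite index_map //; apply: val_inj.
- move=> x y hy; rewrite h2 ?LXE ?ltn_ord //; last by apply: map_f.
  by rewrite index_map //; apply: val_inj.
Qed.

End Input.

(** * Initialisation of the partners, ranks and pointers from [rho] *)

Section Init.
Variables (p q : nat) (T : instance 'I_p 'I_q).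
Variables (U M : {set 'I_p * 'I_q}) (rho : seq ('I_p * 'I_q)).
Hypothesis sU : U \subset edges T.
Hypothesis ex : exposed T U M rho.
Variables (e0 : 'I_p * 'I_q) (s0 : store).
Hypothesis tb : tabled T U rho s0.
Implicit Types (e f : 'I_p * 'I_q).

Local Notation posX := (posX T).
Local Notation posY := (posY T).

(** The pair before position k, cyclically: its x is rematched to the y at position k. *)
Let pv k := nth e0 rho (if k is k'.+1 then k' else (size rho).-1).

Lemma nxt_pv k : k < size rho -> pv k \in rho /\ nxt rho (pv k) = nth e0 rho k.
Proof.
move=> lt; have us := exposed_uniq ex.
have lt' : (if k is k'.+1 then k' else (size rho).-1) < size rho by case: k lt; lia.
have hin : pv k \in rho by apply: mem_nth.
split=> //; rewrite /nxt next_nth hin /pv index_uniq //.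
case: (rho) lt lt' {us hin} => //= a l; case: k => [|k] lt lt'.
  by rewrite nth_default.
exact: set_nth_default.
Qed.

Definition init_arrays := [:: 14; 15; 16; 17; 18; 22; 26; 27; 29].

Record init_inv (s : store) : Prop := InitInv {
  ii_frame : forall a i, a \notin init_arrays -> s a i = s0 a i;
  ii_le : s 22 0 <= size rho;
  ii_prev : s 29 0 = (pv (s 22 0)).1;
  ii_cur : forall e, e \in take (s 22 0) rho -> s 18 e.1 = e.2;
  ii_my : forall e, e \in take (s 22 0) rho -> s 14 e.2 = e.1;
  ii_ptr : forall e, e \in take (s 22 0) rho -> s 17 e.1 = (posX e.1 e.2).+1;
  ii_hi : forall e, e \in take (s 22 0) rho -> s 16 e.2 = posY e.2 e.1;
  ii_lo : forall f, f \in rho -> nxt rho f \in take (s 22 0) rho ->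
    s 15 (nxt rho f).2 = posY (nxt rho f).2 f.1;
  ii_lo0 : forall y : 'I_q, y \notin map snd (take (s 22 0) rho) -> s 15 y = 0;
  ii_hi0 : forall y : 'I_q, y \notin map snd (take (s 22 0) rho) -> s 16 y = 0 }.

Lemma init_body_step s : init_inv s -> s 22 0 < size rho ->
  init_inv (sem init_body s) /\ sem init_body s 22 0 = (s 22 0).+1.
Proof.
move=> [fr le hp hc hm hptr hh hl hl0 hh0] lt; set k := s 22 0 in le hp hc hm hptr hh hl hl0 hh0 lt *.
have [tf trY trX] := tb.
pose e := nth e0 rho k; have he : e \in rho by apply: mem_nth.
have [hf Ef] := nxt_pv lt; rewrite -/e in Ef; set f := pv k in hp hf Ef.
have stM := exposed_stable ex.
have eE : (e.1, e.2) \in edges T.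
  by rewrite -surjective_pairing (subsetP (stable_sub sU stM)) ?(exposed_in ex).
have fE : (f.1, e.2) \in edges T by rewrite (subsetP sU) // -Ef (exposed_table ex).
have us := exposed_uniq ex.
have Et : take k.+1 rho = rcons (take k rho) e by apply: take_nth.
have ne : e \notin take k rho.
  by have := take_uniq k.+1 us; rewrite Et rcons_uniq => /andP [].
have mt g : g \in take k rho -> g \in rho by apply: mem_take.
have d1 g : g \in take k rho -> (val g.1 == val e.1) = false.
  move=> hg; apply/negP=> /eqP /val_inj E.
  by move: ne; rewrite -(exposed_inj1 ex (mt g hg) he E) hg.
have d2 g : g \in take k rho -> (val g.2 == val e.2) = false.
  move=> hg; apply/negP=> /eqP /val_inj E.
  by move: ne; rewrite -(exposed_inj2 ex (mt g hg) he E) hg.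
rewrite /init_body.
rewrite (@sem_write _ _ _ _ _ 0 e.1) //; last first.
  by rewrite /= fr // tf // (input_rhoX _ _ e0).
rewrite (@sem_write _ _ _ _ _ 0 e.2) //; last first.
  by rewrite /= /update /= fr // tf // (input_rhoY _ _ e0).
rewrite (@sem_write _ _ _ _ _ e.1 e.2) //.
rewrite (@sem_write _ _ _ _ _ e.2 e.1) //.
rewrite (@sem_write _ _ _ _ _ e.1 (posX e.1 e.2).+1) //; last first.
  by rewrite /= /update /= !fr // (tf 0) // trX ?addn1 // -mem_edges.
rewrite (@sem_write _ _ _ _ _ e.2 (posY e.2 e.1)) //; last first.
  by rewrite /= /update /= !fr // (tf 0) // trY // -mem_edgesY.
rewrite (@sem_write _ _ _ _ _ e.2 (posY e.2 f.1)) //; last first.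
  by rewrite /= /update /= hp !fr // (tf 0) // trY // -mem_edgesY.
rewrite (@sem_write _ _ _ _ _ 0 e.1) //.
rewrite (@sem_write_last _ _ _ _ 0 k.+1) //; last first.
  by rewrite /= /update /= addn1.
rewrite update_eq; split=> //; split; rewrite ?update_eq //.
- move=> a i na; rewrite !update_array ?fr //; by apply: contraNneq na => ->.
- move=> g; rewrite Et mem_rcons inE /update /= => /orP [/eqP ->|hg]; first by rewrite eqxx.
  by rewrite d1 // hc.
- move=> g; rewrite Et mem_rcons inE /update /= => /orP [/eqP ->|hg]; first by rewrite eqxx.
  by rewrite d2 // hm.
- move=> g; rewrite Et mem_rcons inE /update /= => /orP [/eqP ->|hg]; first by rewrite eqxx.
  by rewrite d1 // hptr.
- move=> g; rewrite Et mem_rcons inE /update /= => /orP [/eqP ->|hg]; first by rewrite eqxx.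
  by rewrite d2 // hh.
- move=> g hg; rewrite Et mem_rcons inE /update /= => /orP [/eqP E|hg'].
    rewrite E eqxx; congr (posY _ _.1).
    by rewrite -(prev_nxt us g) E -Ef prev_nxt.
  by rewrite d2 // hl.
- move=> y; rewrite Et map_rcons mem_rcons inE negb_or => /andP [n1 n2].
  by rewrite /update /= ifN ?hl0.
- move=> y; rewrite Et map_rcons mem_rcons inE negb_or => /andP [n1 n2].
  by rewrite /update /= ifN ?hh0.
Qed.

Lemma init_spec : runs (init ;; 22 <~ Const 0) s0 (200 * size rho + 100)
  (fun s => main_inv T U M rho s /\ s 23 0 = 0).
Proof.
have [tf trY trX] := tb; have stM := exposed_stable ex; have mM := stable_match stM.
apply: (@runs_weaken _ _ ((200 * size rho + 50) + steps (22 <~ Const 0)).+1 _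
  (fun s => main_inv T U M rho s /\ s 23 0 = 0)); [|by rewrite /=; lia|by []].
have ne : 0 < size rho by case: ex => _ [] ; case: (rho).
apply: runs_seq; apply: (@runs_weaken _ _ _ _ (fun s => init_inv s /\ den s (Lt (cell 22) nR) = 0)).
- apply: runs_sem_seq => //.
  apply: (@runs_while _ _ init_inv (fun s => 200 * (size rho - s 22 0))).
    move=> s1 I1; rewrite /= (ii_frame I1 (a := 0)) // tf // eqb0 negbK => lt.
    have [I2 E2] := init_body_step I1 lt; exists (steps init_body) => //.
    by apply: runs_sem => //; split=> //; rewrite E2 /=; move: lt; rewrite /input /=; lia.
  rewrite (@sem_write _ _ _ _ _ 0 (pv 0).1) //; last first.
    by rewrite /= !tf // subn1 (input_rhoX _ _ e0) // /input /=; lia.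
  rewrite (@sem_write_last _ _ _ _ 0 0) //.
  split; rewrite ?update_eq ?take0 //.
  + by move=> a i na; rewrite !update_array //; apply: contraNneq na => ->.
  + by move=> y _; rewrite /update /= tf // input_zero.
  + by move=> y _; rewrite /update /= tf // input_zero.
- rewrite /=; set s1 := update _ _ _ _; rewrite -[s1 22 0]/0 subn0; lia.
move=> s1 [I1]; rewrite /= (ii_frame I1 (a := 0)) // tf // => /eqP.
rewrite eqb0 -leqNgt -[input _ _ _ 0 2]/(size rho) => ge.
have E : s1 22 0 = size rho by have := ii_le I1; lia.
case: I1 => fr _ _ hc hm hptr hh hl hl0 hh0; rewrite E take_size in hc hm hptr hh hl hl0 hh0.
apply: runs_sem => //; rewrite (@sem_write_last _ _ _ _ 0 0) //.
have fr' a i : a \notin init_arrays -> a \notin [:: 12; 13; 22; 30] ->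
    update s1 22 0 0 a i = input T U rho a i.
  move=> n1 n2; rewrite update_array ?fr ?tf //.
  by apply: contraNneq n2 => ->.
set s2 := update _ _ _ _ in fr' *.
split; last by rewrite fr' // input_zero.
split.
  split; rewrite ?fr' //.
  + move=> x y hy; rewrite fr' // input_listX ?index_mem //.
    by rewrite (nth_map y) ?index_mem // nth_index.
  + by move=> x y hx; rewrite -[s2 12 _]/(s1 12 (y * p + x)) fr // trY.
  + by move=> k e lt; rewrite fr' // (input_rhoX _ _ e).
exists M, [::], [::], 0; split=> //; last first.
  by apply: (invariant_init sU ex) => e he; rewrite -hptr.
split=> //.
- move=> x y hM /mem_sndP [e he Ey]; rewrite Ey -[s2 14 _]/(s1 14 e.2) hm //.
  have := exposed_in ex he; rewrite (surjective_pairing e) -Ey => hM'.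
  by rewrite (mM.2 _ _ _ hM hM').
- move=> y; rewrite -[s2 15 _]/(s1 15 y); case: ifP => [/mem_sndP [e he ->]|/negbT n].
    have [f hf <-] := next_surj ex he.
    by rewrite hl ?mem_nxt // (rankY_elim_in ex hf).
  exact: hl0.
- move=> y; rewrite -[s2 16 _]/(s1 16 y); case: ifP => [/mem_sndP [e he ->]|/negbT n].
    by rewrite hh // (exposed_rankY ex he).
  exact: hh0.
- move=> x y hM /mem_fstP [e he Ex]; rewrite Ex -[s2 18 _]/(s1 18 e.1) hc //.
  have := exposed_in ex he; rewrite (surjective_pairing e) -Ex => hM'.
  by rewrite (mM.1 _ _ _ hM hM').
- by move=> x; rewrite fr' // input_zero.
- by rewrite fr' // input_zero.
- by rewrite fr' // input_zero.
- by split; rewrite ?fr' ?input_zero.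
Qed.

End Init.

Theorem theorem6 :
  exists (prog : cmd) (c d : nat),
    forall (p q : nat) (T : instance 'I_p 'I_q)
           (T' : {set 'I_p * 'I_q}) (rho : seq ('I_p * 'I_q)),
      T' \subset edges T -> stable_table T T' -> is_rotation T T' rho ->
      exists (t : nat) (s : store) (R : seq (seq ('I_p * 'I_q))),
        [/\ exec ((p + q) ^ d) prog (input T T' rho) t s,
            t <= c * (p + q) ^ 2,
            outputs s R &
            solves_DR T T' rho R].
Proof.
(* With n = p + q >= 4, the values stored are at most n + 4000 n^2 <= 4096 n^2 <= n^8. Expressions
   cost at most 16, so their values are at most n^128, which is below n^129. *)
exists prog, 4000, 129 => p q T U rho sU _ rot.
have [M0 [M [opt pre ex]]] := predecessor_elim sU rot.
have [e0 he0] := exposed_ne ex.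
have [u1 u2] : uniq (map fst rho) /\ uniq (map snd rho) by case: ex => _ [].
have rp : size rho <= p by have := uniq_ord_size u1; rewrite size_map.
have rq : size rho <= q by have := uniq_ord_size u2; rewrite size_map.
(* In a rotation with a single pair, y_0 would be its own successor and x_0 would strictly prefer it
   to itself. Hence p and q are at least 2. *)
have r2 : 2 <= size rho.
  case: rho ex he0 {rot pre u1 u2 rp rq} => [//|e [|//]] ex _.
  have he : e \in [:: e] by apply: mem_head.
  by have := exposed_ltX ex he; rewrite /nxt /= eqxx ltnn.
have fin s : main_inv T U M rho s /\ s 23 0 = 0 ->
    runs (While (Lt (cell 22) nR) main_body) s (1000 * (2 * (p * q.+1) + 2 * p) + 10)
    (fun s' => exists2 R, outputs s' R & solves_DR T U rho R).
  move=> [I _]; apply: runs_weaken (main_loop_spec sU ex I) _ _.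
    have hr : unscanned p q s <= p * q.+1.
      have le : unscanned p q s <= \sum_(x : 'I_p) q.+1.
        by apply: leq_sum => x _; apply: leq_subr.
      by rewrite sum_nat_const card_ord in le.
    by rewrite leq_add2r /phi leq_mul2l /=; lia.
  by move=> s' [R [h1 h2 h3]]; exists R => //; apply: (chain_solves_DR sU ex opt pre h2 h3).
have [t [s [hex le [R out sol]]]] : runs prog (input T U rho)
    (4000 * (p + q) ^ 2) (fun s' => exists2 R, outputs s' R & solves_DR T U rho R).
  rewrite /prog; apply: (@runs_weaken _ _ _ _ (fun s' => exists2 R, outputs s' R & solves_DR T U rho R)).
  - apply: runs_seq; apply: runs_weaken (fills_spec T U rho) (leqnn _) _ => s1 tb.
    apply: runs_seq; apply: runs_weaken (init_spec sU ex e0 tb) (leqnn _) fin.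
  (* As p and q are at least 2, the terms linear in p and q are absorbed by the product. *)
  - have h1 : 2 * p <= p * q by rewrite mulnC leq_mul2l; lia.
    have h2 : 2 * q <= p * q by rewrite leq_mul2r; lia.
    have -> : (p + q) ^ 2 = p * p + 2 * (p * q) + q * q by rewrite sqrnD; lia.
    by lia.
  by [].
have n4 : 4 <= p + q by lia.
exists t, s, R; split=> //.
have [] // := uexec_exec (K := 16) (W := (p + q) ^ 129) hex (B := p + q).
- by apply: input_bounded; lia.
- by lia.
have h6 : 4096 <= (p + q) ^ 6 by rewrite -[4096]/(4 ^ 6) leq_exp2r.
have h8 : p + q + t <= (p + q) ^ 8.
  have -> : (p + q) ^ 8 = (p + q) ^ 6 * (p + q) ^ 2 by rewrite -expnD.
  apply: leq_trans (leq_mul h6 (leqnn _)).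
  have : p + q <= (p + q) ^ 2 by rewrite -{1}(expn1 (p + q)) leq_exp2l //; lia.
  by lia.
apply: (@leq_ltn_trans (((p + q) ^ 8) ^ 16)); first by rewrite leq_exp2r.
by rewrite -expnM ltn_exp2l //; lia.
Qed.
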